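(* Let $L=\log x$, $L_2=\log_2 x$, $\mathcal A=\log_3 x+\log_4 x-\log 2$, $\mathcal R=\sqrt{LL_2}$ and $\eta=\mathcal A^{-1/2}$. For all sufficiently large $x$ define, in the displayed order, $$E=(\tfrac12-\eta)\mathcal R,\qquad K_0=(\tfrac12-2\eta)\mathcal R,\qquad T=\frac{L\mathcal A}{2E},$$ $$J=\left\lfloor\frac{K_0}{T}\right\rfloor,\qquad K=JT,\qquad y=e^T,\qquad Z=e^K.$$ Then, as $x\to\infty$, $$T=(1+o(1))\mathcal A\sqrt{\frac{L}{L_2}},\qquad J=(\tfrac12+o(1))\frac{L_2}{\mathcal A},\qquad K=(\tfrac12-2\eta+o(\eta))\mathcal R.$$ There is a function $\varepsilon_{\rm mov}(x)\to0$ such that, uniformly for positive integers $1\le h\le y$, $$S_h^\varphi(x)=D_{h,>Z}^\varphi(x)+O\!\left(x\exp\{-K+\varepsilon_{\rm mov}(x)\,\eta\mathcal R\}\right).$$ Consequently the error is $x\exp\{-(\tfrac12-o(1))\sqrt{\log x\,\log_2 x}\}$. For odd $h$ the diagonal is empty, i.e. $D_{h,>Z}^\varphi(x)=0$.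
   Context: $\varphi$ is Euler's totient function; $P^+(m)$ is the largest prime factor of $m$, with $P^+(1)=1$; $\operatorname{rad}(m)$ is the product of the distinct primes dividing $m$; $\log_j x$ is the $j$-fold iterated logarithm. Count: $S_h^\varphi(x)=\#\{n\le x:\varphi(n)=\varphi(n+h)\}$ ($n$ a positive integer). Diagonal: for $h\ge1$ let $\mathcal J_h=\{j\ge1:\operatorname{rad}(j)=\operatorname{rad}(j+h)\}$. For $j\in\mathcal J_h$ put $d_j=\gcd(j,j+h)$, $A_j=(j+h)/d_j$, $B_j=j/d_j$, $\Gamma_j=\varphi(j)A_j$. For $Y\ge2$, $D_{h,>Y}^\varphi(x)$ is the number of integers $n\le x$ for which there is at least one pair $(j,r)$ with $j\in\mathcal J_h$, $r\ge1$ an integer, $n=j(A_jr+1)$, $n+h=(j+h)(B_jr+1)$, $A_jr+1$ and $B_jr+1$ both prime, $\gcd(A_jr+1,j)=1$, $\gcd(B_jr+1,j+h)=1$, and $P^+(\Gamma_jr)>Y$ (multiple representations of the same $n$ are counted once). The implied constant in $O(\cdot)$ is absolute. *)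

(* Defs.v *)
From HB Require Import structures.
From mathcomp Require Import all_boot all_order all_algebra.
From mathcomp Require Import all_classical all_reals all_analysis.
Import Order.TTheory GRing.Theory Num.Theory.
Import numFieldNormedType.Exports.

Set Implicit Arguments.
Unset Strict Implicit.
Unset Printing Implicit Defensive.

Local Open Scope ring_scope.

Definition rad (m : nat) : nat := (\prod_(p <- primes m) p)%N.

Definition diag_index (h j : nat) : bool :=
  (0 < j)%N && (rad j == rad (j + h)%N).

Definition diag_A (h j : nat) : nat := ((j + h) %/ gcdn j (j + h))%N.

Definition diag_B (h j : nat) : nat := (j %/ gcdn j (j + h))%N.

Definition diag_Gamma (h j : nat) : nat := (totient j * diag_A h j)%N.

(* [max_pdiv] is the largest prime factor, with [max_pdiv 1 = 1]. *)
Definition diag_rep (R : realType) (h : nat) (Y : R) (n j r : nat) : Prop :=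
  let q1 := (diag_A h j * r + 1)%N in
  let q2 := (diag_B h j * r + 1)%N in
  [/\ diag_index h j /\ (0 < r)%N,
      n = (j * q1)%N /\ (n + h = (j + h) * q2)%N,
      prime q1 /\ prime q2,
      coprime q1 j /\ coprime q2 (j + h)
    & Y < (max_pdiv (diag_Gamma h j * r))%:R].

Definition S_phi (R : realType) (h : nat) (x : R) : nat :=
  #|[set n : 'I_(Num.truncn x).+1 |
      (0 < n)%N & totient n == totient (n + h)]|.

Definition D_phi (R : realType) (h : nat) (Y x : R) : nat :=
  #|[set n : 'I_(Num.truncn x).+1 |
      (0 < n)%N & `[< exists j r : nat, diag_rep h Y n j r >]]|.

Definition iter_ln (R : realType) (j : nat) (x : R) : R := iter j (@ln R) x.

(* The functions below carry their intended meaning for large [x] only: [ln]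
   is 0 on nonpositive reals, [_^-1] is 0 at 0. *)
Definition calA (R : realType) (x : R) : R := iter_ln 3 x + iter_ln 4 x - ln 2.

Definition calR (R : realType) (x : R) : R := Num.sqrt (ln x * iter_ln 2 x).

Definition par_eta (R : realType) (x : R) : R := (Num.sqrt (calA x))^-1.

Definition par_E (R : realType) (x : R) : R := (2^-1 - par_eta x) * calR x.

Definition par_K0 (R : realType) (x : R) : R := (2^-1 - 2 * par_eta x) * calR x.

Definition par_T (R : realType) (x : R) : R := ln x * calA x / (2 * par_E x).

Definition par_J (R : realType) (x : R) : int := Num.floor (par_K0 x / par_T x).

Definition par_K (R : realType) (x : R) : R := (par_J x)%:~R * par_T x.

Definition par_y (R : realType) (x : R) : R := expR (par_T x).

Definition par_Z (R : realType) (x : R) : R := expR (par_K x).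

(* Main.v *)
Require Import Defs.
From HB Require Import structures.
From mathcomp Require Import all_boot all_order all_algebra.
From mathcomp Require Import all_classical all_reals all_analysis.
From mathcomp Require Import ring lra zify.
Import Order.TTheory GRing.Theory Num.Theory.
Import numFieldNormedType.Exports.

(* Write L = log x, R = sqrt (log x * log_2 x), Z = e^K and n' = n + h.  A
   solution n whose largest prime p, and the largest prime p' of n', exceed Z
   is n = m p, n' = m' p'.  Either phi(m) m' = phi(m') m, which forces
   m' = m + h and gives a diagonal representation, or (m, m') determines p, so
   that solutions with m m' <= x / Z are few.  Otherwise p p' <= 2 x Z.

   Put lam = R / (2 L) and call primes above e^(1/lam) rough.  A rough divisor d
   of phi(W) costs a factor d in sum 1/W up to (log x)^(number of primes of d),
   and a rough d of size a power of Z has O(log_2 x) prime factors, so this loss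
   is only exp(O((log_2 x)^2)).  Hence few n have divisors W | n, W' | n' with
   a common d | phi(W), phi(W'), d > Z and W W' not much larger than x; the same
   holds for n = m p with d | p - 1, d | phi(W'), m d W' <= x.  If p or p' is
   larger than sqrt x * Z^4, splitting n' (or n) into boundedly many coprime
   parts below sqrt x / Z^3, and otherwise splitting both below sqrt x * Z^4,
   shows that apart from these few n the rough part of phi(n) or phi(n') (away
   from primes below Z) is at most a fixed power of Z.  Rankin's method with
   exponent 1 - lam and weight (rough part)^(-2 lam) shows that such integers
   number at most x^(1 - lam) e^(O(T)) <= (x / Z) e^(O(T)), because
   sum_q q^(lam - 1) (rough part of q - 1)^(-2 lam) = O(1 / lam), even over all
   integers q.  Since T = o(eta R), every loss e^(O(T)) is admissible. *)

Set Implicit Arguments.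
Unset Strict Implicit.
Unset Printing Implicit Defensive.

Local Open Scope ring_scope.

(** * Congruence counting and radicals *)

(** All losses must stay within e^(O(T)), and this fixes lam from both sides. Put u = sqrt (log x /
    log_2 x), so that lam = 1 / (2 u). Then x^(-lam) = e^(-R/2) is at most 1 / Z, while 1 / lam = 2
    u is smaller than T, which is about A u with A = log_3 x + log_4 x - log 2. A sum of size O(1 /
    lam) is therefore affordable in the exponent of an Euler product, and no information on primes
    in progressions has to enter. The requirement that W W' be not much larger than x comes from the
    congruence counts: each one carries an additive error 1, which is absorbed only if x d / (W W')
    is at least Z. The power of Z allowed for the rough part is 225 = 9 . 5 . 5. With both divisors
    below sqrt x Z^4 the product W W' may reach x Z^8, so d has to exceed Z^9; each of the two
    splittings behind such a pair pigeonholes over at most five parts and costs a fifth root. *)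

Lemma count_le_congruent (X Q : nat) (B : pred nat) : (0 < Q)%N ->
  (forall m n, (0 < m)%N -> (m <= n)%N -> (n <= X)%N -> B m -> B n -> (Q %| n - m)%N) ->
  (count B (iota 1 X) <= X %/ Q + 1)%N.
Proof.
move=> Q0; elim/ltn_ind: X => X IH HB.
(* A window of at most [Q] consecutive integers holds at most one element of [B]; full windows are
   then peeled off at the right end. *)
have window a k : (0 < a)%N -> (k <= Q)%N -> (a + k <= X.+1)%N ->
    (count B (iota a k) <= 1)%N.
  move=> a0 kQ akX; rewrite leqNgt; apply/negP; rewrite -size_filter => h.
  have : sorted ltn (seq.filter B (iota a k)).
    by apply: sorted_filter; [exact: ltn_trans | exact: iota_ltn_sorted].
  move: h; case E : (seq.filter _ _) => [|b [|c s]] //= _ /andP[bc _].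
  have : b \in seq.filter B (iota a k) by rewrite E inE eqxx.
  rewrite mem_filter mem_iota => /andP[Bb /andP[ab bX]].
  have : c \in seq.filter B (iota a k) by rewrite E !inE eqxx orbT.
  rewrite mem_filter mem_iota => /andP[Bc /andP[ac cX]].
  have b0 : (0 < b)%N by lia.
  have cX' : (c <= X)%N by lia.
  have := HB b c b0 (ltnW bc) cX' Bb Bc => /dvdn_leq; rewrite subn_gt0 bc => /(_ isT).
  by lia.
case: (leqP X Q) => [XQ|QX].
  by rewrite (leq_trans (window 1%N X isT XQ _))// ?leq_addl// add1n.
have eX : X = (X - Q + Q)%N by rewrite subnK// ltnW.
have h2 : (count B (iota 1 (X - Q)) <= (X - Q) %/ Q + 1)%N.
  apply: IH; first by lia.
  by move=> m n m0 mn nX; apply: HB => //; lia.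
have -> : (X %/ Q = (X - Q) %/ Q + 1)%N by rewrite {1}eX divnDr// divnn Q0.
rewrite {1}eX iotaD count_cat (leq_trans (leq_add h2 (window _ _ _ _ _)))//; lia.
Qed.

Lemma rad_gt0 m : (0 < Defs.rad m)%N.
Proof. by rewrite /Defs.rad big_seq prodn_cond_gt0// => p /[!mem_primes]/andP[/prime_gt0]. Qed.

Lemma totient_rad m : (0 < m)%N ->
  (totient m * Defs.rad m = m * \prod_(p <- primes m) p.-1)%N.
Proof.
move=> m0; rewrite totientE// [X in _ = (X * _)%N](prod_prime_decomp m0) prime_decompE big_map /Defs.rad /=.
rewrite -big_split/= -big_split/= big_seq [RHS]big_seq; apply: eq_bigr => p.
rewrite -logn_gt0 => h.
by rewrite -{2}(prednK h) expnS; lia.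
Qed.

Lemma logn_prod (I : eqType) (r : seq I) (F : I -> nat) q :
  (forall i, i \in r -> (0 < F i)%N) ->
  logn q (\prod_(i <- r) F i) = (\sum_(i <- r) logn q (F i))%N.
Proof.
elim: r => [|i r IH] h; first by rewrite !big_nil logn1.
have hr j : j \in r -> (0 < F j)%N by move=> jr; apply: h; rewrite inE jr orbT.
rewrite !big_cons lognM ?IH //; first by apply: h; rewrite inE eqxx.
by rewrite big_seq prodn_cond_gt0// => j jr; apply: h; rewrite inE jr orbT.
Qed.

Lemma prime_pred_gt0 m p : p \in primes m -> (0 < p.-1)%N.
Proof. by rewrite mem_primes => /andP[/prime_gt1]; lia. Qed.

(* Comparing [q]-adic valuations from the largest prime [q] downwards: only
   primes [p > q] contribute to the valuation of [\prod (p - 1)]. *)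
Lemma rad_inj_totient m n : (0 < m)%N -> (0 < n)%N ->
  (totient m * n = totient n * m)%N -> Defs.rad m = Defs.rad n.
Proof.
move=> m0 n0 e.
(* By Euler's product the hypothesis becomes an identity between products over the primes of [m] and
   of [n], from which the exponents have disappeared. *)
have e1 : (\prod_(p <- primes m) p.-1 * Defs.rad n = \prod_(p <- primes n) p.-1 * Defs.rad m)%N.
  apply/eqP; rewrite -(eqn_pmul2l (m:=(m * n)%N)) ?muln_gt0 ?m0 ?n0//; apply/eqP.
  have := totient_rad m0; have := totient_rad n0; move: e.
  move: (totient m) (totient n) (Defs.rad m) (Defs.rad n) => a b c d.
  move: (\prod_(p <- primes m) _)%N (\prod_(p <- primes n) _)%N => u v h1 h2 h3.
  have -> : (m * n * (u * d) = (m * u) * (n * d))%N by ring.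
  have -> : (m * n * (v * c) = (n * v) * (m * c))%N by ring.
  rewrite -h2 -h3.
  have -> : (a * c * (n * d) = (a * n) * (c * d))%N by ring.
  by rewrite h1; ring.
have lrad q k : prime q -> logn q (Defs.rad k) = (q \in primes k).
  move=> pq; rewrite /Defs.rad logn_prod; last first.
    by move=> p; rewrite mem_primes => /andP[/prime_gt0].
  rewrite big_seq (eq_bigr (fun p => (q == p) : nat)); last first.
    by move=> p; rewrite mem_primes => /andP[pp _]; rewrite logn_prime.
  rewrite -big_seq; case: (boolP (q \in primes k)) => [qk|qk].
    rewrite (bigD1_seq q)//= ?primes_uniq// eqxx big1 ?addn0// => i.
    by rewrite eq_sym => /negbTE ->.
  rewrite big_seq big1// => i ik; case: eqP => // qi.
  by rewrite qi ik in qk.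
have sumv q k : prime q -> logn q (\prod_(p <- primes k) p.-1) =
    (\sum_(p <- primes k | (q < p)%N) logn q p.-1)%N.
  move=> pq; rewrite logn_prod; last by move=> p; exact: prime_pred_gt0.
  rewrite [RHS]big_mkcond/=; rewrite big_seq [RHS]big_seq; apply: eq_bigr => p pk.
  case: ltnP => // pleq; apply/eqP; rewrite -leqn0 leqNgt logn_gt0 mem_primes.
  rewrite negb_and -implybE; apply/implyP => _; apply/negP => /andP[a] /dvdn_leq.
  by rewrite a => /(_ isT); have := prime_pred_gt0 pk; lia.
(* The descent in [q] is an induction on [k]: for [k = 0] the prime [q] exceeds [m + n] and divides
   neither number. *)
have key k : forall q, (m + n < q + k)%N -> prime q -> (q \in primes m) = (q \in primes n).
  elim: k => [|k IH] q hq pq.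
    have h j : (0 < j)%N -> (j <= m + n)%N -> (q \in primes j) = false.
      move=> j0 jl; rewrite mem_primes; apply/negP => /and3P[_ _ /dvdn_leq] /(_ j0); lia.
    by rewrite !h//; lia.
  have := congr1 (logn q) e1.
  rewrite !lognM ?rad_gt0//; try by rewrite big_seq prodn_cond_gt0// => p; exact: prime_pred_gt0.
  rewrite !lrad// !sumv//.
  suff -> : (\sum_(p <- primes m | (q < p)%N) logn q p.-1 =
             \sum_(p <- primes n | (q < p)%N) logn q p.-1)%N.
    by move/eqP; rewrite eqn_add2l => /eqP; do 2 case: (q \in _).
  rewrite -big_filter -[RHS]big_filter; congr bigop.
  apply: (irr_sorted_eq ltn_trans ltnn).
  - by apply: sorted_filter; [exact: ltn_trans | exact: sorted_primes].
  - by apply: sorted_filter; [exact: ltn_trans | exact: sorted_primes].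
  move=> p; rewrite !mem_filter; case: ltnP => //= qp.
  case: (boolP (prime p)) => pp; first by apply: IH => //; lia.
  by rewrite !mem_primes (negbTE pp).
have e2 : primes m = primes n.
  apply: (irr_sorted_eq ltn_trans ltnn); rewrite ?sorted_primes// => p.
  case: (boolP (prime p)) => pp; first by apply: (key (m + n).+1) => //; lia.
  by rewrite !mem_primes (negbTE pp).
by rewrite /Defs.rad e2.
Qed.

Lemma dvdn_rad p n : prime p -> (0 < n)%N -> (p %| Defs.rad n)%N = (p %| n)%N.
Proof.
move=> pp n0; apply/idP/idP => [|pn].
  rewrite /Defs.rad Euclid_dvd_prod// big_has => /hasP[q].
  by rewrite mem_primes => /and3P[pq _ qn]; rewrite dvdn_prime2// => /eqP ->.
have pn' : p \in primes n by rewrite mem_primes pp n0.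
by rewrite /Defs.rad (big_rem p)//= dvdn_mulr.
Qed.

Lemma eq_rad_primes m n : (0 < m)%N -> (0 < n)%N -> Defs.rad m = Defs.rad n ->
  primes m = primes n.
Proof.
move=> m0 n0 e; apply: (irr_sorted_eq ltn_trans ltnn); rewrite ?sorted_primes// => p.
rewrite !mem_primes m0 n0/=; case pp: (prime p) => //=.
by rewrite -(dvdn_rad pp m0) -(dvdn_rad pp n0) e.
Qed.

(** * Divisors of totients *)

(** Omega(d) <= k, primes counted with multiplicity. The witnessing list makes the passage to
    divisors and quotients an induction on lists. *)
Definition short (k d : nat) : Prop :=
  exists2 s : seq nat, all prime s && (size s <= k)%N & (\prod_(p <- s) p)%N = d.

Lemma prime_factorization d : (0 < d)%N ->
  exists2 s : seq nat, all prime s & (\prod_(p <- s) p)%N = d.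
Proof.
elim/ltn_ind: d => d IH d0; case: (ltngtP d 1%N) => [|d1|->]; first by lia.
  have p1 := pdiv_prime d1.
  have := divnK (pdiv_dvd d) => e.
  have d'0 : (0 < d %/ pdiv d)%N by rewrite divn_gt0 ?pdiv_gt0// dvdn_leq// pdiv_dvd.
  have d'd : (d %/ pdiv d < d)%N by rewrite ltn_Pdiv// prime_gt1.
  have [s ps es] := IH _ d'd d'0.
  by exists (pdiv d :: s); [rewrite /= p1 | rewrite big_cons es mulnC].
by exists [::]; rewrite ?big_nil.
Qed.

Lemma prod_primes_gt0 (s : seq nat) : all prime s -> (0 < \prod_(p <- s) p)%N.
Proof.
by move=> /allP ps; rewrite big_seq prodn_cond_gt0// => p /ps /prime_gt0.
Qed.

Lemma short_dvd k d e : short k d -> (e %| d)%N -> short k e.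
Proof.
case=> s /andP[ps sk] <- {d}.
suff H t : all prime t -> (e %| \prod_(p <- t) p)%N ->
    exists2 u, all prime u && (size u <= size t)%N & (\prod_(p <- u) p)%N = e.
  move=> /(H _ ps)[u /andP[pu us] eu]; exists u => //.
  by rewrite pu (leq_trans us).
elim: t e {s ps sk} => [|q t IH] e.
  by rewrite big_nil dvdn1 => _ /eqP ->; exists [::]; rewrite ?big_nil.
rewrite /= big_cons => /andP[pq pt] h.
have [qe|qe] := boolP (q %| e)%N.
  have q0 := prime_gt0 pq.
  have h' : (e %/ q %| \prod_(p <- t) p)%N.
    by rewrite -(dvdn_pmul2l q0) mulnC divnK.
  have [u /andP[pu us] eu] := IH _ pt h'.
  by exists (q :: u); rewrite /= ?pq ?pu// big_cons eu mulnC divnK.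
have h' : (e %| \prod_(p <- t) p)%N.
  by rewrite -(Gauss_dvdr _ (n:=q))// coprime_sym prime_coprime.
have [u /andP[pu us] eu] := IH _ pt h'.
by exists u => //; rewrite pu ltnW.
Qed.

(** Each further prime at most doubles the set of divisors. This bounds the number of factors that
    [totient_sum_le] can peel off [d] at one step. *)
Lemma size_divisors_short k d : short k d -> (size (divisors d) <= 2 ^ k)%N.
Proof.
case=> s /andP[ps sk] <-; apply: leq_trans (_ : 2 ^ size s <= _)%N; last by rewrite leq_exp2l.
elim: s ps {sk} => [|q s IH]; first by rewrite big_nil.
rewrite /= big_cons => /andP[pq ps]; set d' := (\prod_(p <- s) p)%N.
have d'0 : (0 < d')%N := prod_primes_gt0 ps.
have q0 := prime_gt0 pq.
have sub : {subset divisors (q * d') <= divisors d' ++ map (muln q) (divisors d')}.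
  move=> e; rewrite mem_cat -!dvdn_divisors ?muln_gt0 ?q0// => h.
  have [qe|qe] := boolP (q %| e)%N.
    apply/orP; right; apply/mapP; exists (e %/ q)%N; last by rewrite mulnC divnK.
    by rewrite -dvdn_divisors// -(dvdn_pmul2l q0) mulnC divnK.
  by rewrite -(Gauss_dvdr _ (n:=q)) ?h// coprime_sym prime_coprime.
apply: leq_trans (uniq_leq_size (divisors_uniq _) sub) _.
by rewrite size_cat size_map addnn -mul2n expnS leq_mul2l IH.
Qed.

(** Take the least divisor [d] of [D] above [V]. Removing any prime [l] brings it down to at most
    [V], whence [d <= V l]; and [d / l], a product of primes above [y] that is at most [V < y ^+ k],
    has fewer than [k] prime factors. *)
Lemma trim_divisor (R : realType) (y V : R) (k D : nat) :
  (0 < D)%N -> 1 < y -> 1 <= V -> V < D%:R -> V < y ^+ k ->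
  (forall l, prime l -> (l %| D)%N -> y < l%:R) ->
  exists d, [/\ (d %| D)%N, short k d, V < d%:R &
    forall P : R, (forall l, prime l -> (l %| D)%N -> l%:R <= P) -> d%:R <= V * P].
Proof.
move=> D0 y1 V1 VD Vy hy.
have ex : exists d, (d %| D)%N && (V < d%:R) by exists D; rewrite dvdnn.
case: (ex_minnP ex) => d /andP[dD Vd] dmin.
have d0 : (0 < d)%N := dvdn_gt0 D0 dD.
have drop l : prime l -> (l %| d)%N -> (d %/ l)%:R <= V.
  move=> pl ld; rewrite leNgt; apply/negP => h.
  have := dmin (d %/ l)%N; rewrite h (dvdn_trans (dvdn_div ld) dD) => /(_ isT).
  by rewrite leqNgt ltn_Pdiv// prime_gt1.
exists d; split=> //; last first.
  move=> P hP; have d1 : (1 < d)%N by rewrite -(ltr_nat R) (le_lt_trans V1).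
  have pl := pdiv_prime d1; have ld := pdiv_dvd d.
  rewrite -(divnK ld) natrM ler_pM ?drop//.
  by apply: hP => //; exact: dvdn_trans dD.
have [s ps es] := prime_factorization d0.
exists s => //; rewrite ps /=; move: ps es; case: s => //= l s /andP[pl ps].
rewrite big_cons => es.
have ld : (l %| d)%N by rewrite -es dvdn_mulr.
have e1 : (d %/ l)%N = (\prod_(p <- s) p)%N by rewrite -es mulKn// prime_gt0.
have h : y ^+ size s <= (d %/ l)%:R.
  have sD : (\prod_(p <- s) p %| D)%N.
    by rewrite (dvdn_trans _ dD)// -es dvdn_mull.
  rewrite e1; elim: s ps sD {es e1} => [|q s IH]; first by rewrite big_nil expr0.
  rewrite /= big_cons => /andP[pq ps] sD; rewrite exprS natrM ler_pM//; try lra.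
  - by rewrite exprn_ge0//; lra.
  - by apply/ltW/hy => //; rewrite (dvdn_trans _ sD)// dvdn_mulr.
  - by apply: IH => //; rewrite (dvdn_trans _ sD)// dvdn_mull.
rewrite ltnNge; apply/negP => ks.
have := le_lt_trans (le_trans h (drop _ pl ld)) Vy.
by rewrite ltNge ler_eXn2l// ks.
Qed.

Lemma dvdn_gcd_split (D a b : nat) : (0 < D)%N -> (D %| a * b)%N ->
  (D %/ gcdn D a %| b)%N.
Proof.
move=> D0 h; have g0 : (0 < gcdn D a)%N by rewrite gcdn_gt0 D0.
rewrite -(Gauss_dvdr _ (n := (a %/ gcdn D a)%N)); last first.
  by rewrite /coprime -(eqn_pmul2l g0) muln_gcdr !(mulnC (gcdn D a)) !divnK ?dvdn_gcdl ?dvdn_gcdr// mul1n.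
by rewrite -(dvdn_pmul2l g0) mulnA !(mulnC (gcdn D a)) !divnK ?dvdn_gcdl ?dvdn_gcdr.
Qed.

Lemma gcdn_mul_split (D a b : nat) : (0 < D)%N -> (D %| a * b)%N ->
  (D <= gcdn D a * gcdn D b)%N.
Proof.
move=> D0 h; have g0 : (0 < gcdn D a)%N by rewrite gcdn_gt0 D0.
rewrite mulnC -leq_divLR ?dvdn_gcdl//; apply: dvdn_leq; first by rewrite gcdn_gt0 D0.
rewrite dvdn_gcd (dvdn_gcd_split D0 h) andbT.
by rewrite dvdn_div ?dvdn_gcdl.
Qed.

Lemma unitary_split (N q : nat) : (0 < N)%N -> prime q ->
  exists2 M, N = (q ^ logn q N * M)%N & (0 < M)%N && ~~ (q %| M)%N.
Proof.
move=> N0 pq; have [M qM e] := pfactor_coprime pq N0.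
exists M; first by rewrite {1}e mulnC.
rewrite -prime_coprime// qM andbT; case: M {qM} e => //= e.
by move: N0; rewrite e.
Qed.

(** A greedy pigeonhole. Remove from [N] its largest unitary divisor [a1 <= B]; unitary divisors
    keep the totient multiplicative across the splitting. Maximality gives [a1 ^ 2 > B], so each
    removal lowers the exponent [k] in [N ^ 2 < B ^ k] by one. If every part met [D] in a gcd of at
    most [V], then [D] would be at most [V ^ k]. *)
Lemma coprime_part (R : realType) (B V : R) (k D N : nat) :
  1 <= V -> 1 <= B -> (0 < N)%N -> (0 < D)%N ->
  (forall q, prime q -> (q %| N)%N -> (q ^ logn q N)%:R <= B) ->
  (N%:R : R) ^+ 2 < B ^+ k -> (D %| totient N)%N -> V ^+ k < D%:R ->
  exists a, [/\ (a %| N)%N, a%:R <= B & V < (gcdn D (totient a))%:R].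
Proof.
move=> V1 B1; elim: k D N => [|k IH] D N N0 D0 comps NB DN VD.
  by move: NB; rewrite expr0 -natrX -[ltRHS]/(1%:R) ltr_nat; lia.
have [NleB|BN] := leP N%:R B.
  exists N; split=> //; rewrite (gcdn_idPl DN); apply: le_lt_trans VD.
  by rewrite exprS ler_peMr ?exprn_ege1//; lra.
pose U a := [&& (a %| N)%N, coprime a (N %/ a) & a%:R <= B].
have exU : exists a, U a by exists 1%N; rewrite /U dvd1n coprime1n.
have ubU a : U a -> (a <= N)%N by move=> /and3P[aN _ _]; apply: dvdn_leq.
case: (ex_maxnP exU ubU) => a1 /and3P[aN ca aB] amax.
have a0 : (0 < a1)%N := dvdn_gt0 N0 aN.
have [N1 eN] : exists N1, N = (a1 * N1)%N by exists (N %/ a1)%N; rewrite mulnC divnK.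
have {ca} : coprime a1 N1 by move: ca; rewrite eN mulKn.
move=> ca.
have N10 : (0 < N1)%N by move: N0; rewrite eN muln_gt0 => /andP[].
have N11 : (1 < N1)%N.
  rewrite ltn_neqAle N10 andbT; apply/eqP => e; move: BN aB.
  by rewrite eN -e muln1; lra.
set q := pdiv N1; have pq : prime q := pdiv_prime N11.
have [N2 eN1 /andP[N20 qN2]] := unitary_split N10 pq.
set w := (q ^ logn q N1)%N in eN1.
have w1 : (1 < w)%N.
  by rewrite -(exp1n (logn q N1)) ltn_exp2r ?prime_gt1// logn_gt0 mem_primes pq N10 pdiv_dvd.
have cwN2 : coprime w N2 by rewrite coprimeXl// prime_coprime.
have cawN2 : coprime (a1 * w) N2.
  rewrite coprimeMl cwN2 andbT; apply: coprime_dvdr ca.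
  by rewrite eN1 dvdn_mull.
have caw : coprime a1 w by apply: coprime_dvdr ca; rewrite eN1 dvdn_mulr.
have logN r : prime r -> (r %| N1)%N -> logn r N = logn r N1.
  move=> pr rN; rewrite eN lognM// (@logn_coprime r a1) ?add0n//.
  by rewrite (coprime_dvdl rN)// coprime_sym.
have wB : w%:R <= B.
  by rewrite /w -logN// ?pdiv_dvd// comps//; rewrite eN dvdn_mull ?pdiv_dvd.
have wa : (w <= a1)%N.
  apply: amax; rewrite /U wB andbT.
  have e : N = (w * (a1 * N2))%N by rewrite eN eN1; ring.
  rewrite {1}e dvdn_mulr//= e mulKn; last by lia.
  by rewrite coprimeMr cwN2 andbT coprime_sym.
have Baw : B < (a1 * w)%:R.
  rewrite ltNge; apply/negP => h.
  have : (a1 * w <= a1)%N.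
    apply: amax; rewrite /U h andbT.
    have e : N = (a1 * w * N2)%N by rewrite eN eN1; ring.
    rewrite {1}e dvdn_mulr//= e mulKn//.
    by rewrite muln_gt0 a0; lia.
  by rewrite -{2}(muln1 a1) leq_pmul2l//; lia.
have [h|gV] := ltP V (gcdn D (totient a1))%:R; first by exists a1.
set g := gcdn D (totient a1) in gV.
have g0 : (0 < g)%N by rewrite gcdn_gt0 D0.
have [D1 eD] : exists D1, D = (g * D1)%N by exists (D %/ g)%N; rewrite mulnC divnK// dvdn_gcdl.
have D1N : (D1 %| totient N1)%N.
  have -> : D1 = (D %/ g)%N by rewrite eD mulKn.
  apply: dvdn_gcd_split => //.
  by rewrite -totient_coprime// -eN.
have D10 : (0 < D1)%N by move: D0; rewrite eD muln_gt0 => /andP[].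
have [|||a [aN1 aB' Vg]] := IH D1 N1 N10 D10 _ _ D1N.
- move=> r pr rN; rewrite -logN//; apply: comps => //; rewrite eN; exact: dvdn_mull.
- have : B ^+ 1 * N1%:R ^+ 2 < B ^+ 1 * B ^+ k.
    rewrite -exprD add1n; apply: le_lt_trans NB.
    rewrite eN natrM exprMn ler_wpM2r ?sqr_ge0// expr1 (le_trans (ltW Baw))//.
    by rewrite natrM expr2 ler_wpM2l ?ler_nat.
  by rewrite expr1 ltr_pM2l//; lra.
- have : V ^+ 1 * V ^+ k < V ^+ 1 * D1%:R.
    rewrite -exprD add1n; apply: lt_le_trans VD _.
    by rewrite eD natrM expr1 ler_wpM2r.
  by rewrite expr1 ltr_pM2l//; lra.
exists a; split=> //; first by rewrite eN dvdn_mull.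
apply: (lt_le_trans Vg); rewrite ler_nat; apply: dvdn_leq.
  by rewrite gcdn_gt0 D0.
by rewrite dvdn_gcd dvdn_gcdr andbT (dvdn_trans (dvdn_gcdl _ _))// eD dvdn_mull.
Qed.

Lemma prime_dvd_totient (l W : nat) : prime l -> (0 < W)%N -> (l %| totient W)%N ->
  exists2 q, q \in primes W & (l %| totient (q ^ logn q W))%N.
Proof.
move=> pl W0; rewrite totientE// Euclid_dvd_prod// big_has => /hasP[q qW h].
exists q => //; move: (qW); rewrite mem_primes => /and3P[pq _ _].
by rewrite totient_pfactor// logn_gt0.
Qed.

(** * Elementary sums *)

Section Covering.
Variables (R : realType) (I J : eqType).

(** The union bound in the form used throughout: [g] may be many-to-one, and repeated hits only
    enlarge the right-hand side. *)
Lemma ler_sum_cover (r : seq J) (s : seq I) (A : pred J) (P : pred I) (g : I -> J)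
    (c : J -> R) : uniq r -> (forall j, 0 <= c j) ->
  (forall j, j \in r -> A j -> exists i, [/\ i \in s, P i & g i = j]) ->
  \sum_(j <- r | A j) c j <= \sum_(i <- s | P i) c (g i).
Proof.
move=> ur c0 cov.
apply: (@le_trans _ _ (\sum_(j <- r | A j) \sum_(i <- s | P i && (g i == j)) c j)).
  rewrite big_seq_cond [leRHS]big_seq_cond; apply: ler_sum => j /andP[jr Aj].
  have [i [si Pi gi]] := cov _ jr Aj.
  rewrite (big_rem i)//= Pi gi eqxx lerDl; apply: sumr_ge0 => *; exact: c0.
rewrite (eq_bigr (fun j => \sum_(i <- s | P i) (g i == j)%:R * c j)); last first.
  by move=> j _; rewrite big_mkcondr/=; apply: eq_bigr => i _; case: eqP; rewrite ?mul1r ?mul0r.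
rewrite exchange_big/=; apply: ler_sum => i _.
apply: (@le_trans _ _ (\sum_(j <- r) (g i == j)%:R * c j)).
  rewrite big_mkcond/=; apply: ler_sum => j _; case: (A j) => //.
  by rewrite mulr_ge0.
have [gr|gr] := boolP (g i \in r).
  rewrite (bigD1_seq (g i))//= eqxx mul1r big1 ?addr0// => j.
  by rewrite eq_sym => /negbTE ->; rewrite mul0r.
rewrite big_seq big1// => j jr; case: eqP => [e|]; last by rewrite mul0r.
by move: gr; rewrite e jr.
Qed.

Lemma count_cover (r : seq J) (s : seq I) (A : pred J) (P : pred I)
    (C : I -> pred J) :
  (forall j, j \in r -> A j -> exists i, [/\ i \in s, P i & C i j]) ->
  ((count A r)%:R : R) <= \sum_(i <- s | P i) (count (C i) r)%:R.
Proof.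
move=> cov.
have cE (Q : pred J) : (count Q r)%:R = \sum_(j <- r) (Q j)%:R :> R.
  by rewrite -sum1_count natr_sum [RHS](bigID Q)/= [X in _ + X]big1 ?addr0;
    [apply: eq_bigr => j ->|move=> j /negbTE ->].
rewrite cE [leRHS](eq_bigr (fun i => \sum_(j <- r) (C i j)%:R)); last by move=> i _; exact: cE.
rewrite exchange_big/= big_seq [leRHS]big_seq; apply: ler_sum => j jr.
case: (boolP (A j)) => Aj; last by apply: sumr_ge0 => *; rewrite ler0n.
have [i [si Pi Cij]] := cov _ jr Aj.
by rewrite (big_rem i)//= Pi Cij lerDl; apply: sumr_ge0 => *; rewrite ler0n.
Qed.

End Covering.

Section Sums.
Variable R : realType.
Implicit Types (lam : R) (X : nat).

Lemma ln_ge1B (x : R) : 0 < x -> 1 - x^-1 <= ln x.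
Proof.
move=> x0; have := @le_ln1Dx R (x^-1 - 1) _.
have -> : 1 + (x^-1 - 1) = x^-1 by ring.
rewrite lnV ?posrE// ltrBrDl addrN invr_gt0 x0 => /(_ isT).
by lra.
Qed.

Lemma one_sub_div (a b : R) : 0 < a -> b = a + 1 -> 1 - a / b = b^-1.
Proof. by move=> a0 ->; field; rewrite gt_eqF//; lra. Qed.

Lemma harmonic_le X : (0 < X)%N -> \sum_(n <- iota 1 X) (n%:R : R)^-1 <= 1 + ln X%:R.
Proof.
case: X => // X _; elim: X => [|X IH].
  by rewrite big_seq1 invr1 ln1 addr0.
rewrite -(addn1 X.+1) iotaD big_cat/= big_seq1 add1n addn1.
apply: (le_trans (lerD IH (lexx _))).
have h1 : (0 : R) < X.+1%:R by rewrite ltr0n.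
have h2 : (0 : R) < X.+2%:R by rewrite ltr0n.
have := @ln_ge1B (X.+2%:R / X.+1%:R) (divr_gt0 h2 h1).
rewrite ln_div ?posrE// invf_div.
have -> : 1 - X.+1%:R / X.+2%:R = X.+2%:R^-1 :> R.
  by rewrite one_sub_div// -natr1.
by rewrite -addrA lerD2l addrC -lerBrDr.
Qed.

Lemma sum_inv_sqr_gt X (V : R) : 0 < V ->
  \sum_(n <- iota 1 X | V < n%:R) (n%:R : R)^-2 <= 2 / V.
Proof.
move=> V0.
(* The subtracted term strengthens the claim enough for induction: 1 / n^2 <= 2 / n - 2 / (n + 1)
   telescopes. *)
suff : \sum_(n <- iota 1 X | V < n%:R) (n%:R : R)^-2 <=
    if V < X%:R then 2 / V - 2 / X.+1%:R else 0.
  move/le_trans; apply; case: ifP => _; last by rewrite divr_ge0// ltW.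
  by rewrite lerBlDr lerDl divr_ge0.
elim: X => [|X IH]; first by rewrite big_nil; case: ifP => //; rewrite ltNge ltW.
rewrite -(addn1 X) iotaD big_cat/= big_cons big_nil add1n.
have h1 : (0 : R) < X.+1%:R by rewrite ltr0n.
have h2 : (0 : R) < X.+2%:R by rewrite ltr0n.
have key : (X.+1%:R : R)^-2 <= 2 / X.+1%:R - 2 / X.+2%:R.
  have e : (X.+2%:R : R) = X.+1%:R + 1 by rewrite -natr1.
  have -> : 2 / X.+1%:R - 2 / X.+2%:R = 2 / (X.+1%:R * X.+2%:R) :> R.
    by rewrite e; field; rewrite !gt_eqF//; lra.
  rewrite -[leLHS]mul1r ler_pdivrMr ?exprn_gt0// mulrAC ler_pdivlMr ?mulr_gt0//.
  rewrite e mul1r expr2; have : (1 : R) <= X.+1%:R by rewrite ler1n.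
  by nra.
have XX : (X%:R : R) <= X.+1%:R by rewrite ler_nat.
case: ifP => VX; last first.
  rewrite addr0 addn1 VX; apply: le_trans IH _; case: ifP => // h.
  by move: VX; rewrite (lt_le_trans h).
rewrite addr0 addn1 VX; apply: le_trans (lerD IH key) _.
have : 2 / X.+1%:R <= 2 / V :> R by rewrite ler_pM2l// lef_pV2 ?posrE// ltW.
by move: (2 / X.+1%:R) (2 / X.+2%:R) => u v; case: ifP => _; lra.
Qed.

Lemma sum_powR_le lam X : 0 < lam ->
  \sum_(n <- iota 1 X) (n%:R : R) `^ (-1 - lam) <= 1 + lam^-1.
Proof.
move=> l0.
(* The subtracted term is the tail of the integral of t^(-1 - lam) beyond [X], which makes the
   induction close. *)
suff : \sum_(n <- iota 1 X) (n%:R : R) `^ (-1 - lam) <=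
    1 + lam^-1 - (if (0 < X)%N then lam^-1 * X%:R `^ (- lam) else 0).
  move/le_trans; apply; rewrite lerBlDr lerDl; case: ifP => // _.
  by rewrite mulr_ge0 ?powR_ge0// invr_ge0 ltW.
elim: X => [|X IH]; first by rewrite big_nil subr0 addr_ge0// invr_ge0 ltW.
rewrite -(addn1 X) iotaD big_cat/= big_cons big_nil add1n addr0 addn1/=.
case: X IH => [|X] /= IH.
  by rewrite big_nil add0r !powR1 mulr1 addrK.
apply: le_trans (lerD IH (lexx _)) _.
have h1 : (0 : R) < X.+1%:R by rewrite ltr0n.
have h2 : (0 : R) < X.+2%:R by rewrite ltr0n.
set a := X.+2%:R `^ (- lam).
have a0 : 0 < a by rewrite powR_gt0.
suff : lam * X.+2%:R `^ (-1 - lam) <= X.+1%:R `^ (- lam) - a.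
  rewrite -(ler_pM2l (x:=lam^-1)) ?invr_gt0// mulKf ?gt_eqF// mulrBr; lra.
have -> : X.+2%:R `^ (-1 - lam) = X.+2%:R^-1 * a.
  rewrite /a powRD ?(gt_eqF h2) ?implybT//.
  by rewrite powR_inv1// ltW.
have -> : X.+1%:R `^ (- lam) = a * expR (lam * ln (X.+2%:R / X.+1%:R)).
  rewrite /a /powR !(gt_eqF h1) !(gt_eqF h2) -expRD; congr expR.
  by rewrite ln_div ?posrE//; ring.
have h := @ln_ge1B (X.+2%:R / X.+1%:R) (divr_gt0 h2 h1).
have e : 1 - (X.+2%:R / X.+1%:R)^-1 = X.+2%:R^-1 :> R.
  by rewrite invf_div one_sub_div// -natr1.
rewrite e in h.
have g := expR_ge1Dx (lam * ln (X.+2%:R / X.+1%:R)).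
have : a * (1 + lam * X.+2%:R^-1) <= a * expR (lam * ln (X.+2%:R / X.+1%:R)).
  rewrite ler_pM2l//; apply: le_trans g; rewrite lerD2l ler_pM2l//.
by move: (expR _) (X.+2%:R^-1) => u v; lra.
Qed.

Lemma sum_ln_primes (n : nat) : (0 < n)%N ->
  \sum_(p <- primes n) ln (p%:R : R) <= ln n%:R.
Proof.
move=> n0; have e : (n = \prod_(p <- primes n) p ^ logn p n)%N.
  by rewrite {1}(prod_prime_decomp n0) prime_decompE big_map.
apply: (@le_trans _ _ (ln (\prod_(p <- primes n) (p ^ logn p n)%N)%:R)); last by rewrite -e.
rewrite natr_prod big_seq.
suff H s : {subset s <= primes n} -> \sum_(i <- s) ln (i%:R : R) <=
    ln (\prod_(i <- s) (i ^ logn i n)%:R) /\ (0 : R) < \prod_(i <- s) (i ^ logn i n)%:R.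
  by rewrite -big_seq; case: (H (primes n)).
elim: s => [|p s IH] sub; first by rewrite !big_nil ln1.
rewrite !big_cons; have [|h1 h2] := IH; first by move=> q qs; apply: sub; rewrite inE qs orbT.
have : p \in primes n by apply: sub; rewrite inE eqxx.
move=> pn; have := pn; rewrite -logn_gt0 => lp; move: pn; rewrite mem_primes => /and3P[pp _ _].
have p0 : (0 : R) < p%:R by rewrite ltr0n prime_gt0.
have w0 : (0 : R) < (p ^ logn p n)%:R by rewrite ltr0n expn_gt0 prime_gt0.
split; last by rewrite mulr_gt0.
rewrite lnM ?posrE// lerD// ler_ln ?posrE// ler_nat -{1}(expn1 p) leq_exp2l// prime_gt1//.
Qed.

Lemma count_multiples_ge p X : (0 < p)%N ->
  (X %/ p <= count (fun n => p %| n) (iota 1 X))%N.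
Proof.
move=> p0; rewrite -size_filter -[X in (X <= _)%N](size_iota 1) -(size_map (muln p)).
apply: uniq_leq_size.
  by rewrite map_inj_uniq ?iota_uniq// => a b /eqP; rewrite eqn_pmul2l// => /eqP.
move=> n /mapP[k]; rewrite mem_iota => /andP[k0 kX] ->.
rewrite mem_filter dvdn_mulr//= mem_iota muln_gt0 p0 k0/= add1n ltnS.
by rewrite mulnC -leq_divRL//; lia.
Qed.

(** Chebyshev's argument: the logarithm of X! is at most X ln X and at least the sum of ln p floor(X
    / p). The constant 2 is the loss in floor(X / p) >= X / (2 p) for p <= X. *)
Lemma sum_ln_div_prime X : (0 < X)%N ->
  \sum_(p <- iota 1 X | prime p) ln (p%:R : R) / p%:R <= 2 * ln X%:R.
Proof.
move=> X0; have X0' : (0 : R) < X%:R by rewrite ltr0n.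
have lnp p : prime p -> 0 <= ln (p%:R : R) by move=> pp; rewrite ln_ge0// ler1n prime_gt0.
have A : \sum_(n <- iota 1 X) ln (n%:R : R) <= X%:R * ln X%:R.
  rewrite mulr_natl; apply: (@le_trans _ _ (\sum_(n <- iota 1 X) ln (X%:R : R))).
    rewrite big_seq [leRHS]big_seq; apply: ler_sum => n; rewrite mem_iota => /andP[n0 nX].
    by rewrite ler_ln ?posrE ?ltr0n// ler_nat -ltnS -add1n.
  by rewrite big_const_seq count_predT size_iota iter_addr_0.
have B : \sum_(p <- iota 1 X | prime p) ln (p%:R : R) * (X %/ p)%:R <= X%:R * ln X%:R.
  apply: le_trans A.
  apply: (@le_trans _ _ (\sum_(n <- iota 1 X) \sum_(p <- iota 1 X | prime p && (p %| n)%N) ln (p%:R : R))).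
    rewrite [leRHS](eq_bigr (fun n => \sum_(p <- iota 1 X | prime p) ln (p%:R : R) * (p %| n)%:R)); last first.
      move=> n _; rewrite big_mkcondr/=; apply: eq_bigr => p _.
      by case: (p %| n)%N; rewrite ?mulr1 ?mulr0.
    rewrite exchange_big/=; apply: ler_sum => p pp; rewrite -mulr_sumr ler_wpM2l ?lnp//.
    rewrite -natr_sum ler_nat; apply: leq_trans (count_multiples_ge X (prime_gt0 pp)) _.
    by rewrite -sum1_count big_mkcond/=; apply: leq_sum => n _; case: ifP.
  rewrite big_seq [leRHS]big_seq; apply: ler_sum => n; rewrite mem_iota => /andP[n0 nX].
  apply: le_trans (sum_ln_primes n0); rewrite -big_filter.
  rewrite (perm_big (primes n)) ?lexx//; apply: uniq_perm; rewrite ?filter_uniq ?iota_uniq ?primes_uniq//.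
  move=> p; rewrite mem_filter mem_primes n0/= mem_iota.
  case pp: (prime p) => //=; case pn: (p %| n)%N => //=.
  by have := dvdn_leq n0 pn; have := prime_gt0 pp; lia.
rewrite -(ler_pM2l X0') mulrCA.
apply: le_trans (ler_wpM2l _ B) => //; rewrite !mulr_sumr big_seq_cond [leRHS]big_seq_cond.
apply: ler_sum => p /andP[]; rewrite mem_iota => /andP[p0 pX] pp.
have p0' : (0 : R) < p%:R by rewrite ltr0n.
rewrite mulrCA [leRHS]mulrCA ler_wpM2l ?lnp// ler_pdivrMr// -natrM -natrM ler_nat.
have := divn_eq X p; have := ltn_pmod X p0; have : (0 < X %/ p)%N by rewrite divn_gt0//; lia.
nia.
Qed.

End Sums.

(** * Euler products *)

Section Euler.
Variable R : realType.

Lemma ler_sum_subset (I : eqType) (r s : seq I) (A P : pred I) (c : I -> R) :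
  uniq r -> (forall i, 0 <= c i) -> (forall i, i \in r -> A i -> (i \in s) && P i) ->
  \sum_(i <- r | A i) c i <= \sum_(i <- s | P i) c i.
Proof.
move=> ur c0 h; apply: (@ler_sum_cover R I I r s A P id) => // i ir Ai.
by exists i; have /andP[] := h i ir Ai.
Qed.

Lemma prod_1D_le_expR (I : Type) (s : seq I) (P : pred I) (E : I -> R) :
  (forall i, 0 <= E i) ->
  \prod_(i <- s | P i) (1 + E i) <= expR (\sum_(i <- s | P i) E i).
Proof.
move=> E0; elim: s => [|i s IH]; first by rewrite !big_nil expR0.
rewrite !big_cons; case: ifP => // _; rewrite expRD ler_pM ?expR_ge1Dx//.
  by rewrite addr_ge0.
by apply: prodr_ge0 => j _; rewrite addr_ge0.
Qed.

(** Submultiplicativity at an exact prime power is enough, which admits weights that vanish off a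
    squarefreeness condition. Primes are adjoined one at a time; exponent 0 supplies the 1 in
    [1 + E q]. *)
Lemma euler_product_le (G : nat -> R) (N : nat) :
  (forall n, 0 <= G n) -> G 1%N <= 1 ->
  (forall q a M, prime q -> (0 < a)%N -> (0 < M)%N -> ~~ (q %| M)%N ->
     G (q ^ a * M)%N <= G (q ^ a)%N * G M) ->
  \sum_(n <- iota 1 N) G n <=
  expR (\sum_(q <- iota 1 N | prime q)
          \sum_(a <- iota 1 N | (q ^ a <= N)%N) G (q ^ a)%N).
Proof.
move=> G0 G1 GM.
pose E q := \sum_(a <- iota 1 N | (q ^ a <= N)%N) G (q ^ a)%N.
have E0 q : 0 <= E q by apply: sumr_ge0.
have key ps : uniq ps -> all prime ps ->
    \sum_(n <- iota 1 N | all (mem ps) (primes n)) G n <= \prod_(q <- ps) (1 + E q).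
  elim: ps => [|q ps IH] /=.
    move=> _ _; rewrite big_nil; apply: le_trans G1.
    have -> : G 1%N = \sum_(n <- [:: 1%N]) G n by rewrite big_seq1.
    apply: ler_sum_subset; rewrite ?iota_uniq// => n; rewrite mem_iota => /andP[n0 _].
    move=> /allP h; rewrite inE andbT eqn_leq n0 andbT leqNgt; apply/negP => n1.
    have /h : pdiv n \in primes n by rewrite mem_primes pdiv_prime// n0 pdiv_dvd.
    by rewrite inE.
  move=> /andP[qps ups] /andP[pq pps]; rewrite big_cons.
  pose s := [seq (a, M) | a <- iota 0 N.+1, M <- iota 1 N].
  pose P (x : nat * nat) := (q ^ x.1 <= N)%N && all (mem ps) (primes x.2).
  have q0 := prime_gt0 pq.
  apply: (@le_trans _ _ (\sum_(x <- s | P x) G (q ^ x.1 * x.2)%N)).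
    apply: (@ler_sum_cover R _ _ _ s _ P (fun x => q ^ x.1 * x.2)%N); rewrite ?iota_uniq//.
    move=> n; rewrite mem_iota => /andP[n0 nN] /allP h.
    have [M e /andP[M0 qM]] := unitary_split n0 pq.
    have wn : (q ^ logn q n <= n)%N by rewrite {2}e leq_pmulr.
    have Mn : (M <= n)%N by rewrite e leq_pmull// expn_gt0 q0.
    exists (logn q n, M); split => //=.
      apply: allpairs_f; rewrite mem_iota ?M0; last by lia.
      by have := ltn_expl (logn q n) (prime_gt1 pq); lia.
    apply/andP; split; first by rewrite /=; lia.
    apply/allP => p /= pM; have : p \in primes n.
      by move: pM; rewrite !mem_primes => /and3P[-> _ pM]; rewrite n0 /= e dvdn_mull.
    move/h; rewrite !inE => /orP[/eqP epq|//].
    by move: qM pM; rewrite -epq mem_primes => /negbTE -> ; rewrite !andbF.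
  rewrite big_mkcond big_allpairs_dep/=.
  apply: (@le_trans _ _ (\sum_(a <- iota 0 N.+1 | (q ^ a <= N)%N)
    \sum_(M <- iota 1 N | all (mem ps) (primes M)) G (q ^ a * M)%N)).
    rewrite [leRHS]big_mkcond/=; apply: ler_sum => a _.
    rewrite /P/=; case: (q ^ a <= N)%N => //=; last by rewrite big1.
    by rewrite [leRHS]big_mkcond.
  set S := \sum_(n <- iota 1 N | all (mem ps) (primes n)) G n in IH.
  have IH' := IH ups pps.
  apply: (@le_trans _ _ ((1 + E q) * S)); last by rewrite ler_wpM2l// addr_ge0.
  rewrite /= big_cons expn0 mulrDl mul1r.
  have S0 : 0 <= S by apply: sumr_ge0.
  have h2 : \sum_(a <- iota 1 N | (q ^ a <= N)%N)
    \sum_(M <- iota 1 N | all (mem ps) (primes M)) G (q ^ a * M)%N <= E q * S.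
    rewrite mulr_suml big_seq_cond [leRHS]big_seq_cond; apply: ler_sum => a /andP[].
    rewrite mem_iota => /andP[a0 _] _; rewrite mulr_sumr.
    rewrite big_seq_cond [leRHS]big_seq_cond; apply: ler_sum => M /andP[].
    rewrite mem_iota => /andP[M0 _] /allP hM; apply: GM => //.
    apply/negP => qM; have /hM : q \in primes M by rewrite mem_primes pq M0.
    by rewrite /= (negbTE qps).
  case: ifP => _; last by apply: le_trans h2 _; rewrite lerDr.
  by rewrite lerD// /S; under eq_bigr do rewrite mul1n.
have := @prod_1D_le_expR _ (seq.filter prime (iota 1 N)) predT E E0.
rewrite [X in expR X]big_filter/=; apply: le_trans.
apply: le_trans (key _ _ _); rewrite ?filter_uniq ?iota_uniq ?filter_all//.
apply: ler_sum_subset; rewrite ?iota_uniq// => n nN _; rewrite nN/=.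
apply/allP => p /=; rewrite mem_filter mem_primes mem_iota => /and3P[pp n0 /(dvdn_leq n0)].
move: nN; rewrite mem_iota => /andP[_ nN] pn.
by rewrite pp prime_gt0//=; exact: leq_ltn_trans pn nN.
Qed.

Lemma geometric_le (r : R) n : 0 <= r -> r <= 3 / 4 ->
  \sum_(a <- iota 1 n) r ^+ a <= 4 * r.
Proof.
move=> r0 r1.
suff : \sum_(a <- iota 1 n) r ^+ a <= 4 * r - 4 * r ^+ n.+1.
  by move/le_trans; apply; rewrite lerBlDr lerDl mulr_ge0// exprn_ge0.
elim: n => [|n IH]; first by rewrite big_nil expr1 subrr.
rewrite -(addn1 n) iotaD big_cat/= big_seq1 add1n addn1.
have h : 0 <= r ^+ n.+1 by rewrite exprn_ge0.
rewrite [r ^+ n.+2]exprS.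
move: IH h; set S := \sum_(_ <- _) _; move: (r ^+ n.+1) => u IH h.
have : 0 <= u * (3 / 4 - r) by rewrite mulr_ge0//; lra.
by lra.
Qed.

Lemma powRX (x s : R) a : 0 <= x -> (x ^+ a) `^ s = (x `^ s) ^+ a.
Proof.
move=> x0; elim: a => [|a IH]; first by rewrite !expr0 powR1.
by rewrite !exprS powRM ?exprn_ge0// IH.
Qed.

(** The exponent is at most -1/2 and q >= 2, and 2^(-1/2) <= 3/4 since 16/9 <= 2. This keeps the
    ratio of the geometric series over powers of [q] away from 1. *)
Lemma powR_prime_le (lam : R) (q : nat) : lam <= 1 / 4 -> prime q ->
  (q%:R : R) `^ (lam - 1) <= 3 / 4.
Proof.
move=> l1 pq; have q2 : (2 : R) <= q%:R by rewrite ler_nat prime_gt1.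
apply: (@le_trans _ _ (q%:R `^ (- 2^-1))); first by rewrite ler_powR; lra.
rewrite powRN powR12_sqrt; last by lra.
rewrite invf_ple ?posrE ?divr_gt0 ?sqrtr_gt0//; try lra.
have -> : (3 / 4)^-1 = Num.sqrt ((4 / 3) ^+ 2) :> R.
  by rewrite sqrtr_sqr ger0_norm; [field | lra].
by rewrite ler_sqrt; [rewrite expr2; lra | lra].
Qed.

Lemma prime_powers_le (lam : R) (q N : nat) : lam <= 1 / 4 -> prime q ->
  \sum_(a <- iota 1 N | (q ^ a <= N)%N) (q ^ a)%:R `^ (lam - 1) <=
  4 * (q%:R : R) `^ (lam - 1).
Proof.
move=> l1 pq; apply: le_trans (geometric_le N (powR_ge0 _ _) (powR_prime_le l1 pq)).
rewrite big_mkcond; apply: ler_sum => a _; rewrite natrX powRX//.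
by case: ifP => // _; rewrite exprn_ge0// powR_ge0.
Qed.

Lemma mertens_le (y : R) (N : nat) : 1 <= y ->
  \sum_(p <- iota 1 N | prime p && (p%:R <= y)) ln (p%:R : R) / p%:R <= 2 * ln y.
Proof.
move=> y1; have m0 : (0 < Num.truncn y)%N by rewrite truncn_gt0.
apply: (@le_trans _ _ (2 * ln (Num.truncn y)%:R)); last first.
  by rewrite ler_pM2l// ler_ln ?posrE ?ltr0n//; [rewrite truncn_le|]; lra.
apply: le_trans (sum_ln_div_prime _ m0).
rewrite big_mkcond [leRHS]big_mkcond/=.
rewrite -big_mkcond -[leRHS]big_mkcond/=.
apply: (@le_trans _ _ (\sum_(p <- iota 1 (Num.truncn y) | prime p) `|ln (p%:R : R) / p%:R|)).
  apply: (@le_trans _ _ (\sum_(p <- iota 1 N | prime p && (p%:R <= y)) `|ln (p%:R : R) / p%:R|)).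
    by apply: ler_sum => *; exact: ler_norm.
  apply: ler_sum_subset; rewrite ?iota_uniq// => p _ /andP[pp py].
  rewrite pp andbT mem_iota prime_gt0//= add1n ltnS truncn_ge_nat//; lra.
apply: ler_sum => p pp; rewrite ger0_norm// divr_ge0// ln_ge0// ler1n prime_gt0//.
Qed.

(** Primes up to e^w are bounded by the harmonic sum; beyond, 1 / p <= ln p / (w p) and Mertens'
    bound apply. The free parameter [w] replaces an exact second Mertens theorem: any choice making
    both [w] and [K / w] small against T will do. *)
Lemma sum_inv_prime_le (K w : R) (N : nat) : 0 <= K -> 0 < w ->
  \sum_(p <- iota 1 N | prime p && (p%:R <= expR K)) (p%:R : R)^-1 <= 1 + w + 2 * K / w.
Proof.
move=> K0 w0; rewrite (bigID (fun p : nat => p%:R <= expR w))/=; apply: lerD.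
  have m0 : (0 < Num.truncn (expR w))%N by rewrite truncn_gt0 -expR0 ler_expR ltW.
  apply: (@le_trans _ _ (1 + ln (Num.truncn (expR w))%:R)); last first.
    by rewrite lerD2l -[leRHS]expRK ler_ln ?posrE ?ltr0n ?expR_gt0// truncn_le ?ltW ?expR_gt0.
  apply: le_trans (harmonic_le _ m0).
  apply: ler_sum_subset; rewrite ?iota_uniq//.
  move=> p _ /andP[/andP[pp _] pw].
  by rewrite andbT mem_iota prime_gt0//= add1n ltnS truncn_ge_nat// ltW ?expR_gt0.
apply: (@le_trans _ _ (w^-1 * \sum_(p <- iota 1 N | prime p && (p%:R <= expR K)) ln (p%:R : R) / p%:R)).
  rewrite mulr_sumr [leLHS]big_mkcondr/=; apply: ler_sum => p /andP[pp _].
  have p0 : (0 : R) < p%:R by rewrite ltr0n prime_gt0.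
  have l0 : 0 <= ln (p%:R : R) by rewrite ln_ge0// ler1n prime_gt0.
  rewrite -ltNge; case: ltP => h; last by rewrite mulr_ge0// ?divr_ge0// ltW ?invr_gt0.
  rewrite mulrA; apply: ler_peMl; first by rewrite invr_ge0 ltW.
  rewrite mulrC ler_pdivlMr// mul1r.
  by rewrite -ler_expR lnK// ltW.
rewrite mulrC ler_pM2r ?invr_gt0//.
apply: le_trans (mertens_le _ _) _; first by rewrite -expR0 ler_expR.
by rewrite expRK.
Qed.

(* Convexity gives [p^lam <= 1 + lam (ln p) Z^lam] for [p <= Z]. *)
Lemma smooth_exponent_le (lam K w : R) (N : nat) :
  0 <= lam -> lam <= 1 / 4 -> 0 <= K -> 0 < w ->
  \sum_(q <- iota 1 N | prime q && (q%:R <= expR K))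
     \sum_(a <- iota 1 N | (q ^ a <= N)%N) (q ^ a)%:R `^ (lam - 1) <=
  4 * (1 + w + 2 * K / w + 2 * lam * K * expR (lam * K)).
Proof.
move=> l0 l1 K0 w0.
have Z1 : (1 : R) <= expR K by rewrite -expR0 ler_expR.
apply: (@le_trans _ _ (4 * \sum_(q <- iota 1 N | prime q && (q%:R <= expR K)) (q%:R : R) `^ (lam - 1))).
  rewrite mulr_sumr; apply: ler_sum => q /andP[pq _]; exact: prime_powers_le.
rewrite ler_pM2l//.
apply: (@le_trans _ _ (\sum_(q <- iota 1 N | prime q && (q%:R <= expR K)) ((q%:R : R)^-1
   + lam * expR (lam * K) * (ln q%:R / q%:R)))).
  apply: ler_sum => q /andP[pq qZ].
  have q0 : (0 : R) < q%:R by rewrite ltr0n prime_gt0.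
  have lq0 : 0 <= ln (q%:R : R) by rewrite ln_ge0// ler1n prime_gt0.
  have lqK : ln (q%:R : R) <= K by rewrite -[leRHS]expRK ler_ln ?posrE ?expR_gt0.
  rewrite powRD ?(gt_eqF q0) ?implybT// powR_inv1 ?(ltW q0)//.
  have -> : (q%:R : R)^-1 + lam * expR (lam * K) * (ln q%:R / q%:R) =
    (1 + lam * ln q%:R * expR (lam * K)) * q%:R^-1 by ring.
  rewrite ler_pM2r ?invr_gt0// /powR gt_eqF//.
  have h := expR_ge1Dx (- (lam * ln (q%:R : R))).
  have h3 : expR (- (lam * ln (q%:R : R))) * expR (lam * ln q%:R) = 1 by rewrite -expRD addNr expR0.
  have h2 : expR (lam * ln (q%:R : R)) <= expR (lam * K) by rewrite ler_expR ler_wpM2l.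
  have h4 := expR_gt0 (lam * ln (q%:R : R)).
  have h5 : 0 <= lam * ln (q%:R : R) by rewrite mulr_ge0.
  move: h h2 h3 h4 h5.
  set t := lam * ln _; move: (expR (- t)) (expR t) (expR (lam * K)) => u v s.
  move: t => t h h2 h3 h4 h5.
  have h6 : (1 - t) * v <= u * v by rewrite ler_pM2r// addrC; lra.
  have h7 : t * v <= t * s by rewrite ler_wpM2l.
  by lra.
rewrite big_split/= -mulr_sumr; apply: lerD; first exact: sum_inv_prime_le.
have := mertens_le N Z1; rewrite expRK => h.
apply: le_trans (ler_wpM2l _ h) _; first by rewrite mulr_ge0 ?expR_ge0.
by rewrite le_eqVlt; apply/orP; left; apply/eqP; ring.
Qed.

End Euler.

(** * Rough parts *)

Section RoughWeight.
Variable R : realType.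
Variables (lam : R).
Hypothesis l0 : 0 < lam.

Let psmooth (ps : seq nat) (n : nat) : nat := (\prod_(q <- ps) q ^ logn q n)%N.
(** For [ps] the primes up to e^(1/lam) and r the rough part of n, n^(lam - 1) r^(-2 lam) equals
    n^(-1 - lam) (n / r)^(2 lam). In this form the smooth part has a positive exponent and its power
    expands with the nonnegative coefficients [dlt]. *)
Let wt ps n : R := (n%:R : R) `^ (-1 - lam) * (psmooth ps n)%:R `^ (2 * lam).
Let dlt (q a : nat) : R := (q ^ a)%:R `^ (2 * lam) - (q ^ a.-1)%:R `^ (2 * lam).
Let eps N q : R := \sum_(a <- iota 1 N | (q ^ a <= N)%N) dlt q a * (q ^ a)%:R `^ (-1 - lam).

Let dlt_ge0 q a : prime q -> 0 <= dlt q a.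
Proof.
move=> pq; rewrite subr_ge0.
apply: ge0_ler_powR; rewrite ?nnegrE ?ler0n//; first by rewrite mulr_ge0// ltW.
by rewrite ler_nat leq_exp2l ?leq_pred// prime_gt1.
Qed.

Let eps_ge0 N q : prime q -> 0 <= eps N q.
Proof. by move=> pq; apply: sumr_ge0 => a _; rewrite mulr_ge0 ?powR_ge0 ?dlt_ge0. Qed.

Let telescope_dlt q v : (q ^ v)%:R `^ (2 * lam) = 1 + \sum_(a <- iota 1 v) dlt q a.
Proof.
elim: v => [|v IH]; first by rewrite big_nil addr0 expn0 powR1.
by rewrite -(addn1 v) iotaD big_cat/= big_seq1 add1n addn1 addrA -IH /dlt addrC subrK.
Qed.

(* Adjoining one prime [q] to [ps] multiplies the sum by at most [1 + eps N q]:
   expand the new factor [(q ^ v) `^ (2 lam)] as a telescoping sum. *)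
Let smooth_weight_le N ps : uniq ps -> all prime ps ->
  \sum_(n <- iota 1 N) wt ps n <=
  \prod_(q <- ps) (1 + eps N q) * \sum_(n <- iota 1 N) (n%:R : R) `^ (-1 - lam).
Proof.
elim: ps => [|q ps IH] /=.
  move=> _ _; rewrite big_nil mul1r; apply: ler_sum => n _.
  by rewrite /wt /psmooth big_nil powR1 mulr1.
move=> /andP[qps ups] /andP[pq pps]; rewrite big_cons -mulrA.
have wt0 n : 0 <= wt ps n by rewrite mulr_ge0// powR_ge0.
have := ler_wpM2l (_ : 0 <= 1 + eps N q) (IH ups pps); rewrite addr_ge0 ?eps_ge0// => /(_ isT).
apply: le_trans.
have e n : wt (q :: ps) n = wt ps n + \sum_(a <- iota 1 (logn q n)) dlt q a * wt ps n.
  rewrite /wt /psmooth big_cons natrM powRM ?ler0n// telescope_dlt -mulr_suml; ring.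
rewrite (eq_bigr _ (fun n _ => e n)) big_split/= mulrDl mul1r lerD2l.
apply: (@le_trans _ _ (\sum_(n <- iota 1 N)
   \sum_(a <- iota 1 N | (q ^ a <= N)%N && (a <= logn q n)%N) dlt q a * wt ps n)).
  rewrite big_seq [leRHS]big_seq; apply: ler_sum => n; rewrite mem_iota => /andP[n0 nN].
  apply: ler_sum_subset; rewrite ?iota_uniq//; first by move=> a; rewrite mulr_ge0 ?dlt_ge0.
  move=> a; rewrite !mem_iota => /andP[a0]; rewrite add1n ltnS => av _.
  have h : (q ^ a <= n)%N by rewrite dvdn_leq// pfactor_dvdn.
  have := ltn_expl a (prime_gt1 pq); rewrite a0 av andbT /= => h2.
  by apply/andP; split; lia.
rewrite (exchange_big_dep (fun a => (q ^ a <= N)%N))/=; last by move=> n a _ /andP[].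
rewrite mulr_suml big_seq_cond [leRHS]big_seq_cond; apply: ler_sum => a /andP[].
rewrite mem_iota => /andP[a0 _] aN; rewrite -mulr_sumr -mulrA ler_wpM2l ?dlt_ge0//.
rewrite aN/= mulr_sumr.
apply: (@le_trans _ _ (\sum_(M <- iota 1 N) wt ps (q ^ a * M)%N)).
  apply: (@ler_sum_cover R _ _ _ _ _ predT (fun M => q ^ a * M)%N); rewrite ?iota_uniq//.
  move=> n; rewrite mem_iota => /andP[n0 nN] av.
  have ad : (q ^ a %| n)%N by rewrite pfactor_dvdn.
  exists (n %/ q ^ a)%N; split=> //; last by rewrite mulnC divnK.
  rewrite mem_iota divn_gt0 ?expn_gt0 ?prime_gt0// dvdn_leq//=.
  by apply: leq_ltn_trans nN; exact: leq_div.
rewrite big_seq [leRHS]big_seq; apply: ler_sum => M; rewrite mem_iota => /andP[M0 _].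
rewrite /wt natrM powRM ?ler0n// -mulrA.
suff -> : psmooth ps (q ^ a * M) = psmooth ps M by [].
rewrite /psmooth big_seq [RHS]big_seq; apply: eq_bigr => p pps'.
have pp := allP pps _ pps'.
have w0 : (0 < q ^ a)%N by rewrite expn_gt0 prime_gt0.
rewrite lognM// lognX logn_prime//.
case: eqP => [ep|_]; last by rewrite muln0.
by move: qps; rewrite -ep pps'.
Qed.

Hypothesis l1 : lam <= 1 / 4.

(** From 1 - e^(-t) <= t with t = 2 lam ln q, [dlt q a] is at most t (q^a)^(2 lam). The powers of
    [q] then sum to at most 4 q^(lam - 1), and ln q <= 1 / lam turns q^lam into at most e; the
    constant is 2 . 4 . e. *)
Let eps_le N q : prime q -> ln (q%:R : R) <= lam^-1 ->
  eps N q <= 8 * expR 1 * lam * (ln q%:R / q%:R).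
Proof.
move=> pq ql; have q0 : (0 : R) < q%:R by rewrite ltr0n prime_gt0.
have lq0 : 0 <= ln (q%:R : R) by rewrite ln_ge0// ler1n prime_gt0.
apply: (@le_trans _ _ (2 * lam * ln q%:R *
    \sum_(a <- iota 1 N | (q ^ a <= N)%N) (q ^ a)%:R `^ (lam - 1))).
  rewrite /eps mulr_sumr big_seq_cond [leRHS]big_seq_cond; apply: ler_sum => a /andP[].
  rewrite mem_iota => /andP[a0 _] _.
  have w0 : (0 : R) < (q ^ a)%:R by rewrite ltr0n expn_gt0 prime_gt0.
  have -> : lam - 1 = 2 * lam + (-1 - lam) by ring.
  rewrite [X in _ <= _ * X]powRD ?(gt_eqF w0) ?implybT// mulrA; apply: ler_wpM2r; first exact: powR_ge0.
  rewrite /dlt; have -> : (q ^ a)%N = (q * q ^ a.-1)%N by rewrite -expnS prednK.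
  have u0 : (0 : R) < (q ^ a.-1)%:R by rewrite ltr0n expn_gt0 prime_gt0.
  rewrite natrM powRM ?(ltW q0) ?(ltW u0)//; set u := _ `^ _; rewrite mulrA.
  have : 0 <= (q ^ a.-1)%:R `^ (2 * lam) :> R by rewrite powR_ge0.
  rewrite /u /powR (gt_eqF q0); set v := (if _ then _ else _) => v0.
  have := expR_ge1Dx (- (2 * lam * ln (q%:R : R))).
  have h3 : expR (- (2 * lam * ln (q%:R : R))) * expR (2 * lam * ln q%:R) = 1 by rewrite -expRD addNr expR0.
  have h4 := expR_gt0 (2 * lam * ln (q%:R : R)).
  move: h3 h4; set t := 2 * lam * ln _; move: (expR (- t)) (expR t) => x y h3 h4 h5.
  have h6 : (1 - t) * y <= x * y by rewrite ler_pM2r// addrC; lra.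
  have h7 : (y - 1) * v <= (t * y) * v by rewrite ler_wpM2r//; lra.
  by lra.
have h := prime_powers_le N l1 pq.
apply: le_trans (ler_wpM2l _ h) _; first by rewrite !mulr_ge0// ltW.
have hq : (q%:R : R) `^ (lam - 1) <= expR 1 * q%:R^-1.
  rewrite powRD ?(gt_eqF q0) ?implybT// powR_inv1 ?(ltW q0)// ler_wpM2r ?invr_ge0//.
  rewrite /powR gt_eqF// ler_expR mulrC -ler_pdivlMr// mul1r//.
have -> : 8 * expR 1 * lam * (ln q%:R / q%:R) = 2 * lam * ln q%:R * (4 * (expR 1 * q%:R^-1)) by ring.
by rewrite ler_wpM2l ?ler_wpM2l// !mulr_ge0// ltW.
Qed.

(** The factor lam in [eps_le] cancels against Mertens' bound 2 / lam over the primes up to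
    e^(1/lam), so the whole product over them is at most e^(16 e); the factor 1 + 1 / lam is the sum
    of n^(-1 - lam). *)
Lemma rough_weight_le (N : nat) :
  \sum_(n <- iota 1 N) (n%:R : R) `^ (lam - 1) *
     (partn n [pred p : nat | lam^-1 < ln p%:R])%:R `^ (- (2 * lam)) <=
  expR (16 * expR 1) * (1 + lam^-1).
Proof.
pose ps := seq.filter (fun q : nat => ~~ (lam^-1 < ln q%:R)) (seq.filter prime (iota 1 N)).
have ups : uniq ps by rewrite !filter_uniq ?iota_uniq.
have pps : all prime ps.
  by apply/allP => p; rewrite !mem_filter => /and3P[].
apply: (@le_trans _ _ (\sum_(n <- iota 1 N) wt ps n)).
  rewrite big_seq [leRHS]big_seq; apply: ler_sum => n; rewrite mem_iota => /andP[n0 nN].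
  set P : nat_pred := [pred p : nat | lam^-1 < ln p%:R].
  have n0' : (0 : R) < n%:R by rewrite ltr0n.
  have e : psmooth ps n = partn n P^'.
    rewrite (@widen_partn N) -1?ltnS// /psmooth /ps big_filter big_filter_cond.
    rewrite /index_iota subn0 /= big_cons lognE /= expn0 mul1n.
    have -> : (\prod_(j <- iota 1 N | j \in P^') j ^ logn j n =
               \prod_(j <- iota 1 N | prime j && (j \in P^')) j ^ logn j n)%N.
      rewrite big_mkcond [RHS]big_mkcond; apply: eq_bigr => j _.
      by case pj: (prime j) => //=; rewrite lognE pj; case: ifP.
    by case: ifP.
  rewrite le_eqVlt; apply/orP; left; apply/eqP; rewrite /wt e.
  have eN : (n%:R : R) = (partn n P)%:R * (partn n P^')%:R by rewrite -natrM partnC.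
  have a0 : (0 : R) < (partn n P)%:R by rewrite ltr0n part_gt0.
  have b0 : (0 : R) < (partn n P^')%:R by rewrite ltr0n part_gt0.
  have -> : lam - 1 = 2 * lam + (-1 - lam) by ring.
  rewrite powRD ?(gt_eqF n0') ?implybT// mulrAC [RHS]mulrC; congr (_ * _).
  by rewrite eN powRM ?ltW// mulrAC -powRD ?(gt_eqF a0) ?implybT// addrN powRr0 mul1r.
apply: le_trans (smooth_weight_le N ups pps) _.
apply: ler_pM; last exact: sum_powR_le.
- rewrite big_seq; apply: prodr_ge0 => q /(allP pps) pq; rewrite addr_ge0 ?eps_ge0//.
- by apply: sumr_ge0 => *; rewrite powR_ge0.
apply: (@le_trans _ _ (\prod_(q <- ps) (1 + `|eps N q|))).
  rewrite big_seq [leRHS]big_seq; apply: ler_prod => q /(allP pps) pq.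
  by rewrite addr_ge0 ?eps_ge0//= lerD2l ler_norm.
apply: le_trans (prod_1D_le_expR _ _ _) _; first by move=> q; exact: normr_ge0.
rewrite ler_expR.
have y1 : (1 : R) <= expR lam^-1 by rewrite -expR0 ler_expR invr_ge0 ltW.
have := mertens_le N y1; rewrite expRK => h.
have -> : 16 * expR 1 = (8 * expR 1 * lam) * (2 * lam^-1) :> R by field; rewrite gt_eqF.
have c0 : 0 <= 8 * expR 1 * lam by rewrite !mulr_ge0 ?expR_ge0// ltW.
apply: le_trans (ler_wpM2l c0 h); rewrite mulr_sumr /ps big_filter big_filter_cond/=.
rewrite big_seq_cond [leRHS]big_seq_cond.
rewrite (eq_bigl (fun i => (i \in iota 1 N) && (prime i && (i%:R <= expR lam^-1)))); last first.
  move=> i; rewrite -leNgt; case: (boolP (prime i)) => pi_; rewrite ?andbF//=.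
  by rewrite -[in RHS](@lnK R i%:R) ?posrE ?ltr0n ?prime_gt0// ler_expR.
apply: ler_sum => q /and3P[_ pq]; rewrite -{1}[q%:R](@lnK R) ?posrE ?ltr0n ?prime_gt0//.
by rewrite ler_expR => ql; rewrite ger0_norm ?eps_ge0 ?eps_le.
Qed.

End RoughWeight.

(** * Integers whose totient is divisible by d *)

Lemma leq_totient n : (totient n <= n)%N.
Proof.
rewrite totient_count_coprime -[leqRHS](@subn0 n) -[leqRHS]muln1 -sum_nat_const_nat.
by rewrite leq_sum// => i _; case: coprime.
Qed.

Lemma short_divisor k d e : (0 < d)%N -> short k d -> (e %| d)%N -> (1 < e)%N ->
  short k.-1 (d %/ e).
Proof.
move=> d0 [s /andP[ps sk] ed] de e1.
have pl := pdiv_prime e1; set l := pdiv e in pl.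
have le_ : (l %| e)%N by exact: pdiv_dvd.
have ld : (l %| \prod_(p <- s) p)%N by rewrite ed (dvdn_trans le_).
have ls : l \in s.
  move: ld; rewrite Euclid_dvd_prod// big_has => /hasP[p psn lp].
  by have := allP ps _ psn; move: lp => /[swap] pp; rewrite dvdn_prime2// => /eqP ->.
have e2 : d = (l * \prod_(p <- rem l s) p)%N by rewrite -ed (big_rem l).
have sh : short k.-1 (\prod_(p <- rem l s) p)%N.
  exists (rem l s) => //; rewrite size_rem//; apply/andP; split; last by rewrite -!subn1 leq_sub2r.
  by apply/allP => p /mem_rem; exact: (allP ps).
apply: short_dvd sh _.
have l0 := prime_gt0 pl.
have e0 : (0 < e)%N by lia.
have [f ef] : exists f, e = (l * f)%N by exists (e %/ l)%N; rewrite mulnC divnK.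
have f0 : (0 < f)%N by move: e0; rewrite ef muln_gt0 => /andP[].
rewrite e2 ef divnMl//; apply: dvdn_div.
by rewrite -(dvdn_pmul2l l0) -ef -e2.
Qed.

Lemma totient_expn_inj a p q : (0 < a)%N -> prime p -> prime q ->
  totient (p ^ a) = totient (q ^ a) -> p = q.
Proof.
move=> a0; wlog pq : p q / (p < q)%N => [h pp qq e|pp qq].
  by case: (ltngtP p q) => // l; [exact: (h p q) | rewrite (h q p)].
rewrite !totient_pfactor// => e.
have p1 := prime_gt1 pp.
have h1 : (p.-1 < q.-1)%N by lia.
have h2 : (p ^ a.-1 <= q ^ a.-1)%N by apply: leq_exp2r_le || (case: (a.-1) => [|b] //; rewrite leq_exp2r// ltnW).
have h3 : (0 < p ^ a.-1)%N by rewrite expn_gt0 prime_gt0.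
by nia.
Qed.

Section TotientSums.
Variable R : realType.

(* For each exponent [a] at most one prime power [q ^ a] has a given totient. *)
Lemma prime_power_totient_sum (N e : nat) : (0 < N)%N -> (0 < e)%N ->
  \sum_(q <- iota 1 N | prime q)
    \sum_(a <- iota 1 N | (q ^ a <= N)%N && (e %| totient (q ^ a))%N) ((q ^ a)%:R : R)^-1
  <= 2 * (1 + ln N%:R) ^+ 2 / e%:R.
Proof.
move=> N0 e0.
have lN : 0 <= ln (N%:R : R) by rewrite ln_ge0// ler1n.
apply: (@le_trans _ _ (\sum_(a <- iota 1 N | (2 ^ a <= N)%N)
   \sum_(q <- iota 1 N | [&& prime q, (q ^ a <= N)%N & (e %| totient (q ^ a))%N]) ((q ^ a)%:R : R)^-1)).
  rewrite (exchange_big_dep (fun a => (2 ^ a <= N)%N))/=; last first.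
    move=> q a pq /andP[qa _]; apply: leq_trans qa.
    by case: a => // a; rewrite leq_exp2r// prime_gt1.
  by apply: ler_sum.
apply: (@le_trans _ _ (\sum_(a <- iota 1 N | (2 ^ a <= N)%N) (1 + ln N%:R) / e%:R)).
  rewrite big_seq_cond [leRHS]big_seq_cond; apply: ler_sum => a /andP[].
  rewrite mem_iota => /andP[a0 _] _.
  pose A q := [&& prime q, (q ^ a <= N)%N & (e %| totient (q ^ a))%N].
  apply: (@le_trans _ _ (\sum_(q <- seq.filter A (iota 1 N)) (e%:R * (totient (q ^ a) %/ e)%:R)^-1)).
    rewrite [leRHS]big_filter; apply: ler_sum => q /and3P[pq _ eq].
    rewrite -natrM mulnC divnK// lef_pV2 ?posrE ?ltr0n ?totient_gt0 ?expn_gt0 ?prime_gt0// ler_nat.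
    rewrite totient_pfactor// -[a in leqRHS]prednK// expnS leq_mul2r; apply/orP; right; lia.
  pose f q := (totient (q ^ a) %/ e)%N.
  have -> : \sum_(q <- seq.filter A (iota 1 N)) (e%:R * (totient (q ^ a) %/ e)%:R)^-1 =
     \sum_(k <- map f (seq.filter A (iota 1 N))) e%:R^-1 * (k%:R : R)^-1.
    by rewrite big_map; apply: eq_bigr => q _; rewrite invfM.
  apply: (@le_trans _ _ (\sum_(k <- iota 1 N) e%:R^-1 * (k%:R : R)^-1)).
    apply: ler_sum_subset.
    - rewrite map_inj_in_uniq ?filter_uniq ?iota_uniq// => p q.
      rewrite !mem_filter => /andP[/and3P[pp _ ep] _] /andP[/and3P[pq _ eq] _] h.
      by apply: (totient_expn_inj a0) => //; rewrite -(divnK ep) -(divnK eq) -/(f p) h.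
    - by move=> k; rewrite mulr_ge0// invr_ge0.
    move=> k /mapP[q]; rewrite mem_filter => /andP[/and3P[pq qN eq] _] -> _.
    rewrite andbT mem_iota /f; have t0 : (0 < totient (q ^ a))%N.
      by rewrite totient_gt0 expn_gt0 prime_gt0.
    rewrite divn_gt0// dvdn_leq//= add1n ltnS.
    apply: leq_trans (leq_div _ _) _; apply: leq_trans _ qN.
    by rewrite totient_pfactor// -[a in leqRHS]prednK// expnS leq_mul2r; apply/orP; right; lia.
  rewrite -mulr_sumr mulrC ler_pM2r ?invr_gt0 ?ltr0n//; exact: harmonic_le.
rewrite -big_filter big_const_seq count_predT iter_addr_0 size_filter.
(* The second logarithm comes from the exponents: 2^a <= N and ln 2 >= 1/2 leave at most 2 ln N of
   them. *)
have cnt : (count (fun a => (2 ^ a <= N)%N) (iota 1 N) <= trunc_log 2 N)%N.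
  rewrite -size_filter -(size_iota 1 (trunc_log 2 N)).
  apply: uniq_leq_size; first by rewrite filter_uniq ?iota_uniq.
  move=> a; rewrite mem_filter !mem_iota => /andP[aN /andP[a0 _]].
  by rewrite a0/= add1n ltnS trunc_log_max.
have h : (trunc_log 2 N)%:R <= 2 * ln (N%:R : R).
  have : ln ((2 ^ trunc_log 2 N)%:R : R) <= ln N%:R.
    by rewrite ler_ln ?posrE ?ltr0n ?expn_gt0// ler_nat trunc_logP.
  rewrite natrX lnXn// -[_ *+ _]mulr_natl.
  have : 2^-1 <= ln (2 : R) by have := @ln_ge1B R 2 (ltr0Sn R 1); lra.
  have : 0 <= (trunc_log 2 N)%:R :> R by [].
  move: (trunc_log 2 N)%:R (ln 2) (ln N%:R) => u v w u0 v2 uvw.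
  by have := ler_wpM2l u0 v2; lra.
rewrite -[leLHS]mulr_natl mulrA ler_pM2r ?invr_gt0 ?ltr0n//.
have : (count (fun a => (2 ^ a <= N)%N) (iota 1 N))%:R <= 2 * ln (N%:R : R).
  by apply: le_trans h; rewrite ler_nat.
move: (_%:R) (ln _) lN => u v v0 uv.
by nra.
Qed.

Definition totient_sum (N d : nat) : R :=
  \sum_(W <- iota 1 N | (d %| totient W)%N) (W%:R : R)^-1.

(** Induction on the number of primes of [d]. Some exact prime power q^a of W has e = gcd(d,
    phi(q^a)) > 1, and d / e, with fewer primes, divides the totient of the cofactor. For fixed e
    the prime powers contribute at most H / e, and there are at most 2^k choices of e. The bound [k]
    stays fixed so that every level of the recursion costs the same factor. *)
Lemma totient_sum_le (N k j d : nat) : (0 < N)%N -> (0 < d)%N -> (j <= k)%N -> short j d ->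
  totient_sum N d <=
  (2 ^+ k * (2 * (1 + ln N%:R) ^+ 2)) ^+ j * (1 + ln N%:R) / d%:R.
Proof.
move=> N0; set H := 2 * _; set H0 := 1 + _.
have lN : 0 <= ln (N%:R : R) by rewrite ln_ge0// ler1n.
have H01 : 1 <= H0 by rewrite /H0; lra.
have H1 : 1 <= H.
  have : 1 <= H0 ^+ 2 by rewrite exprn_ege1.
  by rewrite /H -/H0; lra.
elim: j d => [|j IH] d d0 jk sd.
  rewrite expr0 mul1r.
  have d1 : d = 1%N by case: sd => s /andP[_]; case: s => // _; rewrite big_nil.
  rewrite d1 divr1; apply: le_trans (harmonic_le R N0).
  by apply: ler_sum_subset; [exact: iota_uniq | move=> i; rewrite invr_ge0 | move=> i ->].
case: (ltngtP d 1%N) => [|d1|d1]; first by lia.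
  pose I1 := [seq (q, a) | q <- iota 1 N, a <- iota 1 N].
  pose I2 := [seq (x, M) | x <- I1, M <- iota 1 N].
  pose I := [seq (e, x) | e <- divisors d, x <- I2].
  pose P (i : nat * (nat * nat * nat)) := [&& (1 < i.1)%N, prime i.2.1.1,
    (i.2.1.1 ^ i.2.1.2 <= N)%N && (i.1 %| totient (i.2.1.1 ^ i.2.1.2))%N &
    (d %/ i.1 %| totient i.2.2)%N].
  pose g (i : nat * (nat * nat * nat)) := (i.2.1.1 ^ i.2.1.2 * i.2.2)%N.
  apply: (@le_trans _ _ (\sum_(i <- I | P i) ((g i)%:R : R)^-1)).
    apply: (@ler_sum_cover R _ _ _ I _ P g); rewrite ?iota_uniq//.
    move=> W; rewrite mem_iota => /andP[W0 WN] dW.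
    have pl := pdiv_prime d1.
    have [q qW lq] := prime_dvd_totient pl W0 (dvdn_trans (pdiv_dvd d) dW).
    have pq : prime q by move: qW; rewrite mem_primes => /and3P[].
    have [M eW /andP[M0 qM]] := unitary_split W0 pq.
    set a := logn q W in lq eW.
    have a0 : (0 < a)%N by rewrite /a logn_gt0.
    have q0 := prime_gt0 pq.
    have w0 : (0 < q ^ a)%N by rewrite expn_gt0 q0.
    have wW : (q ^ a <= W)%N by rewrite eW leq_pmulr.
    have MW : (M <= W)%N by rewrite eW leq_pmull.
    pose e := gcdn d (totient (q ^ a)).
    have ed : (e %| d)%N by exact: dvdn_gcdl.
    have e1 : (1 < e)%N.
      apply: leq_trans (prime_gt1 pl) _; apply: dvdn_leq; first by rewrite gcdn_gt0 d0.
      by rewrite dvdn_gcd pdiv_dvd.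
    exists (e, ((q, a), M)); split => //.
      apply: allpairs_f; first by rewrite -dvdn_divisors.
      apply: allpairs_f; last by rewrite mem_iota M0 (leq_ltn_trans MW).
      apply: allpairs_f; rewrite mem_iota ?q0 ?a0/=.
        apply: leq_ltn_trans WN; apply: leq_trans wW.
        by rewrite -{1}(expn1 q) leq_exp2l// prime_gt1.
      apply: leq_ltn_trans WN; apply: leq_trans wW.
      exact/ltnW/ltn_expl/prime_gt1.
    rewrite /P/= e1 pq dvdn_gcdr andbT/=; apply/andP; split.
      by apply: leq_trans wW _; rewrite -ltnS -add1n.
    apply: dvdn_gcd_split => //; rewrite -totient_coprime -?eW//.
    by rewrite coprimeXl// prime_coprime.
  apply: (@le_trans _ _ (\sum_(e <- divisors d | (1 < e)%N)
      (\sum_(q <- iota 1 N | prime q)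
      \sum_(a <- iota 1 N | (q ^ a <= N)%N && (e %| totient (q ^ a))%N) ((q ^ a)%:R : R)^-1)
      * totient_sum N (d %/ e))).
    rewrite big_mkcond/= big_allpairs_dep/= [leRHS]big_mkcond/=.
    apply: ler_sum => e _; rewrite big_allpairs_dep/= big_allpairs_dep/=.
    rewrite /P /g /=; case: (1 < e)%N => /=; last first.
      by rewrite big1// => q _; rewrite big1// => a _; rewrite big1.
    rewrite mulr_suml [leRHS]big_mkcond/=; apply: ler_sum => q _.
    case: (prime q) => /=; last by rewrite big1// => a _; rewrite big1.
    rewrite mulr_suml [leRHS]big_mkcond/=; apply: ler_sum => a _.
    case: (_ && _) => /=; last by rewrite big1.
    rewrite -big_mkcond/= mulr_sumr; apply: ler_sum => M _.
    by rewrite natrM invfM.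
  apply: (@le_trans _ _ (\sum_(e <- divisors d | (1 < e)%N)
     (2 ^+ k * H) ^+ j * H * H0 / d%:R)).
    rewrite big_seq_cond [leRHS]big_seq_cond; apply: ler_sum => e.
    rewrite -dvdn_divisors// => /andP[ed e1].
    have e0 : (0 < e)%N by lia.
    have e0' : (0 : R) < e%:R by rewrite ltr0n.
    have f0 : (0 < d %/ e)%N by rewrite divn_gt0// dvdn_leq.
    have h1 := prime_power_totient_sum N0 e0.
    have h2 := IH _ f0 (ltnW jk) (short_divisor d0 sd ed e1).
    apply: le_trans (ler_pM _ _ h1 h2) _.
    - by apply: sumr_ge0 => q _; apply: sumr_ge0 => a _; rewrite invr_ge0.
    - by apply: sumr_ge0 => W _; rewrite invr_ge0.
    rewrite -[d in leRHS](divnK ed) natrM; rewrite -/H0 -/H.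
    rewrite le_eqVlt; apply/orP; left; apply/eqP; field.
    by rewrite !gt_eqF// ltr0n.
  rewrite -big_filter big_const_seq count_predT iter_addr_0 -[leLHS]mulr_natl.
  have cnt : (size (seq.filter (ltn 1) (divisors d)))%:R <= 2 ^+ k :> R.
    rewrite -natrX ler_nat; apply: leq_trans (leq_trans (size_divisors_short sd) _).
      by rewrite size_filter count_size.
    by rewrite leq_exp2l.
  apply: le_trans (ler_wpM2r _ cnt) _.
    by rewrite !mulr_ge0 ?exprn_ge0 ?mulr_ge0 ?invr_ge0 ?exprn_ge0//; lra.
  by rewrite le_eqVlt exprS; apply/orP; left; apply/eqP; ring.
rewrite d1 divr1; apply: (@le_trans _ _ H0).
  apply: le_trans (harmonic_le R N0).
  by apply: ler_sum_subset; [exact: iota_uniq | move=> i; rewrite invr_ge0 | move=> i ->].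
rewrite ler_peMl//; first by lra.
rewrite exprn_ege1// -[1]mulr1 ler_pM//.
by rewrite exprn_ege1//; lra.
Qed.

End TotientSums.

(** * Counting the exceptional integers *)

(** Subtracting two solutions gives a (q - p) = b (q' - p') and m (q - p) = m' (q' - p'). If q
    differs from p, these two relations have the same ratio, so a m' = b m. Here [a] and [b] stand
    for the totients of [m] and [m']. *)
Lemma two_line_unique (a b m m' p q p' q' h : nat) :
  (0 < p)%N -> (0 < p')%N -> (0 < q')%N -> (0 < m)%N -> (0 < m')%N ->
  (a * p.-1 = b * p'.-1)%N -> (a * q.-1 = b * q'.-1)%N ->
  (m * p + h = m' * p')%N -> (m * q + h = m' * q')%N ->
  (a * m' <> b * m)%N -> (p <= q)%N -> p = q.
Proof.
move=> p0 p'0 q'0 m0 m'0 t1 t2 ep eq nz pq.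
have p'q' : (p' <= q')%N by rewrite -(leq_pmul2l m'0) -ep -eq leq_add2r leq_mul2l pq orbT.
have e1 : (a * (q - p) = b * (q' - p'))%N.
  have -> : (q - p = q.-1 - p.-1)%N by clear -p0 pq; lia.
  have -> : (q' - p' = q'.-1 - p'.-1)%N by clear -p'0 p'q'; lia.
  by rewrite !mulnBr t1 t2.
have e2 : (m * (q - p) = m' * (q' - p'))%N.
  by rewrite !mulnBr -ep -eq subnDr.
apply/eqP; rewrite eqn_leq pq/= leqNgt; apply/negP => qp; apply: nz.
have D0 : (0 < q - p)%N by rewrite subn_gt0.
apply/eqP; rewrite -(eqn_pmul2r D0) mulnAC e1 -[X in _ == X]mulnA e2; apply/eqP; ring.
Qed.

Section Counting.
Variable R : realType.

Lemma count_congruent_real (X Q : nat) (B : pred nat) : (0 < Q)%N ->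
  (forall m n, (0 < m)%N -> (m <= n)%N -> (n <= X)%N -> B m -> B n -> (Q %| n - m)%N) ->
  ((count B (iota 1 X))%:R : R) <= X%:R / Q%:R + 1.
Proof.
move=> Q0 H; have := count_le_congruent Q0 H; rewrite -(ler_nat R) => /le_trans; apply.
rewrite natrD lerD2r ler_pdivlMr ?ltr0n// -natrM ler_nat; exact: leq_divM.
Qed.

Lemma count_unique (X : nat) (B : pred nat) :
  (forall m n, (0 < m)%N -> (m <= n)%N -> (n <= X)%N -> B m -> B n -> m = n) ->
  ((count B (iota 1 X))%:R : R) <= 1.
Proof.
move=> H; have Q0 : (0 < X.+1)%N by [].
have := @count_le_congruent X X.+1 B Q0 _; rewrite divn_small// add0n => h.
rewrite (ler_nat R _ 1); apply: h => m n m0 mn nX Bm Bn.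
by rewrite (H _ _ m0 mn nX Bm Bn) subnn dvdn0.
Qed.

(** One element of [B] already forces gcd(Q1, Q2) to divide [h], so the least common multiple is at
    least Q1 Q2 / h. This is how the size of [h] enters the congruence counts. *)
Lemma count_two_moduli (X h Q1 Q2 : nat) (B : pred nat) :
  (0 < Q1)%N -> (0 < Q2)%N -> (0 < h)%N ->
  (forall n, (0 < n)%N -> (n <= X)%N -> B n -> (gcdn Q1 Q2 %| h)%N) ->
  (forall m n, (0 < m)%N -> (m <= n)%N -> (n <= X)%N -> B m -> B n ->
     (Q1 %| n - m)%N /\ (Q2 %| n - m)%N) ->
  ((count B (iota 1 X))%:R : R) <= X%:R * h%:R / (Q1%:R * Q2%:R) + 1.
Proof.
move=> Q10 Q20 h0 Hg H.
case: (boolP (has B (iota 1 X))) => [/hasP[n]|]; last first.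
  by rewrite has_count -eqn0Ngt => /eqP ->; rewrite addr_ge0// divr_ge0// mulr_ge0.
rewrite mem_iota add1n ltnS => /andP[n0 nX] Bn.
have gh := dvdn_leq h0 (Hg n n0 nX Bn).
have L0 : (0 < lcmn Q1 Q2)%N by rewrite lcmn_gt0 Q10.
apply: le_trans (count_congruent_real L0 _) _.
  by move=> a b a0 ab bX Ba Bb; have [h1 h2] := H a b a0 ab bX Ba Bb; rewrite dvdn_lcm h1.
rewrite lerD2r -mulrA ler_wpM2l// ler_pdivlMr ?mulr_gt0 ?ltr0n// mulrC.
rewrite ler_pdivrMr ?ltr0n// -!natrM ler_nat -muln_lcm_gcd mulnC.
by rewrite leq_mul2r gh orbT.
Qed.

Variables (x : R) (X h : nat).
Hypotheses (Xx : X%:R <= x) (X0 : (0 < X)%N) (h0 : (0 < h)%N) (hX : (h <= X)%N).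
Let N := (2 * X)%N.
Let Lg : R := 1 + ln N%:R.

Let x0 : 0 < x. Proof. by apply: lt_le_trans Xx; rewrite ltr0n. Qed.
Let N0 : (0 < N)%N. Proof. by rewrite muln_gt0. Qed.
Let Lg1 : 1 <= Lg. Proof. by rewrite lerDl ln_ge0// ler1n. Qed.

Let shift_le n d : (n <= X)%N -> (d <= h)%N -> (n + d <= N)%N.
Proof. by move=> nX dh; rewrite /N mul2n -addnn leq_add// (leq_trans dh). Qed.

Variable Z : R.
Hypothesis Z1 : 1 <= Z.
Let Z0 : 0 < Z. Proof. exact: lt_le_trans Z1. Qed.

Definition has_square (Z : R) (n : nat) : Prop :=
  exists2 f : nat, Z < f%:R & (f ^ 2 %| n)%N.

(** Since f^2 <= 2 X, the additive 1 is absorbed: X / f^2 + 1 <= 3 x / f^2, and summing over f > Z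
    gives 3 . 2 / Z. *)
Lemma count_has_square d : (d <= h)%N ->
  ((count (fun n => `[< has_square Z (n + d) >]) (iota 1 X))%:R : R) <= 6 * x / Z.
Proof.
move=> dh.
apply: (@le_trans _ _ (\sum_(f <- iota 1 N | Z < f%:R) 3 * x * (f%:R : R)^-2)); last first.
  rewrite -mulr_sumr; apply: le_trans (ler_wpM2l _ (sum_inv_sqr_gt N Z0)) _.
    by rewrite mulr_ge0// ltW.
  by rewrite le_eqVlt; apply/orP; left; apply/eqP; ring.
apply: (@le_trans _ _ (\sum_(f <- iota 1 N | Z < f%:R)
    (count (fun n => (f ^ 2 %| n + d)%N) (iota 1 X))%:R)).
  apply: (@count_cover R nat nat _ _ _ (fun f : nat => Z < f%:R)
    (fun f n => (f ^ 2 %| n + d)%N)) => n.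
  rewrite mem_iota add1n ltnS => /andP[n0 nX] /asboolP[f Zf fn].
  exists f; split=> //; rewrite mem_iota add1n ltnS.
  have f0 : (0 < f)%N by rewrite -(ltr0n R) (lt_trans Z0).
  rewrite f0/=; apply: leq_trans (shift_le nX dh).
  apply: leq_trans (dvdn_leq _ fn); last by rewrite addn_gt0 n0.
  by rewrite -{1}(expn1 f) leq_pexp2l.
apply: ler_sum => f Zf.
have f0 : (0 < f)%N by rewrite -(ltr0n R) (lt_trans Z0).
have f20 : (0 < f ^ 2)%N by rewrite expn_gt0 f0.
have f20' : (0 : R) < f%:R ^+ 2 by rewrite exprn_gt0// ltr0n.
case: (boolP (has (fun n => (f ^ 2 %| n + d)%N) (iota 1 X))) => [/hasP[n]|]; last first.
  by rewrite has_count -eqn0Ngt => /eqP ->; rewrite !mulr_ge0 ?invr_ge0 ?ltW.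
rewrite mem_iota add1n ltnS => /andP[n0 nX] fn.
have fN : (f ^ 2 <= N)%N.
  by apply: leq_trans (shift_le nX dh); apply: dvdn_leq fn; rewrite addn_gt0 n0.
apply: le_trans (count_congruent_real f20 _) _.
  move=> a b a0 ab bX ha hb.
  by have := dvdn_sub hb ha; rewrite subnDr.
rewrite natrX ler_pdivlMr// mulrDl mulfVK ?gt_eqF// mul1r.
have : (f%:R : R) ^+ 2 <= 2 * X%:R by rewrite -natrX -natrM ler_nat.
by move: Xx; lra.
Qed.

Definition smooth (Z : R) (s : nat) : bool := all (fun p : nat => p%:R <= Z) (primes s).

Lemma smooth_sum_le (lam K w : R) (M : nat) :
  0 <= lam -> lam <= 1 / 4 -> 0 <= K -> 0 < w ->
  \sum_(s <- iota 1 M | smooth (expR K) s) (s%:R : R) `^ (lam - 1) <=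
  expR (4 * (1 + w + 2 * K / w + 2 * lam * K * expR (lam * K))).
Proof.
move=> l0 l1 K0 w0.
pose G n : R := if smooth (expR K) n then (n%:R : R) `^ (lam - 1) else 0.
rewrite big_mkcond/=; apply: le_trans (@euler_product_le R G M _ _ _) _.
- by move=> n; rewrite /G; case: ifP => // _; exact: powR_ge0.
- by rewrite /G /smooth powR1.
- move=> q a m pq a0 m0 qm; rewrite /G.
  have w0' : (0 < q ^ a)%N by rewrite expn_gt0 prime_gt0.
  have -> : smooth (expR K) (q ^ a * m) = smooth (expR K) (q ^ a) && smooth (expR K) m.
    apply/allP/andP => [hh|[/allP h1 /allP h2] p].
      by split; apply/allP => p pp; apply: hh; rewrite primesM// pp ?orbT.
    by rewrite primesM// => /orP[/h1|/h2].
  case: (smooth _ (q ^ a)) => /=; last by rewrite mul0r.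
  case: ifP => _; last by rewrite mulr0.
  by rewrite natrM powRM.
rewrite ler_expR; apply: le_trans (smooth_exponent_le M l0 l1 K0 w0).
rewrite [leRHS]big_mkcondr/= le_eqVlt; apply/orP; left; apply/eqP.
apply: eq_bigr => q pq.
transitivity (\sum_(a <- iota 1 M | (q ^ a <= M)%N)
   if (q%:R : R) <= expR K then (q ^ a)%:R `^ (lam - 1) else 0).
  rewrite big_seq_cond [RHS]big_seq_cond; apply: eq_bigr => a /andP[].
  rewrite mem_iota => /andP[a0 _] _.
  by rewrite /G /smooth primesX// primes_prime//= andbT.
by case: ifP => // _; rewrite big1.
Qed.

Definition diag_small (Z : R) (h n : nat) : Prop :=
  exists j r : nat, [/\ diag_index h j, (0 < r)%N, n = (j * (diag_A h j * r + 1))%N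
    & smooth Z r].

(** Equal radicals of [j] and [j + h] make every prime of [j] divide [h], so [j] is [Z]-smooth like
    [r]. The pair determines [n] and has j r <= X, and Rankin's weight (x / (j r))^(1 - lam) factors
    into the square of one smooth sum. *)
Lemma count_diag_small (lam S : R) : 0 <= lam -> lam <= 1 -> h%:R <= Z ->
  \sum_(s <- iota 1 X | smooth Z s) (s%:R : R) `^ (lam - 1) <= S ->
  ((count (fun n => `[< diag_small Z h n >]) (iota 1 X))%:R : R) <= x `^ (1 - lam) * S ^+ 2.
Proof.
move=> l0 l1 hZ HS.
pose I := [seq (j, r) | j <- iota 1 X, r <- iota 1 X].
pose P (i : nat * nat) := [&& smooth Z i.1, smooth Z i.2 & (i.1 * i.2 <= X)%N].
apply: (@le_trans _ _ (\sum_(i <- I | P i)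
   (count (fun n => n == i.1 * (diag_A h i.1 * i.2 + 1))%N (iota 1 X))%:R)).
  apply: (@count_cover R _ nat _ _ _ _ (fun i n => n == i.1 * (diag_A h i.1 * i.2 + 1))%N) => n.
  rewrite mem_iota add1n ltnS => /andP[n0 nX] /asboolP[j [r [dj r0 en sr]]].
  move: (dj) => /andP[j0 /eqP ej].
  have A0 : (0 < diag_A h j)%N.
    by rewrite divn_gt0 ?gcdn_gt0 ?j0// dvdn_leq ?addn_gt0 ?j0// dvdn_gcdr.
  have jr : (j * r <= n)%N.
    by rewrite en leq_mul2l (leq_trans (leq_pmull r A0)) ?orbT// leq_addr.
  have jX : (j <= X)%N by apply: leq_trans nX; apply: leq_trans jr; rewrite leq_pmulr.
  have rX : (r <= X)%N by apply: leq_trans nX; apply: leq_trans jr; rewrite leq_pmull.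
  exists (j, r); split; first by apply: allpairs_f; rewrite mem_iota ?j0 ?r0.
    rewrite /P sr (leq_trans jr nX) !andbT/=; apply/allP => p pj.
    apply: le_trans hZ; rewrite ler_nat; apply: dvdn_leq => //.
    move: pj; rewrite mem_primes => /and3P[pp _ pd].
    have : (p %| j + h)%N by rewrite -dvdn_rad ?addn_gt0 ?j0// -ej dvdn_rad.
    by rewrite dvdn_addr.
  by apply/eqP.
apply: (@le_trans _ _ (\sum_(i <- I | P i) x `^ (1 - lam) * (i.1%:R `^ (lam - 1) * i.2%:R `^ (lam - 1)))).
  rewrite big_seq_cond [leRHS]big_seq_cond; apply: ler_sum => -[j r] /andP[].
  move=> /allpairsP[[j' r'] /= [jj rr [-> ->]]] /and3P[_ _ /= jrX].
  move: jj rr; rewrite !mem_iota => /andP[j0 _] /andP[r0 _].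
  apply: le_trans (count_unique _) _.
    by move=> a b _ _ _ /eqP -> /eqP ->.
  rewrite -powRM// -natrM.
  have jr0 : (0 : R) < (j' * r')%:R by rewrite ltr0n muln_gt0 j0.
  have -> : lam - 1 = - (1 - lam) by ring.
  rewrite powRN ler_pdivlMr ?powR_gt0// mul1r.
  apply: ge0_ler_powR; rewrite ?nnegrE ?ler0n ?subr_ge0// ?(ltW x0)//.
  by apply: le_trans Xx; rewrite ler_nat.
rewrite -mulr_sumr ler_wpM2l ?powR_ge0//.
have S0 : 0 <= \sum_(s <- iota 1 X | smooth Z s) (s%:R : R) `^ (lam - 1).
  by apply: sumr_ge0 => s _; exact: powR_ge0.
apply: (@le_trans _ _ ((\sum_(s <- iota 1 X | smooth Z s) (s%:R : R) `^ (lam - 1)) ^+ 2)); last first.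
  by rewrite ler_pXn2r ?nnegrE// (le_trans S0).
rewrite big_mkcond big_allpairs_dep/= expr2 mulr_suml [leRHS]big_mkcond/=.
apply: ler_sum => j _; rewrite /P/=; case: (smooth Z j) => /=; last by rewrite big1.
rewrite mulr_sumr [leRHS]big_mkcond/=; apply: ler_sum => r _.
case: (smooth Z r) => //=; case: ifP => // _; exact: (mulr_ge0 (powR_ge0 _ _) (powR_ge0 _ _)).
Qed.

Definition nondiag_pair (V : R) (h n : nat) : Prop :=
  exists m p m' p' : nat, [/\ prime p /\ prime p', n = (m * p)%N /\ (n + h = m' * p')%N,
    ~~ (p %| m)%N /\ ~~ (p' %| m')%N, totient n = totient (n + h) &
    (totient m * m' != totient m' * m)%N /\ (m * m')%:R <= V].

(** By [two_line_unique] a pair [(m, m')] carries at most one [n], so it remains to count pairs with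
    product at most x / Z, a harmonic sum. *)
Lemma count_nondiag_pair :
  ((count (fun n => `[< nondiag_pair (x / Z) h n >]) (iota 1 X))%:R : R) <= x / Z * Lg.
Proof.
pose I := [seq (m, m') | m <- iota 1 N, m' <- iota 1 N].
pose P (i : nat * nat) := (i.1 * i.2)%:R <= x / Z.
pose C (i : nat * nat) n := `[< exists p p', [/\ prime p /\ prime p',
   n = (i.1 * p)%N /\ (n + h = i.2 * p')%N, ~~ (p %| i.1)%N /\ ~~ (p' %| i.2)%N,
   totient n = totient (n + h) & (totient i.1 * i.2 != totient i.2 * i.1)%N ] >].
apply: (@le_trans _ _ (\sum_(i <- I | P i) (count (C i) (iota 1 X))%:R)).
  apply: (@count_cover R _ nat) => n.
  rewrite mem_iota add1n ltnS => /andP[n0 nX] /asboolP[m [p [m' [p' [[pp pp'] [en en'] nd et [nz mV]]]]]].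
  have n'N := shift_le nX (leqnn h).
  have n'0 : (0 < n + h)%N by rewrite addn_gt0 n0.
  have [m0 p0] : (0 < m)%N /\ (0 < p)%N by apply/andP; rewrite -muln_gt0 -en.
  have [m'0 p'0] : (0 < m')%N /\ (0 < p')%N by apply/andP; rewrite -muln_gt0 -en'.
  exists (m, m'); split=> //.
    apply: allpairs_f; rewrite mem_iota ?m0 ?m'0 add1n ltnS/=.
      apply: leq_trans n'N; apply: leq_trans (leq_addr h n).
      by rewrite en leq_pmulr.
    by apply: leq_trans n'N; rewrite en' leq_pmulr.
  by apply/asboolP; exists p, p'; split.
apply: (@le_trans _ _ (\sum_(i <- I | P i) 1)).
  apply: ler_sum => -[m m'] _; apply: count_unique => a b a0 ab bX.
  move=> /asboolP[p [p' [[pp pp'] /= [ea ea'] [pm pm'] ta nz]]].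
  move=> /asboolP[q [q' [[pq pq'] /= [eb eb'] [qm qm'] tb _]]].
  move: ta tb; rewrite ea' eb' ea eb.
  have tp r s : prime r -> ~~ (r %| s)%N -> totient (s * r) = (totient s * r.-1)%N.
    move=> pr rs; have cop : coprime s r by rewrite coprime_sym prime_coprime.
    by rewrite (totient_coprime cop) (totient_prime pr).
  rewrite !tp// => t1 t2.
  have m0 : (0 < m)%N by move: a0; rewrite ea muln_gt0 => /andP[].
  have m'0 : (0 < m')%N.
    by move: (addn_gt0 a h); rewrite h0 orbT ea' muln_gt0 => /andP[].
  have pq_ : (p <= q)%N by rewrite -(leq_pmul2l m0) -ea -eb.
  congr muln; move/eqP: nz => nz; move: ea' eb'; rewrite ea eb => ea' eb'.
  exact: (two_line_unique (prime_gt0 pp) (prime_gt0 pp') (prime_gt0 pq') m0 m'0 t1 t2 ea' eb' nz).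
rewrite big_mkcond big_allpairs_dep/= /Lg.
apply: (@le_trans _ _ (\sum_(m <- iota 1 N) x / Z * (m%:R : R)^-1)); last first.
  by rewrite -mulr_sumr ler_wpM2l ?divr_ge0 ?(ltW x0) ?(ltW Z0)//; exact: harmonic_le.
rewrite big_seq [leRHS]big_seq; apply: ler_sum => m; rewrite mem_iota => /andP[m0 _].
have V0 : 0 <= x / Z / m%:R by rewrite !divr_ge0// ltW.
have tV : (Num.truncn (x / Z / m%:R))%:R <= x / Z / m%:R by rewrite truncn_le.
apply: le_trans tV.
rewrite -big_mkcond/= -big_filter big_const_seq count_predT iter_addr_0 size_filter ler_nat.
rewrite -size_filter -[leqRHS](size_iota 1); apply: uniq_leq_size; first by rewrite filter_uniq ?iota_uniq.
move=> m'; rewrite mem_filter !mem_iota /P/= => /andP[mV /andP[m'0 _]].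
by rewrite m'0/= add1n ltnS truncn_ge_nat// ler_pdivlMr ?ltr0n// -natrM mulnC.
Qed.

End Counting.

(** * Rankin's method for integers whose totient has a small rough part *)

Section RoughPart.
Variable R : realType.

Definition above (Z : R) : nat_pred := [pred p : nat | Z < p%:R].
Definition rough (lam : R) : nat_pred := [pred p : nat | lam^-1 < ln p%:R].

Definition squarefree_above (Z : R) (n : nat) : bool :=
  all (fun q : nat => (Z < q%:R) ==> (logn q n <= 1)%N) (primes n).

(** Primes of [n] up to [Z] are removed before the totient is taken, so that, for [n] squarefree
    above [Z], the weight depends only on the values q - 1 at primes q > Z. *)
Definition rough_totient (lam Z : R) (n : nat) : nat :=
  partn (totient (partn n (above Z))) (rough lam).

Lemma rough_totient_gt0 lam Z n : (0 < rough_totient lam Z n)%N.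
Proof. by rewrite part_gt0. Qed.

Lemma rough_totientM lam Z q a m : prime q -> (0 < a)%N -> (0 < m)%N -> ~~ (q %| m)%N ->
  rough_totient lam Z (q ^ a * m) =
  (rough_totient lam Z (q ^ a) * rough_totient lam Z m)%N.
Proof.
move=> pq a0 m0 qm; have w0 : (0 < q ^ a)%N by rewrite expn_gt0 prime_gt0.
have cop : coprime (partn (q ^ a) (above Z)) (partn m (above Z)).
  apply: coprime_dvdl (dvdn_part _ _) _; apply: coprime_dvdr (dvdn_part _ _) _.
  by rewrite coprimeXl// prime_coprime.
rewrite /rough_totient partnM// totient_coprime//.
by rewrite partnM// totient_gt0 part_gt0.
Qed.

Lemma squarefree_aboveM Z q a m : prime q -> (0 < a)%N -> (0 < m)%N -> ~~ (q %| m)%N ->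
  squarefree_above Z (q ^ a * m) -> squarefree_above Z (q ^ a) && squarefree_above Z m.
Proof.
move=> pq a0 m0 qm; have w0 : (0 < q ^ a)%N by rewrite expn_gt0 prime_gt0.
move=> /allP h; apply/andP; split; apply/allP => p pp.
  have := h p; rewrite primesM// pp => /(_ isT) /implyP h'; apply/implyP => /h'.
  by apply: leq_trans; rewrite lognM// leq_addr.
have := h p; rewrite primesM// pp orbT => /(_ isT) /implyP h'; apply/implyP => /h'.
by apply: leq_trans; rewrite lognM// leq_addl.
Qed.

Let G lam Z n : R := if squarefree_above Z n
  then (n%:R : R) `^ (lam - 1) * (rough_totient lam Z n)%:R `^ (- (2 * lam)) else 0.

Let G_ge0 lam Z n : 0 <= G lam Z n.
Proof. by rewrite /G; case: ifP => // _; rewrite mulr_ge0// powR_ge0. Qed.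

(** The Euler factors split at [Z]. Up to [Z] the weight is at most that of smooth numbers. Above
    [Z] the squarefreeness condition leaves only the exponent 1, that is q^(lam - 1) (rough part of
    q - 1)^(-2 lam), which [rough_weight_le] sums. *)
Lemma rough_totient_sum_le (lam K w : R) (M : nat) :
  0 < lam -> lam <= 1 / 4 -> 0 <= K -> 0 < w ->
  \sum_(n <- iota 1 M) G lam (expR K) n <=
  expR (4 * (1 + w + 2 * K / w + 2 * lam * K * expR (lam * K)) +
        expR (16 * expR 1) * (1 + lam^-1)).
Proof.
move=> l0 l1 K0 w0; set Z := expR K.
apply: le_trans (@euler_product_le R (G lam Z) M _ _ _) _.
- by move=> n; exact: G_ge0.
- by rewrite /G /= /rough_totient partn1 (_ : totient 1 = 1%N)// partn1 !powR1 mulr1.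
- move=> q a m pq a0 m0 qm; rewrite /G; case: ifP => [h|_]; last first.
    by apply: mulr_ge0; exact: G_ge0.
  have /andP[-> ->] := squarefree_aboveM pq a0 m0 qm h.
  rewrite rough_totientM// natrM powRM// natrM powRM//.
  by rewrite le_eqVlt; apply/orP; left; apply/eqP; ring.
rewrite ler_expR (bigID (fun q : nat => q%:R <= Z))/=; apply: lerD.
  apply: le_trans (smooth_exponent_le M (ltW l0) l1 K0 w0).
  apply: ler_sum => q /andP[pq qZ]; apply: ler_sum => a _; rewrite /G; case: ifP => // _.
    rewrite -[leRHS]mulr1 ler_wpM2l ?powR_ge0// powRN invf_le1.
      have e1 : 1 = 1 `^ (2 * lam) :> R by rewrite powR1.
      rewrite [X in X <= _]e1; apply: ge0_ler_powR; rewrite ?nnegrE//.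
        by rewrite mulr_ge0// ltW.
      by rewrite ler1n rough_totient_gt0.
    by rewrite powR_gt0// ltr0n rough_totient_gt0.
apply: le_trans (rough_weight_le l0 l1 M).
pose c q : R := (q%:R : R) `^ (lam - 1) * (partn q.-1 (rough lam))%:R `^ (- (2 * lam)).
have c0 q : 0 <= c q by rewrite mulr_ge0// powR_ge0.
apply: (@le_trans _ _ (\sum_(q <- iota 1 M | prime q && ~~ (q%:R <= Z)) c q)).
  apply: ler_sum => q /andP[pq]; rewrite -ltNge => Zq.
  have Gq : G lam Z q = c q.
    rewrite /G /c /rough_totient.
    have -> : squarefree_above Z q.
      apply/allP => p; rewrite primes_prime// inE => /eqP ->.
      by rewrite (logn_prime _ pq) eqxx implybT.
    rewrite [partn q (above Z)]part_pnat_id; first by rewrite totient_prime.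
    by rewrite pnatE.
  rewrite -Gq; apply: (@le_trans _ _ (\sum_(a <- iota 1 M | a == 1%N) G lam Z (q ^ a)%N)).
    rewrite big_mkcond/= [leRHS]big_mkcond/= big_seq [leRHS]big_seq.
    apply: ler_sum => a; rewrite mem_iota => /andP[a0 _].
    case: eqP => [_|a1]; first by case: ifP => // _; exact: G_ge0.
    rewrite /G /squarefree_above primesX// primes_prime//= Zq andbT/= lognX.
    have a2 : (1 < a)%N by rewrite ltn_neqAle a0 andbT eq_sym; apply/eqP.
    by rewrite logn_prime// eqxx muln1 [(a <= 1)%N]leqNgt a2; case: ifP.
  apply: (@le_trans _ _ (\sum_(a <- [:: 1%N]) G lam Z (q ^ a)%N)).
    apply: ler_sum_subset; first exact: iota_uniq.
      by move=> a; exact: G_ge0.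
    by move=> a _ /eqP ->.
  by rewrite big_seq1 expn1.
(* The substitution n = q - 1 lets n range over all positive integers; afterwards (n + 1)^(lam - 1)
   <= n^(lam - 1). *)
apply: (@le_trans _ _ (\sum_(n <- iota 1 M) c n.+1)).
  apply: (@ler_sum_cover R _ _ _ _ _ predT (fun n => n.+1)); rewrite ?iota_uniq//.
  move=> q; rewrite mem_iota add1n ltnS => /andP[q0 qM] /andP[pq _].
  exists q.-1; split=> //; last by rewrite prednK.
  by rewrite mem_iota; have := prime_gt1 pq; clear -qM; case: q qM => [|[|q]] //= qM _; rewrite add1n ltnS ltnW.
rewrite big_seq [leRHS]big_seq; apply: ler_sum => n; rewrite mem_iota => /andP[n0 _].
rewrite /c /= ler_wpM2r ?powR_ge0//.
have -> : lam - 1 = - (1 - lam) by ring.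
rewrite !powRN lef_pV2 ?posrE ?powR_gt0 ?ltr0n//.
apply: ge0_ler_powR; rewrite ?nnegrE ?ler_nat//; lra.
Qed.

(** Rankin's trick with two parameters: an integer k counted here, with rough part r, has (2 x /
    k)^(1 - lam) (V / r)^(2 lam) >= 1. The 2 is due to the shift by [d <= h <= X]. *)
Lemma count_rough_totient_small (x : R) (X h d : nat) (lam K w V : R) :
  X%:R <= x -> (h <= X)%N -> (d <= h)%N ->
  0 < lam -> lam <= 1 / 4 -> 0 <= K -> 0 < w -> 0 < V ->
  ((count (fun n => squarefree_above (expR K) (n + d) &&
       ((rough_totient lam (expR K) (n + d))%:R <= V)) (iota 1 X))%:R : R) <=
  (2 * x) `^ (1 - lam) * V `^ (2 * lam) *
  expR (4 * (1 + w + 2 * K / w + 2 * lam * K * expR (lam * K)) +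
        expR (16 * expR 1) * (1 + lam^-1)).
Proof.
move=> Xx hX dh l0 l1 K0 w0 V0; set Z := expR K.
pose c n := (2 * x) `^ (1 - lam) * V `^ (2 * lam) * G lam Z n.
have c0 n : 0 <= c n by rewrite !mulr_ge0 ?powR_ge0// G_ge0.
have xX : (2 * X)%:R <= 2 * x by rewrite natrM ler_pM2l.
apply: (@le_trans _ _ (\sum_(n <- iota 1 (2 * X)) c n)); last first.
  rewrite -mulr_sumr ler_wpM2l ?mulr_ge0 ?powR_ge0//.
  exact: rough_totient_sum_le.
apply: (@le_trans _ _ (\sum_(k <- map (addn^~ d) (iota 1 X)) c k)); last first.
  apply: ler_sum_subset => //.
    by rewrite map_inj_uniq ?iota_uniq//; exact: addIn.
  move=> k /mapP[n]; rewrite !mem_iota add1n ltnS => /andP[n0 nX] -> _.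
  by rewrite addn_gt0 n0/= add1n ltnS mul2n -addnn andbT leq_add// (leq_trans dh).
rewrite big_map -sum1_count natr_sum big_mkcond/= big_seq [leRHS]big_seq.
apply: ler_sum => n; rewrite mem_iota add1n ltnS => /andP[n0 nX].
case: ifP => // /andP[sq rV].
rewrite /c /G sq.
have k0 : (0 : R) < (n + d)%:R by rewrite ltr0n addn_gt0 n0.
have r0 : (0 : R) < (rough_totient lam Z (n + d))%:R by rewrite ltr0n rough_totient_gt0.
have kx : (n + d)%:R <= 2 * x.
  by apply: le_trans xX; rewrite ler_nat mul2n -addnn leq_add// (leq_trans dh).
have -> : lam - 1 = - (1 - lam) by ring.
rewrite !powRN mulrACA -[leLHS]mulr1; apply: ler_pM => //.
  rewrite ler_pdivlMr ?powR_gt0// mul1r; apply: ge0_ler_powR; rewrite ?nnegrE//; try lra.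
rewrite ler_pdivlMr ?powR_gt0// mul1r; apply: ge0_ler_powR; rewrite ?nnegrE//; lra.
Qed.

End RoughPart.

(** * Solutions with a large common divisor of two totients *)

Section Congruences.
Variable R : realType.
Variables (x : R) (X h : nat).
Hypotheses (Xx : X%:R <= x) (X0 : (0 < X)%N) (h0 : (0 < h)%N) (hX : (h <= X)%N).
Let N := (2 * X)%N.
Let Lg : R := 1 + ln N%:R.
Let x0 : 0 < x. Proof. by apply: lt_le_trans Xx; rewrite ltr0n. Qed.
Let N0 : (0 < N)%N. Proof. by rewrite muln_gt0. Qed.
Let Lg1 : 1 <= Lg. Proof. by rewrite lerDl ln_ge0// ler1n. Qed.
Let shift_le n d : (n <= X)%N -> (d <= h)%N -> (n + d <= N)%N.
Proof. by move=> nX dh; rewrite /N mul2n -addnn leq_add// (leq_trans dh). Qed.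

Variables (Z : R) (k0 : nat).
Hypothesis Z1 : 1 <= Z.
Let Z0 : 0 < Z. Proof. exact: lt_le_trans Z1. Qed.
Let Mk : R := (2 ^+ k0 * (2 * Lg ^+ 2)) ^+ k0 * Lg.
Let Mk0 : 0 <= Mk.
Proof.
have Lg0 : 0 <= Lg by exact: le_trans Lg1.
by rewrite mulr_ge0// exprn_ge0// mulr_ge0 ?exprn_ge0// mulr_ge0 ?exprn_ge0.
Qed.

Let S d : R := totient_sum R N d.
Let S_le d : (0 < d)%N -> short k0 d -> S d <= Mk / d%:R.
Proof. by move=> d0 sd; have := totient_sum_le R N0 d0 (leqnn k0) sd. Qed.
Let S_ge0 d : 0 <= S d.
Proof. by apply: sumr_ge0 => *; rewrite invr_ge0. Qed.

(** The last inequality is what absorbs the additive 1 of the congruence count: 1 <= (x d / Z) / (W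
    W'). *)
Definition common_divisor (x Z : R) (k0 h n : nat) : Prop :=
  exists d W W' : nat, [/\ short k0 d /\ Z < d%:R, (W %| n)%N /\ (W' %| n + h)%N,
    (d %| totient W)%N /\ (d %| totient W')%N & (W * W')%:R * Z <= x * d%:R].

(** For fixed d, W, W' the count is at most (x h + x d / Z) / (W W'), and summing over W and W'
    gains Mk^2 / d^2. The first term then sums over d > Z to 2 h / Z, the second leaves a harmonic
    sum [Lg] over Z. *)
Lemma count_common_divisor :
  ((count (fun n => `[< common_divisor x Z k0 h n >]) (iota 1 X))%:R : R) <=
  x * Mk ^+ 2 * (2 * h%:R + Lg) / Z.
Proof.
pose r := iota 1 N.
pose I1 := [seq (W, W') | W <- r, W' <- r].
pose I := [seq (d, y) | d <- r, y <- I1].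
pose P (i : nat * (nat * nat)) := [&& `[< short k0 i.1 >] && (Z < i.1%:R),
  (i.1 %| totient i.2.1)%N && (i.1 %| totient i.2.2)%N &
  (i.2.1 * i.2.2)%:R * Z <= x * i.1%:R].
pose C (i : nat * (nat * nat)) n := (i.2.1 %| n)%N && (i.2.2 %| n + h)%N.
apply: (@le_trans _ _ (\sum_(i <- I | P i) (count (C i) (iota 1 X))%:R)).
  apply: (@count_cover R _ nat) => n.
  rewrite mem_iota add1n ltnS => /andP[n0 nX] /asboolP[d [W [W' [[sd Zd] [Wn W'n] [dW dW'] le]]]].
  have n'N := shift_le nX (leqnn h).
  have n'0 : (0 < n + h)%N by rewrite addn_gt0 n0.
  have W0 := dvdn_gt0 n0 Wn; have W'0 := dvdn_gt0 n'0 W'n.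
  have WN : (W <= N)%N.
    by apply: leq_trans n'N; apply: leq_trans (leq_addr h n); exact: dvdn_leq.
  have W'N : (W' <= N)%N by apply: leq_trans n'N; exact: dvdn_leq.
  have d0 : (0 < d)%N by rewrite -(ltr0n R) (lt_trans Z0).
  have dN : (d <= N)%N.
    apply: leq_trans WN; apply: leq_trans (leq_totient W).
    by apply: dvdn_leq; rewrite ?totient_gt0.
  exists (d, (W, W')); split.
  - apply: allpairs_f; first by rewrite mem_iota d0 add1n ltnS.
    by apply: allpairs_f; rewrite mem_iota ?W0 ?W'0 add1n ltnS.
  - by rewrite /P/= Zd dW dW' le !andbT; apply/asboolP.
  - by rewrite /C/= Wn.
apply: (@le_trans _ _ (\sum_(i <- I | P i)
    (x * h%:R + x * i.1%:R / Z) * (i.2.1%:R^-1 * i.2.2%:R^-1))).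
  rewrite big_seq_cond [leRHS]big_seq_cond; apply: ler_sum => -[d [W W']] /andP[].
  move=> /allpairsP[[d' [W1 W2]] /= [d'r WW [-> -> ->]]] {d W W'}.
  move: WW => /allpairsP[[W W'] /= [Wr W'r [-> ->]]] {W1 W2}.
  move=> /and3P[/andP[_ Zd] _ /= le].
  move: Wr W'r; rewrite !mem_iota => /andP[W0 _] /andP[W'0 _].
  have W0' : (0 : R) < W%:R by rewrite ltr0n.
  have W'0' : (0 : R) < W'%:R by rewrite ltr0n.
  apply: le_trans (@count_two_moduli R X h W W' _ W0 W'0 h0 _ _) _.
  - move=> n n0 nX /andP[/= Wn W'n].
    rewrite -(dvdn_addr _ (dvdn_trans (dvdn_gcdl W W') Wn)).
    exact: dvdn_trans (dvdn_gcdr W W') W'n.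
  - move=> a b a0 ab bX /andP[/= Wa W'a] /andP[/= Wb W'b]; split.
      exact: dvdn_sub.
    by have := dvdn_sub W'b W'a; rewrite subnDr.
  rewrite -invfM mulrDl; apply: lerD.
    by rewrite ler_pM2r ?invr_gt0 ?mulr_gt0// ler_wpM2r.
  by rewrite ler_pdivlMr ?mulr_gt0// mul1r ler_pdivlMr// -natrM.
apply: (@le_trans _ _ (\sum_(d <- r | `[< short k0 d >] && (Z < d%:R))
    (x * h%:R + x * d%:R / Z) * (S d * S d))).
  rewrite big_mkcond big_allpairs_dep/= [leRHS]big_mkcond/=.
  apply: ler_sum => d _; rewrite big_allpairs_dep/= /P/=.
  case: (_ && _) => /=; last by rewrite big1// => W _; rewrite big1.
  rewrite /S /totient_sum mulr_suml mulr_sumr [leRHS]big_mkcond/=; apply: ler_sum => W _.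
  case: (d %| totient W)%N => /=; last by rewrite big1.
  rewrite mulr_sumr mulr_sumr [leRHS]big_mkcond/=; apply: ler_sum => W' _.
  case: (d %| totient W')%N => //=; case: ifP => // _.
  rewrite !mulr_ge0 ?invr_ge0 ?addr_ge0 ?mulr_ge0 ?invr_ge0// ltW//.
apply: (@le_trans _ _ (\sum_(d <- r | `[< short k0 d >] && (Z < d%:R))
    (x * h%:R * Mk ^+ 2 * (d%:R)^-2 + x * Mk ^+ 2 / Z * d%:R^-1))).
  rewrite big_seq_cond [leRHS]big_seq_cond; apply: ler_sum => d /andP[].
  rewrite mem_iota => /andP[d0 _] /andP[/asboolP sd _].
  have d0' : (0 : R) < d%:R by rewrite ltr0n.
  have -> : x * h%:R * Mk ^+ 2 * (d%:R)^-2 + x * Mk ^+ 2 / Z * d%:R^-1 =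
    (x * h%:R + x * d%:R / Z) * ((Mk / d%:R) * (Mk / d%:R)).
    by field; rewrite !gt_eqF.
  rewrite ler_wpM2l//; last by rewrite ler_pM ?S_ge0// S_le.
  by rewrite addr_ge0 ?mulr_ge0 ?invr_ge0// ltW.
rewrite big_split/= -!mulr_sumr.
have -> : x * Mk ^+ 2 * (2 * h%:R + Lg) / Z =
  x * h%:R * Mk ^+ 2 * (2 / Z) + x * Mk ^+ 2 / Z * Lg by field; rewrite gt_eqF.
have M20 : 0 <= Mk ^+ 2 by exact: sqr_ge0.
apply: lerD.
  apply: ler_wpM2l; first exact: mulr_ge0 (mulr_ge0 (ltW x0) (ler0n _ _)) M20.
  apply: le_trans (sum_inv_sqr_gt N Z0).
  apply: ler_sum_subset; first exact: iota_uniq.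
    by move=> i; rewrite invr_ge0 exprn_ge0.
  by move=> d dr /andP[_ ->]; rewrite dr.
apply: ler_wpM2l; first by apply: mulr_ge0; [exact: mulr_ge0 (ltW x0) M20 | rewrite invr_ge0 ltW].
apply: le_trans (harmonic_le R N0).
by apply: ler_sum_subset; [exact: iota_uniq | move=> i; rewrite invr_ge0 | move=> d ->].
Qed.

(** Knowing that d divides p - 1 fixes a = m p modulo m d. Coprimality of d and W keeps gcd(m d, W)
    equal to gcd(m, W), which divides the difference of a and b. *)
Definition shifted_divisor (x Z : R) (k0 a b : nat) : Prop :=
  exists m p d W : nat, [/\ a = (m * p)%N /\ prime p, (d %| p.-1)%N /\ coprime d W,
    short k0 d /\ Z < d%:R, (W %| b)%N /\ (d %| totient W)%N & (m * d * W)%:R <= x].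

(** The modulus m d gains one factor 1 / d and the condition on phi(W) another, so the sum over d >
    Z converges like 2 / Z. The shifts [d1], [d2] let one statement serve a prime factor of [n] and
    one of [n + h]. *)
Lemma count_shifted_divisor d1 d2 : (d1 + d2 = h)%N -> (d1 = 0%N \/ d2 = 0%N) ->
  ((count (fun n => `[< shifted_divisor x Z k0 (n + d1) (n + d2) >]) (iota 1 X))%:R : R) <=
  x * Mk * Lg * (2 * (h%:R + 1)) / Z.
Proof.
move=> dh d12.
have d1h : (d1 <= h)%N by rewrite -dh leq_addr.
have d2h : (d2 <= h)%N by rewrite -dh leq_addl.
pose r := iota 1 N.
pose I1 := [seq (m, W) | m <- r, W <- r].
pose I := [seq (d, y) | d <- r, y <- I1].
pose P (i : nat * (nat * nat)) := [&& `[< short k0 i.1 >] && (Z < i.1%:R),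
  (i.1 %| totient i.2.2)%N & coprime i.1 i.2.2 && ((i.2.1 * i.1 * i.2.2)%:R <= x)].
pose C (i : nat * (nat * nat)) n := `[< exists2 p, (n + d1 = i.2.1 * p)%N & prime p && (i.1 %| p.-1)%N >]
   && (i.2.2 %| n + d2)%N.
apply: (@le_trans _ _ (\sum_(i <- I | P i) (count (C i) (iota 1 X))%:R)).
  apply: (@count_cover R _ nat) => n.
  rewrite mem_iota add1n ltnS => /andP[n0 nX].
  move=> /asboolP[m [p [d [W [[ea pp] [dp cdW] [sd Zd] [Wb dW] le]]]]].
  have aN := shift_le nX d1h; have bN := shift_le nX d2h.
  have a0 : (0 < n + d1)%N by rewrite addn_gt0 n0.
  have b0 : (0 < n + d2)%N by rewrite addn_gt0 n0.
  have p0 := prime_gt0 pp.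
  have m0 : (0 < m)%N by move: a0; rewrite ea muln_gt0 => /andP[].
  have W0 := dvdn_gt0 b0 Wb.
  have d0 : (0 < d)%N by rewrite -(ltr0n R) (lt_trans Z0).
  have mN : (m <= N)%N by apply: leq_trans aN; rewrite ea leq_pmulr.
  have WN : (W <= N)%N by apply: leq_trans bN; exact: dvdn_leq.
  have dN : (d <= N)%N.
    apply: leq_trans aN; rewrite ea; apply: leq_trans (leq_pmull _ m0).
    apply: leq_trans (leq_pred p); apply: dvdn_leq => //.
    by rewrite -subn1 subn_gt0 prime_gt1.
  exists (d, (m, W)); split.
  - apply: allpairs_f; first by rewrite mem_iota d0 add1n ltnS.
    by apply: allpairs_f; rewrite mem_iota ?m0 ?W0 add1n ltnS.
  - by rewrite /P/= Zd dW cdW le !andbT; apply/asboolP.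
  - by rewrite /C/= Wb andbT; apply/asboolP; exists p; rewrite ?pp.
apply: (@le_trans _ _ (\sum_(i <- I | P i)
    (x * (h%:R + 1)) * (i.1%:R^-1 * (i.2.1%:R^-1 * i.2.2%:R^-1)))).
  rewrite big_seq_cond [leRHS]big_seq_cond; apply: ler_sum => -[d [m W]] /andP[].
  move=> /allpairsP[[d' [W1 W2]] /= [d'r WW [-> -> ->]]] {d W m}.
  move: WW => /allpairsP[[m W] /= [mr Wr [-> ->]]] {W1 W2}.
  move: d'r mr Wr; rewrite !mem_iota => /andP[d0 _] /andP[m0 _] /andP[W0 _].
  move=> /and3P[/andP[/= _ Zd] /= _ /andP[cdW /= le]].
  have W0' : (0 : R) < W%:R by rewrite ltr0n.
  have m0' : (0 : R) < m%:R by rewrite ltr0n.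
  have d0' : (0 : R) < d'%:R by rewrite ltr0n.
  have md0 : (0 < m * d')%N by rewrite muln_gt0 m0.
  apply: le_trans (@count_two_moduli R X h (m * d') W _ md0 W0 h0 _ _) _.
  - move=> n n0 nX /andP[/asboolP[p /= ea _] /= Wb].
    rewrite gcdnC Gauss_gcdl; last by rewrite coprime_sym.
    rewrite gcdnC.
    have g1 : (gcdn m W %| n + d1)%N.
      by apply: dvdn_trans (dvdn_gcdl _ _) _; rewrite ea dvdn_mulr.
    have g2 : (gcdn m W %| n + d2)%N by apply: dvdn_trans Wb; exact: dvdn_gcdr.
    rewrite -dh; case: d12 => e; move: g1 g2; rewrite e ?addn0 ?add0n => g1 g2.
      by rewrite -(dvdn_addr _ g1).
    by rewrite -(dvdn_addr _ g2).
  - move=> a b a0 ab bX /andP[/asboolP[p /= ea /andP[pp dp]] /= Wa].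
    move=> /andP[/asboolP[q /= eb /andP[pq dq]] /= Wb]; split; last first.
      by have := dvdn_sub Wb Wa; rewrite subnDr.
    rewrite -(subnDr d1) ea eb -mulnBr dvdn_pmul2l//.
    have -> : (q - p = q.-1 - p.-1)%N.
      by rewrite -!subn1 subnBA ?subnK ?prime_gt0.
    exact: dvdn_sub.
  have -> : d'%:R^-1 * (m%:R^-1 * W%:R^-1) = ((m * d')%:R * W%:R)^-1 :> R.
    by rewrite natrM; field; rewrite !gt_eqF.
  have mdW : (0 : R) < (m * d')%:R * W%:R by rewrite mulr_gt0// ltr0n.
  rewrite mulrDr mulr1 mulrDl; apply: lerD.
    by rewrite ler_pM2r ?invr_gt0// ler_wpM2r.
  by rewrite ler_pdivlMr// mul1r -natrM.
apply: (@le_trans _ _ (\sum_(d <- r | `[< short k0 d >] && (Z < d%:R))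
    (x * (h%:R + 1)) * (d%:R^-1 * (Lg * S d)))).
  rewrite big_mkcond big_allpairs_dep/= [leRHS]big_mkcond/=.
  apply: ler_sum => d _; rewrite big_allpairs_dep/= /P/=.
  case: (_ && _) => /=; last by rewrite big1// => m _; rewrite big1.
  apply: (@le_trans _ _ (x * (h%:R + 1) * (d%:R^-1 * ((\sum_(m <- r) m%:R^-1) * S d)))); last first.
    rewrite ler_wpM2l ?mulr_ge0 ?(ltW x0)// ?ler_wpM2l ?invr_ge0// ler_wpM2r ?S_ge0//.
    exact: harmonic_le.
  rewrite mulr_suml !mulr_sumr; apply: ler_sum => m _.
  rewrite /S /totient_sum !mulr_sumr [leRHS]big_mkcond/=; apply: ler_sum => W _.
  case: (d %| totient W)%N => //=; case: ifP => // _.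
  by rewrite !mulr_ge0 ?invr_ge0// ltW.
apply: (@le_trans _ _ (\sum_(d <- r | `[< short k0 d >] && (Z < d%:R))
    x * (h%:R + 1) * Lg * Mk * (d%:R)^-2)).
  rewrite big_seq_cond [leRHS]big_seq_cond; apply: ler_sum => d /andP[].
  rewrite mem_iota => /andP[d0 _] /andP[/asboolP sd _].
  have d0' : (0 : R) < d%:R by rewrite ltr0n.
  have Lg0 : 0 <= Lg by exact: le_trans Lg1.
  have -> : x * (h%:R + 1) * Lg * Mk * (d%:R)^-2 =
     x * (h%:R + 1) * (d%:R^-1 * (Lg * (Mk / d%:R))) by field; rewrite gt_eqF.
  apply: ler_wpM2l; first by rewrite mulr_ge0 ?(ltW x0) ?addr_ge0.
  apply: ler_wpM2l; first by rewrite invr_ge0.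
  by apply: ler_wpM2l => //; exact: S_le.
rewrite -mulr_sumr.
have -> : x * Mk * Lg * (2 * (h%:R + 1)) / Z = x * (h%:R + 1) * Lg * Mk * (2 / Z) by ring.
have Lg0 : 0 <= Lg by exact: le_trans Lg1.
have h1 : 0 <= h%:R + 1 :> R by rewrite addr_ge0.
apply: ler_wpM2l; first exact: mulr_ge0 (mulr_ge0 (mulr_ge0 (ltW x0) h1) Lg0) Mk0.
apply: le_trans (sum_inv_sqr_gt N Z0).
apply: ler_sum_subset; first exact: iota_uniq.
  by move=> i; rewrite invr_ge0 exprn_ge0.
by move=> d dr /andP[_ ->]; rewrite dr.
Qed.

End Congruences.

(** * Classification of solutions *)

Lemma totient_dvd_part (n : nat) (P : nat_pred) : (0 < n)%N ->
  (totient (partn n P) %| totient n)%N.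
Proof.
move=> n0; rewrite -{2}(partnC P n0) totient_coprime ?dvdn_mulr//.
exact: coprime_partC.
Qed.

Lemma max_pdiv_split n : (1 < n)%N -> exists m, n = (m * max_pdiv n)%N.
Proof. by move=> n1; exists (n %/ max_pdiv n)%N; rewrite divnK// max_pdiv_dvd. Qed.

(** The two totient relations combine to m (p - 1) = m' (p' - 1); subtracting this from m p + h = m'
    p' leaves m' = m + h. Then [rad_inj_totient] gives equal radicals, and coprimality of [diag_A]
    and [diag_B] gives the common parameter r. *)
Lemma diagonal_representation (m p m' p' h : nat) :
  prime p -> prime p' -> (0 < m)%N -> (0 < m')%N -> ~~ (p %| m)%N -> ~~ (p' %| m')%N ->
  (m * p + h = m' * p')%N -> (totient m * p.-1 = totient m' * p'.-1)%N ->
  (totient m * m' = totient m' * m)%N ->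
  exists r, [/\ m' = (m + h)%N, diag_index h m /\ (0 < r)%N, p = (diag_A h m * r + 1)%N
    & p' = (diag_B h m * r + 1)%N].
Proof.
move=> pp pp' m0 m'0 pm pm' e1 e2 e3.
have p1 := prime_gt1 pp; have p'1 := prime_gt1 pp'.
have t0 : (0 < totient m')%N by rewrite totient_gt0.
have e4 : (m * p.-1 = m' * p'.-1)%N.
  apply/eqP; rewrite -(eqn_pmul2l t0) mulnA -e3 mulnAC e2; apply/eqP.
  by move: (totient m') (p'.-1) => u v; ring.
have em : m' = (m + h)%N.
  move: e1 e4; rewrite -{1}(prednK (ltnW p1)) -{1}(prednK (ltnW p'1)) !mulnS => e1 e4.
  by move: e1; rewrite e4 addnAC => /addIn.
have rad_e : Defs.rad m = Defs.rad (m + h).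
  by rewrite -em; apply: rad_inj_totient.
set g := gcdn m (m + h).
have g0 : (0 < g)%N by rewrite gcdn_gt0 m0.
have eA : (m + h = g * diag_A h m)%N by rewrite mulnC /diag_A divnK// dvdn_gcdr.
have eB : (m = g * diag_B h m)%N by rewrite mulnC /diag_B divnK// dvdn_gcdl.
have cop : coprime (diag_A h m) (diag_B h m).
  rewrite /coprime -(eqn_pmul2l g0) muln_gcdr -eA -eB muln1 gcdnC.
  by rewrite /g.
have e5 : (diag_B h m * p.-1 = diag_A h m * p'.-1)%N.
  by apply/eqP; rewrite -(eqn_pmul2l g0) !mulnA -eA -eB -em e4.
have A0 : (0 < diag_A h m)%N.
  by have : (0 < m + h)%N by [rewrite addn_gt0 m0]; rewrite eA muln_gt0 => /andP[].
have Ap : (diag_A h m %| p.-1)%N.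
  by rewrite -(Gauss_dvdr _ cop) e5 dvdn_mulr.
have [r er] : exists r, p.-1 = (diag_A h m * r)%N.
  by exists (p.-1 %/ diag_A h m)%N; rewrite mulnC divnK.
exists r; split=> //.
- split; first by rewrite /diag_index m0 rad_e eqxx.
  have : (0 < p.-1)%N by rewrite -subn1 subn_gt0.
  by rewrite er muln_gt0 => /andP[].
- by rewrite -er addn1 prednK// ltnW.
have -> : (diag_B h m * r = p'.-1)%N.
  apply/eqP; rewrite -(eqn_pmul2l A0) -e5 er; apply/eqP; ring.
by rewrite addn1 prednK// ltnW.
Qed.

Section Classification.
Variable R : realType.
Variables (s Z lam : R) (k0 : nat).
Let x := s ^+ 2.
Let B := s * Z ^+ 4.
Let y := expR lam^-1.
Hypotheses (Z4 : 4 <= Z) (sZ : 4 * Z ^+ 15 <= s) (l0 : 0 < lam).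
Hypothesis Zy : Z ^+ 9 < y ^+ k0.

Let Z0 : 0 < Z. Proof. by apply: lt_le_trans Z4. Qed.
Let Z1 : 1 <= Z. Proof. by apply: le_trans Z4; rewrite ler1n. Qed.
Let s0 : 0 < s.
Proof. by apply: lt_le_trans sZ; rewrite mulr_gt0// exprn_gt0. Qed.
Let x0 : 0 < x. Proof. exact: exprn_gt0. Qed.
Let y1 : 1 < y. Proof. by rewrite -expR0 ltr_expR invr_gt0. Qed.
Let Zk j k : (j <= k)%N -> Z ^+ j <= Z ^+ k.
Proof. by move=> jk; rewrite ler_weXn2l. Qed.
Let ZyZ : Z < y ^+ k0.
Proof. by apply: le_lt_trans Zy; rewrite -{1}(expr1 Z) Zk. Qed.
Let k00 : (0 < k0)%N.
Proof.
case: (posnP k0) Zy => // ->; rewrite expr0 => h.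
by have := lt_le_trans h (exprn_ege1 9 Z1); rewrite ltxx.
Qed.

Let rough_prime D0 D l : (0 < D0)%N -> (D %| partn D0 (rough lam))%N -> prime l ->
  (l %| D)%N -> y < l%:R.
Proof.
move=> D00 DD pl lD; have := dvdn_trans lD DD.
have := part_pnat (rough lam) D0 => /pnatP h.
move=> /(h (part_gt0 _ _) _ pl); rewrite inE/= => h'.
by rewrite -(@lnK R l%:R) ?posrE ?ltr0n ?prime_gt0// ltr_expR.
Qed.

Let logn_le1 n q : (0 < n)%N -> ~ has_square Z n -> prime q -> Z < q%:R -> (logn q n <= 1)%N.
Proof.
move=> n0 ns pq Zq; rewrite leqNgt; apply/negP => h; apply: ns; exists q => //.
by rewrite pfactor_dvdn.
Qed.

(** For an exponent e >= 2 the absence of large squares bounds q^(floor(e / 2)) by Z, and e <= 3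
    floor(e / 2) gives Z^3. *)
Let component_le n q C : (0 < n)%N -> ~ has_square Z n -> prime q -> (q %| n)%N ->
  Z ^+ 3 <= C -> (max_pdiv n)%:R <= C -> (q ^ logn q n)%:R <= C.
Proof.
move=> n0 ns pq qn ZC pC; case: (leqP (logn q n) 1) => e1.
  have e : logn q n = 1%N.
    by apply/eqP; rewrite eqn_leq e1 logn_gt0 mem_primes pq n0.
  rewrite e expn1; apply: le_trans pC; rewrite ler_nat max_pdiv_max//.
  by rewrite mem_primes pq n0.
apply: le_trans ZC; set e := logn q n in e1 *.
have fZ : (q ^ e./2)%:R <= Z.
  rewrite leNgt; apply/negP => h; apply: ns; exists (q ^ e./2)%N => //.
  rewrite -expnM pfactor_dvdn// -/e; have := odd_double_half e; clear; lia.
apply: le_trans (_ : ((q ^ e./2)%:R) ^+ 3 <= _); last first.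
  by rewrite lerXn2r ?nnegrE// ltW.
rewrite -natrX ler_nat -expnM leq_exp2l ?prime_gt1//.
have := odd_double_half e; case: (odd e); move: e1; clear; lia.
Qed.

(** [common_divisor] with free arguments in place of [n] and [n + h], so that their roles can be
    exchanged. *)
Definition common_divisor_of (a b : nat) : Prop :=
  exists d W W' : nat, [/\ short k0 d /\ Z < d%:R, (W %| a)%N /\ (W' %| b)%N,
    (d %| totient W)%N /\ (d %| totient W')%N & (W * W')%:R * Z <= x * d%:R].

Let Z6 : 4 <= Z ^+ 6. Proof. by apply: le_trans Z4 _; rewrite -{1}(expr1 Z) Zk. Qed.

(** As p > s Z^4, both m <= 2 s / Z^4 and, through p p' <= 2 x Z, every prime of b is at most 2 s /
    Z^3. Hence a part [a1] of b paired with m leaves room Z^7 / 4 below x. The divisor found in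
    phi(a1) also divides phi(m) (p - 1); a large gcd with phi(m) yields a common divisor, a large
    gcd with p - 1 a shifted one. *)
Let large_prime a b m p : (0 < a)%N -> (0 < b)%N -> a%:R <= 2 * x -> b%:R <= 2 * x ->
  totient a = totient b -> a = (m * p)%N -> prime p -> ~~ (p %| m)%N -> B < p%:R ->
  (p * max_pdiv b)%:R <= 2 * x * Z -> ~ has_square Z b ->
  Z ^+ 225 < (rough_totient lam Z b)%:R ->
  common_divisor_of a b \/ shifted_divisor x Z k0 a b.
Proof.
move=> a0 b0 ax bx tab ea pp pm Bp ppx nsb rb.
have Z4_ := Z4; have sZ_ := sZ; have x0_ := x0; have s0_ := s0.
have p0 : (0 : R) < p%:R by rewrite ltr0n prime_gt0.
have m0 : (0 < m)%N by move: a0; rewrite ea muln_gt0 => /andP[].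
have mZ : m%:R * Z ^+ 4 <= 2 * s.
  rewrite -(ler_pM2r s0) -mulrA [Z ^+ 4 * s]mulrC -/B -[2 * s * s]mulrA -expr2 -/x.
  by apply: le_trans ax; rewrite ea natrM ler_wpM2l// ltW.
have p'Z : (max_pdiv b)%:R * Z ^+ 3 <= 2 * s.
  have sZ0 : 0 < s * Z by rewrite mulr_gt0.
  rewrite -(ler_pM2r sZ0).
  have -> : (max_pdiv b)%:R * Z ^+ 3 * (s * Z) = B * (max_pdiv b)%:R.
    by rewrite /B; ring.
  have -> : 2 * s * (s * Z) = 2 * x * Z by rewrite /x; ring.
  by apply: le_trans ppx; rewrite natrM ler_wpM2r// ltW.
have Z3 : 0 < Z ^+ 3 by rewrite exprn_gt0.
pose C := 2 * s / Z ^+ 3.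
have C1 : 1 <= C.
  rewrite ler_pdivlMr// mul1r; apply: le_trans (Zk (isT : 3 <= 15)%N) _.
  by have := exprn_gt0 15 Z0; lra.
pose t := partn b (above Z).
have t0 : (0 < t)%N by rewrite part_gt0.
have tb : (t %| b)%N by exact: dvdn_part.
have tprime q : prime q -> (q %| t)%N -> Z < q%:R.
  by move=> pq qt; have := part_pnat (above Z) b => /pnatP h; have := h (part_gt0 _ _) q pq qt.
have tlog q : prime q -> (q %| t)%N -> (logn q t <= 1)%N.
  move=> pq qt; apply: leq_trans (dvdn_leq_log q b0 tb) _.
  by apply: logn_le1 => //; exact: tprime.
have D0t : (rough_totient lam Z b %| totient t)%N by exact: dvdn_part.
have comps q : prime q -> (q %| t)%N -> (q ^ logn q t)%:R <= C.
  move=> pq qt; have qb := dvdn_trans qt tb.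
  apply: (@le_trans _ _ (max_pdiv b)%:R); last by rewrite ler_pdivlMr.
  rewrite ler_nat; apply: leq_trans (_ : q <= _)%N.
    by rewrite -[leqRHS]expn1 leq_exp2l ?prime_gt1// tlog.
  by apply: max_pdiv_max; rewrite mem_primes pq b0.
(* Five parts suffice: C^5 = (2 s)^5 / Z^15 exceeds (2 s^2)^2 as soon as 8 s > Z^15, which is the
   role of [sZ]. *)
have tC : (t%:R : R) ^+ 2 < C ^+ 5.
  apply: (@le_lt_trans _ _ ((2 * x) ^+ 2)).
    apply: lerXn2r; rewrite ?nnegrE//; first by rewrite mulr_ge0 ?(ltW x0).
    by apply: le_trans bx; rewrite ler_nat dvdn_leq.
  rewrite /C expr_div_n ltr_pdivlMr ?exprn_gt0// -exprM.
  have -> : (2 * s) ^+ 5 = (2 * x) ^+ 2 * (8 * s) by rewrite /x; ring.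
  rewrite ltr_pM2l ?exprn_gt0 ?mulr_gt0//.
  by have := exprn_gt0 15 Z0; rewrite (_ : 3 * 5 = 15)%N//; lra.
have V1 : 1 <= Z ^+ 45 by exact: exprn_ege1.
have [|a1 [a1t a1C D1V]] := coprime_part V1 C1 t0 (rough_totient_gt0 lam Z b) comps tC D0t _.
  by rewrite -exprM.
set D1 := gcdn _ _ in D1V.
have a10 : (0 < a1)%N := dvdn_gt0 t0 a1t.
have D10 : (0 < D1)%N by rewrite gcdn_gt0 rough_totient_gt0.
have a1Z : a1%:R * Z ^+ 3 <= 2 * s by rewrite -ler_pdivlMr.
have D1a : (D1 %| totient a1)%N by exact: dvdn_gcdr.
have D1r : (D1 %| partn (totient t) (rough lam))%N by exact: dvdn_gcdl.
have tt0 : (0 < totient t)%N by rewrite totient_gt0.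
have D1m : (D1 %| totient m * p.-1)%N.
  rewrite -(totient_prime pp) -totient_coprime; last by rewrite coprime_sym prime_coprime.
  rewrite -ea tab; apply: dvdn_trans (totient_dvd_part (above Z) b0).
  exact: dvdn_trans D1r (dvdn_part _ _).
have prodZ (u : nat) : u%:R * Z ^+ 3 <= 2 * s -> m%:R * u%:R * Z ^+ 7 <= 4 * x.
  move=> uZ; have -> : m%:R * u%:R * Z ^+ 7 = (m%:R * Z ^+ 4) * (u%:R * Z ^+ 3) by ring.
  have -> : 4 * x = (2 * s) * (2 * s) by rewrite /x; ring.
  by apply: ler_pM => //; rewrite mulr_ge0// exprn_ge0// ltW.
have a1b : (a1 %| b)%N := dvdn_trans a1t tb.
have [gm|gm] := ltP (Z ^+ 9) (gcdn D1 (totient m))%:R.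
  left; set g := gcdn D1 (totient m) in gm.
  have g0 : (0 < g)%N by rewrite gcdn_gt0 D10.
  have Zg : Z < g%:R by apply: le_lt_trans gm; rewrite -{1}(expr1 Z) Zk.
  have gr l : prime l -> (l %| g)%N -> y < l%:R.
    by move=> pl lg; apply: rough_prime tt0 (dvdn_trans (dvdn_gcdl _ _) D1r) pl lg.
  have [d [dg sd Zd _]] := trim_divisor g0 y1 Z1 Zg ZyZ gr.
  exists d, m, a1; split=> //.
  - by split=> //; rewrite ea dvdn_mulr.
  - split; first exact: dvdn_trans dg (dvdn_gcdr _ _).
    exact: dvdn_trans (dvdn_trans dg (dvdn_gcdl _ _)) D1a.
  have h := prodZ a1 a1Z.
  apply: (@le_trans _ _ x); last by rewrite ler_peMr ?(ltW x0)//; lra.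
  rewrite natrM -(ler_pM2r (_ : 0 < (4 : R)))// [x * 4]mulrC; apply: le_trans h.
  rewrite [Z ^+ 7]exprS mulrA ler_wpM2l// mulr_ge0 ?mulr_ge0 ?(ltW Z0)//.
set g := gcdn D1 p.-1.
(* Two gcds of at most Z^9 would give D1 <= Z^18, against D1 > Z^45. *)
have gZ : Z ^+ 9 < g%:R.
  rewrite ltNge; apply/negP => h.
  have := gcdn_mul_split D10 D1m; rewrite -(ler_nat R) natrM -/g => h2.
  have h3 : (gcdn D1 (totient m))%:R * g%:R <= Z ^+ 9 * Z ^+ 9 by apply: ler_pM.
  have := lt_le_trans D1V (le_trans h2 h3).
  by rewrite -exprD ltNge Zk.
have g0 : (0 < g)%N by rewrite gcdn_gt0 D10.
have Zg : Z < g%:R by apply: le_lt_trans gZ; rewrite -{1}(expr1 Z) Zk.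
have gr l : prime l -> (l %| g)%N -> y < l%:R.
  by move=> pl lg; apply: rough_prime tt0 (dvdn_trans (dvdn_gcdl _ _) D1r) pl lg.
have gp : (g %| p.-1)%N by exact: dvdn_gcdr.
have ga : (g %| totient a1)%N by exact: dvdn_trans (dvdn_gcdl _ _) D1a.
(* The coprimality required by [shifted_divisor] has two sources: a prime l > Z of g divides q - 1
   for some prime q of [a1] and is used with W = q; otherwise all primes of g are at most Z, while
   those of [a1] exceed Z. *)
have [[l [pl lg Zl]]|small] := pselect (exists l, [/\ prime l, (l %| g)%N & Z < l%:R]).
  have [q qa lq] := prime_dvd_totient pl a10 (dvdn_trans lg ga).
  move: qa; rewrite mem_primes => /and3P[pq _ qa].
  have qt := dvdn_trans qa a1t.
  have e1 : logn q a1 = 1%N.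
    apply/eqP; rewrite eqn_leq logn_gt0 mem_primes pq a10 qa !andbT.
    by apply: leq_trans (dvdn_leq_log q t0 a1t) _; exact: tlog.
  move: lq; rewrite e1 expn1 => lq.
  have qp' : (q <= max_pdiv b)%N.
    by apply: max_pdiv_max; rewrite mem_primes pq b0 (dvdn_trans qt tb).
  have sl : short k0 l by exists [:: l]; rewrite /= ?pl ?k00// big_seq1.
  (* If l exceeds Z^3, the product m l q may be too large; but l divides both p - 1 and q - 1, and p
     q <= 2 x Z makes W = p, W' = q admissible. *)
  have [lZ|lZ] := ltP (Z ^+ 3) l%:R.
    left; exists l, p, q; split=> //.
    - by split; [rewrite ea dvdn_mull | exact: dvdn_trans qt tb].
    - by split=> //; rewrite totient_prime// (dvdn_trans lg).
    apply: (@le_trans _ _ (2 * x * Z * Z)).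
      rewrite ler_wpM2r ?(ltW Z0)//; apply: le_trans ppx.
      by rewrite ler_nat leq_mul2l qp' orbT.
    have -> : 2 * x * Z * Z = x * (2 * Z ^+ 2) by ring.
    rewrite ler_wpM2l ?(ltW x0)//; apply: le_trans (ltW lZ).
    by rewrite [Z ^+ 3]exprS ler_wpM2r ?exprn_ge0 ?(ltW Z0)//; lra.
  right; exists m, p, l, q; split=> //.
  - split; first exact: dvdn_trans lg gp.
    rewrite prime_coprime// dvdn_prime2//; apply/eqP => elq.
    move: lq; rewrite totient_prime// elq => /dvdn_leq.
    by rewrite -subn1 subn_gt0 prime_gt1// => /(_ isT); have := prime_gt0 pq; clear; lia.
  - by split=> //; exact: dvdn_trans qt tb.
  have qZ : q%:R * Z ^+ 3 <= 2 * s.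
    by apply: le_trans p'Z; rewrite ler_wpM2r ?ler_nat// ltW.
  have h := prodZ q qZ.
  rewrite mulnAC natrM natrM.
  apply: (@le_trans _ _ (m%:R * q%:R * Z ^+ 3)); first by rewrite ler_wpM2l// mulr_ge0.
  rewrite -(ler_pM2r (_ : 0 < (4 : R)))// [x * 4]mulrC; apply: le_trans h.
  rewrite (_ : 7 = 3 + 4)%N// exprD mulrA ler_wpM2l//.
    by rewrite mulr_ge0 ?exprn_ge0 ?(ltW Z0)// mulr_ge0.
  by apply: le_trans Z4 _; rewrite -{1}(expr1 Z) Zk.
have gsmall l : prime l -> (l %| g)%N -> l%:R <= Z.
  by move=> pl lg; rewrite leNgt; apply/negP => Zl; apply: small; exists l.
(* Here the upper bound on the trimmed divisor is used: d <= Z^2, so m d [a1] stays below x. *)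
have [d [dg sd Zd dZ]] := trim_divisor g0 y1 Z1 Zg ZyZ gr.
have d0 : (0 < d)%N by rewrite -(ltr0n R) (lt_trans Z0).
right; exists m, p, d, a1; split=> //.
- split; first exact: dvdn_trans dg gp.
  rewrite coprime_has_primes//; apply/hasPn => q; rewrite !mem_primes => /and3P[pq _ qa].
  apply/negP => /and3P[_ _ qd].
  have := tprime q pq (dvdn_trans qa a1t); have := gsmall q pq (dvdn_trans qd dg); lra.
- by split=> //; exact: dvdn_trans dg ga.
have h := prodZ a1 a1Z.
have dZ2 := dZ Z gsmall.
rewrite mulnAC natrM natrM.
apply: (@le_trans _ _ (m%:R * a1%:R * Z ^+ 2)).
  by rewrite ler_wpM2l// ?mulr_ge0// expr2.
rewrite -(ler_pM2r (_ : 0 < (4 : R)))// [x * 4]mulrC; apply: le_trans h.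
rewrite (_ : 7 = 2 + 5)%N// exprD mulrA ler_wpM2l//.
  by apply: mulr_ge0; [exact: mulr_ge0 | exact: sqr_ge0].
by apply: le_trans Z4 _; rewrite -{1}(expr1 Z) Zk.
Qed.

(** With all components at most B = s Z^4, [coprime_part] is applied to b and then, with the divisor
    so obtained, to a; the exponents go from 225 to 45 to 9. The final d > Z^9 suffices since B^2 Z
    = x Z^9. *)
Let small_primes a b : (0 < a)%N -> (0 < b)%N -> a%:R <= 2 * x -> b%:R <= 2 * x ->
  totient a = totient b -> (max_pdiv a)%:R <= B -> (max_pdiv b)%:R <= B ->
  ~ has_square Z a -> ~ has_square Z b ->
  Z ^+ 225 < (rough_totient lam Z b)%:R -> common_divisor_of a b.
Proof.
move=> a0 b0 ax bx tab pa pb nsa nsb rb.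
have Z4_ := Z4; have sZ_ := sZ; have x0_ := x0; have s0_ := s0.
have ZB : Z ^+ 3 <= B.
  rewrite -[leLHS]mul1r; apply: ler_pM; rewrite ?exprn_ge0 ?(ltW Z0)// ?Zk//.
  by apply: le_trans sZ; have := exprn_ege1 15 Z1; lra.
have B1 : 1 <= B by apply: le_trans ZB; exact: exprn_ege1.
have big n : n%:R <= 2 * x -> (n%:R : R) ^+ 2 < B ^+ 5.
  move=> nx; apply: (@le_lt_trans _ _ ((2 * x) ^+ 2)).
    by apply: lerXn2r; rewrite ?nnegrE// mulr_ge0 ?(ltW x0).
  have -> : (2 * x) ^+ 2 = s ^+ 4 * 4 by rewrite /x; ring.
  have -> : B ^+ 5 = s ^+ 4 * (s * Z ^+ 20) by rewrite /B; ring.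
  rewrite ltr_pM2l ?exprn_gt0//.
  apply: (@lt_le_trans _ _ s); last by rewrite ler_peMr ?(ltW s0) ?exprn_ege1.
  apply: lt_le_trans sZ; rewrite ltr_pMr//.
  by apply: lt_le_trans (_ : Z ^+ 1 <= _); [rewrite expr1; lra | exact: Zk].
have V45 : 1 <= Z ^+ 45 by exact: exprn_ege1.
have V9 : 1 <= Z ^+ 9 by exact: exprn_ege1.
have D0b : (rough_totient lam Z b %| totient b)%N.
  apply: dvdn_trans (totient_dvd_part (above Z) b0); exact: dvdn_part.
have [|a1 [a1b a1B D1V]] := coprime_part V45 B1 b0 (rough_totient_gt0 lam Z b)
    (fun q pq qb => component_le b0 nsb pq qb ZB pb) (big b bx) D0b _.
  by rewrite -exprM.
set D1 := gcdn _ _ in D1V.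
have D10 : (0 < D1)%N by rewrite gcdn_gt0 rough_totient_gt0.
have D1a : (D1 %| totient a)%N.
  by rewrite tab; apply: dvdn_trans D0b; exact: dvdn_gcdl.
have [|b1 [b1a b1B D2V]] := coprime_part V9 B1 a0 D10
    (fun q pq qb => component_le a0 nsa pq qb ZB pa) (big a ax) D1a _.
  by rewrite -exprM.
set D2 := gcdn _ _ in D2V.
have D20 : (0 < D2)%N by rewrite gcdn_gt0 D10.
have tt0 : (0 < totient (partn b (above Z)))%N by rewrite totient_gt0 part_gt0.
have gr l : prime l -> (l %| D2)%N -> y < l%:R.
  move=> pl lg; apply: rough_prime tt0 _ pl lg.
  exact: dvdn_trans (dvdn_gcdl _ _) (dvdn_gcdl _ _).
have [d [dD sd Zd _]] := trim_divisor D20 y1 V9 D2V Zy gr.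
exists d, b1, a1; split=> //.
- by split=> //; apply: le_lt_trans Zd; rewrite -{1}(expr1 Z) Zk.
- split; first exact: dvdn_trans dD (dvdn_gcdr _ _).
  exact: dvdn_trans dD (dvdn_trans (dvdn_gcdl _ _) (dvdn_gcdr _ _)).
apply: (@le_trans _ _ (x * Z ^+ 9)); last by rewrite ler_wpM2l ?(ltW x0)// ltW.
have -> : x * Z ^+ 9 = B * B * Z by rewrite /B /x; ring.
by rewrite ler_wpM2r ?(ltW Z0)// natrM ler_pM.
Qed.

Lemma classify (h n : nat) : (0 < n)%N -> (0 < h)%N -> n%:R <= x -> (n + h)%:R <= 2 * x ->
  totient n = totient (n + h) ->
  [\/ (exists j r, diag_rep h Z n j r), has_square Z n \/ has_square Z (n + h),
      diag_small Z h n \/ nondiag_pair (x / Z) h n |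
   [\/ common_divisor x Z k0 h n,
      shifted_divisor x Z k0 n (n + h), shifted_divisor x Z k0 (n + h) n |
      (squarefree_above Z n /\ (rough_totient lam Z n)%:R <= Z ^+ 225) \/
      (squarefree_above Z (n + h) /\ (rough_totient lam Z (n + h))%:R <= Z ^+ 225)]].
Proof.
move=> n0 h0 nx n'x tnh; set n' := (n + h)%N in n'x tnh *.
have Z4_ := Z4; have sZ_ := sZ; have x0_ := x0; have s0_ := s0.
have n'0 : (0 < n')%N by rewrite addn_gt0 n0.
have nx2 : n%:R <= 2 * x by move: x0; lra.
have [?|nsn] := pselect (has_square Z n); first by apply: Or42; left.
have [?|nsn'] := pselect (has_square Z n'); first by apply: Or42; right.
have sq k : (0 < k)%N -> ~ has_square Z k -> squarefree_above Z k.
  move=> k_0 nsk; apply/allP => q; rewrite mem_primes => /and3P[pq _ _].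
  by apply/implyP => Zq; exact: logn_le1.
have [?|rn] := leP (rough_totient lam Z n)%:R (Z ^+ 225).
  by apply/Or44/Or44; left; split=> //; exact: sq.
have [?|rn'] := leP (rough_totient lam Z n')%:R (Z ^+ 225).
  by apply/Or44/Or44; right; split=> //; exact: sq.
(* If all primes of k were at most Z, the part of k above Z would be 1 and [rough_totient] would be
   1. *)
have Zp k : (0 < k)%N -> Z ^+ 225 < (rough_totient lam Z k)%:R -> Z < (max_pdiv k)%:R.
  move=> k_0 rk; rewrite ltNge; apply/negP => h1.
  have e1 : partn k (above Z) = 1%N.
    apply/eqP; rewrite partn_eq1//; apply/pnatP => // q pq qk.
    rewrite inE/= inE/= -leNgt; apply: le_trans h1; rewrite ler_nat.
    by apply: max_pdiv_max; rewrite mem_primes pq k_0.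
  move: rk; rewrite /rough_totient e1 (_ : totient 1 = 1%N)// partn1.
  by rewrite ltNge exprn_ege1.
have split_k k : (0 < k)%N -> ~ has_square Z k -> Z < (max_pdiv k)%:R ->
    exists m, [/\ k = (m * max_pdiv k)%N, prime (max_pdiv k), ~~ (max_pdiv k %| m)%N & (0 < m)%N].
  move=> k_0 nsk Zk'.
  have k1 : (1 < k)%N.
    rewrite ltn_neqAle k_0 andbT; apply/eqP => ek; move: Zk'; rewrite -ek /max_pdiv/=; lra.
  have [m em] := max_pdiv_split k1; exists m; split=> //; first exact: max_pdiv_prime.
    apply/negP => pm; apply: nsk; exists (max_pdiv k) => //.
    by rewrite {2}em expnS expn1 dvdn_mul.
  by move: k_0; rewrite em muln_gt0 => /andP[].
have [m [en pp pm m0]] := split_k n n0 nsn (Zp n n0 rn).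
have [m' [en' pp' pm' m'0]] := split_k n' n'0 nsn' (Zp n' n'0 rn').
have [px p'x] := (Zp n n0 rn, Zp n' n'0 rn').
set p := max_pdiv n in en pp pm px.
set p' := max_pdiv n' in en' pp' pm' p'x.
have tp r t : prime r -> ~~ (r %| t)%N -> totient (t * r) = (totient t * r.-1)%N.
  move=> pr rt; have cop : coprime t r by rewrite coprime_sym prime_coprime.
  by rewrite (totient_coprime cop) (totient_prime pr).
have et : (totient m * p.-1 = totient m' * p'.-1)%N.
  by rewrite -!tp// -en -en'.
have eh : (m * p + h = m' * p')%N by rewrite -en -en'.
have [ed|nd] := eqVneq (totient m * m')%N (totient m' * m)%N.
  have [r [em' [di r0] ep ep']] := diagonal_representation pp pp' m0 m'0 pm pm' eh et ed.
  have [ZG|GZ] := ltP Z (max_pdiv (diag_Gamma h m * r))%:R.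
    apply: Or41; exists m, r; split=> //; rewrite -?ep -?ep' -?em' //.
    by rewrite !prime_coprime.
  apply: Or43; left; exists m, r; split=> //; first by rewrite -ep.
  (* The only clause of [diag_rep] that fails is the size condition; as r divides
     [diag_Gamma h m * r], all its primes are then at most Z. *)
  have G0 : (0 < diag_Gamma h m * r)%N.
    rewrite muln_gt0 r0 andbT /diag_Gamma muln_gt0 totient_gt0 m0/=.
    by rewrite divn_gt0 ?gcdn_gt0 ?m0// dvdn_leq ?addn_gt0 ?m0// dvdn_gcdr.
  apply/allP => l; rewrite mem_primes => /and3P[pl _ lr]; apply: le_trans GZ.
  by rewrite ler_nat max_pdiv_max// mem_primes pl G0 dvdn_mull.
have [mV|mV] := leP ((m * m')%:R : R) (x / Z).
  by apply: Or43; right; exists m, p, m', p'; split.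
have ppx : (p * p')%:R <= 2 * x * Z.
  have mm0 : (0 : R) < (m * m')%:R by rewrite ltr0n muln_gt0 m0.
  rewrite -(ler_pM2l mm0) -natrM.
  have -> : (m * m' * (p * p') = n * n')%N by rewrite [in RHS]en [in RHS]en'; ring.
  rewrite natrM; apply: (@le_trans _ _ (x * (2 * x))); first exact: ler_pM.
  have -> : x * (2 * x) = x / Z * (2 * x * Z) by field; rewrite gt_eqF.
  by apply: ler_wpM2r (ltW mV); exact: mulr_ge0 (mulr_ge0 (ler0n _ 2) (ltW x0)) (ltW Z0).
have swap a b : common_divisor_of b a -> common_divisor_of a b.
  move=> [d [W [W' [? [? ?] [? ?] ?]]]]; exists d, W', W; split=> //.
  by rewrite mulnC.
have [Bp|pB] := ltP B p%:R.
  have [c|c] := large_prime n0 n'0 nx2 n'x tnh en pp pm Bp ppx nsn' rn'.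
    by apply: Or44; apply: Or41.
  by apply: Or44; apply: Or42.
have [Bp'|p'B] := ltP B p'%:R.
  have ppx' : (p' * max_pdiv n)%:R <= 2 * x * Z by rewrite mulnC.
  have [c|c] := large_prime n'0 n0 n'x nx2 (esym tnh) en' pp' pm' Bp' ppx' nsn rn.
    by apply: Or44; apply: Or41; exact: swap.
  by apply: Or44; apply: Or43.
apply: Or44; apply: Or41.
exact: (small_primes n0 n'0 nx2 n'x tnh pB p'B nsn nsn' rn').
Qed.

End Classification.

(** * The finite estimate *)

(** Equal radicals mean phi(j) / j = phi(j + h) / (j + h), which cancels against [diag_A] and
    [diag_B]. Diagonal integers are thus genuine solutions, and the difference of the two counts is
    exactly the number of exceptional ones. *)
Lemma diag_rep_totient (R : realType) (h : nat) (Y : R) n j r :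
  diag_rep h Y n j r -> totient n = totient (n + h).
Proof.
move=> [[/andP[j0 /eqP er] r0] [en en'] [pq1 pq2] [c1 c2] _].
have jh0 : (0 < j + h)%N by rewrite addn_gt0 j0.
have ep := eq_rad_primes j0 jh0 er.
have e1 : (totient j * (j + h) = totient (j + h) * j)%N.
  have h1 := totient_rad j0; have h2 := totient_rad jh0.
  have R0 := rad_gt0 j.
  apply/eqP; rewrite -(eqn_pmul2r R0) mulnAC h1 [X in _ == X]mulnAC er h2 ep; apply/eqP.
  by ring.
have t1 : totient n = (totient j * (diag_A h j * r))%N.
  rewrite en totient_coprime; last by rewrite coprime_sym.
  by rewrite (totient_prime pq1) addn1.
have t2 : totient (n + h) = (totient (j + h) * (diag_B h j * r))%N.
  rewrite en' totient_coprime; last by rewrite coprime_sym.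
  by rewrite (totient_prime pq2) addn1.
rewrite t1 t2 !mulnA; congr muln.
have g0 : (0 < gcdn j (j + h))%N by rewrite gcdn_gt0 j0.
apply/eqP; rewrite -(eqn_pmul2r g0) -!mulnA /diag_A /diag_B !divnK ?dvdn_gcdl ?dvdn_gcdr//.
by rewrite e1.
Qed.

Lemma card_ord_count (X : nat) (P : pred nat) :
  #|[set n : 'I_X.+1 | (0 < n)%N & P n]| = count P (iota 1 X).
Proof.
rewrite cardsE cardE size_filter -(count_map (@nat_of_ord X.+1) (fun n => (0 < n)%N && P n)).
rewrite -enumT val_enum_ord/= add0n; apply: eq_in_count => n.
by rewrite mem_iota => /andP[-> _].
Qed.

Section Total.
Variable R : realType.
Variables (x K lam T w : R) (k0 h : nat).
Let Z := expR K.
Let X := Num.truncn x.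
Let Lg : R := 1 + ln (2 * X)%:R.
Let Mk : R := (2 ^+ k0 * (2 * Lg ^+ 2)) ^+ k0 * Lg.

Definition exceptional (n : nat) : bool :=
  (totient n == totient (n + h)) && ~~ `[< exists j r : nat, diag_rep h Z n j r >].

Hypotheses (l0 : 0 < lam) (l1 : lam <= 1 / 4) (w0 : 0 < w) (h0 : (0 < h)%N).
Hypotheses (Z4 : 4 <= Z) (xZ : 4 * Z ^+ 15 <= Num.sqrt x).
Hypothesis Zy : Z ^+ 9 < expR lam^-1 ^+ k0.
Hypotheses (hT : h%:R <= expR T) (TK : T <= K) (LgT : Lg <= expR T) (MkT : Mk <= expR T).
Hypothesis Kx : K <= lam * ln x.
Hypothesis VT : 450 * lam * K <= T.
Hypothesis sT : 4 * (1 + w + 2 * K / w + 2 * lam * K * expR (lam * K)) <= T.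
Hypothesis fT : expR (16 * expR 1) * (1 + lam^-1) <= T.

(** All asymptotic information enters through the hypotheses of the section. The nine families
    contribute 6 + 6 + 1 + 1 + 3 + 4 + 4 + 2 + 2 = 29 times (x / Z) e^(3 T); the worst carry three
    factors bounded by e^T, such as Mk, Lg and h. *)
Lemma exceptional_count_le :
  ((count exceptional (iota 1 X))%:R : R) <= 29 * (x * expR (- K + 3 * T)).
Proof.
have [Z4_ xZ_] := conj Z4 xZ; have [l0_ l1_] := conj l0 l1.
have Z0 : 0 < Z by exact: expR_gt0.
have Z1 : 1 <= Z by lra.
have K0 : 0 <= K by rewrite -(@ler_expR R) expR0.
have s1 : 1 <= Num.sqrt x.
  by apply: le_trans xZ; have := exprn_ege1 15 Z1; lra.
have x1 : 1 <= x.
  rewrite leNgt; apply/negP => xlt1; have : Num.sqrt x < Num.sqrt 1 by rewrite ltr_sqrt.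
  by rewrite sqrtr1; lra.
have x0 : 0 < x by lra.
have sx : Num.sqrt x ^+ 2 = x by rewrite sqr_sqrtr// ltW.
have Xx : X%:R <= x by rewrite /X truncn_le ltW.
have X0 : (0 < X)%N by rewrite /X truncn_gt0.
have Zx : Z <= x.
  rewrite -sx; apply: (@le_trans _ _ (Num.sqrt x)); last by rewrite expr2 ler_peMl//; lra.
  apply: le_trans xZ; have : Z ^+ 1 <= Z ^+ 15 by rewrite ler_weXn2l.
  by rewrite expr1; lra.
have hZ : h%:R <= Z by apply: le_trans hT _; rewrite ler_expR.
have hX : (h <= X)%N.
  by rewrite /X truncn_ge_nat ?(ltW x0)//; exact: le_trans Zx.
set et := expR T.
have T0 : 0 <= T.
  by apply: le_trans fT; rewrite mulr_ge0 ?expR_ge0// addr_ge0// invr_ge0 ltW.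
have et1 : 1 <= et by rewrite -expR0 ler_expR.
have Lg1 : 1 <= Lg by rewrite lerDl ln_ge0// ler1n muln_gt0.
pose S := expR (4 * (1 + w + 2 * K / w + 2 * lam * K * expR (lam * K))).
have S_et : S <= et by rewrite ler_expR.
have S0 : 0 <= S by exact: expR_ge0.
have xl : x `^ (1 - lam) <= x / Z.
  rewrite powRD ?(gt_eqF x0) ?implybT// powRr1 ?(ltW x0)// ler_pM2l// powRN.
  by rewrite lef_pV2 ?posrE ?powR_gt0// /Z /powR (gt_eqF x0) ler_expR.
(* The list turns the alternatives of [classify] into one indexed family for the union bound; the
   terms [n + 0] match the shift in the counting lemmas. *)
pose bad (i : nat) (n : nat) : bool := nth false [::
   `[< has_square Z (n + 0) >]; `[< has_square Z (n + h) >];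
   `[< diag_small Z h n >]; `[< nondiag_pair (x / Z) h n >];
   `[< common_divisor x Z k0 h n >];
   `[< shifted_divisor x Z k0 (n + 0) (n + h) >];
   `[< shifted_divisor x Z k0 (n + h) (n + 0) >];
   squarefree_above Z (n + 0) && ((rough_totient lam Z (n + 0))%:R <= Z ^+ 225);
   squarefree_above Z (n + h) && ((rough_totient lam Z (n + h))%:R <= Z ^+ 225)] i.
have cover : (count exceptional (iota 1 X))%:R <=
    \sum_(i <- iota 0 9) (count (bad i) (iota 1 X))%:R :> R.
  apply: (@count_cover R _ nat _ _ _ predT) => n.
  rewrite mem_iota add1n ltnS => /andP[n0 nX] /andP[/eqP tn /asboolPn nd].
  have nx : n%:R <= Num.sqrt x ^+ 2 by rewrite sx; apply: le_trans Xx; rewrite ler_nat.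
  have n'x : (n + h)%:R <= 2 * Num.sqrt x ^+ 2.
    rewrite sx natrD (_ : 2 * x = x + x); last by ring.
    by apply: lerD; [rewrite -sx | apply: le_trans Zx].
  have := classify Z4 xZ l0 Zy n0 h0 nx n'x tn; rewrite sx.
  have in_ i : (i < 9)%N -> bad i n -> exists i, [/\ i \in iota 0 9, true & bad i n].
    by move=> i9 b; exists i; rewrite mem_iota.
  case=> [//|[c|c]|[c|c]|[c|c|c|[[c1 c2]|[c1 c2]]]].
  - by apply: (in_ 0%N) => //; rewrite /bad/= addn0; apply/asboolP.
  - by apply: (in_ 1%N) => //; rewrite /bad/=; apply/asboolP.
  - by apply: (in_ 2%N) => //; rewrite /bad/=; apply/asboolP.
  - by apply: (in_ 3%N) => //; rewrite /bad/=; apply/asboolP.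
  - by apply: (in_ 4%N) => //; rewrite /bad/=; apply/asboolP.
  - by apply: (in_ 5%N) => //; rewrite /bad/= addn0; apply/asboolP.
  - by apply: (in_ 6%N) => //; rewrite /bad/= addn0; apply/asboolP.
  - by apply: (in_ 7%N) => //; rewrite /bad/= addn0 c1 c2.
  - by apply: (in_ 8%N) => //; rewrite /bad/= c1 c2.
have b0 : (count (bad 0%N) (iota 1 X))%:R <= 6 * x / Z.
  exact: (count_has_square Xx X0 hX Z1 (leq0n h)).
have b1 : (count (bad 1%N) (iota 1 X))%:R <= 6 * x / Z.
  exact: (count_has_square Xx X0 hX Z1 (leqnn h)).
have l2 : lam <= 1 by lra.
have b2 : (count (bad 2%N) (iota 1 X))%:R <= x `^ (1 - lam) * S ^+ 2.
  apply: (count_diag_small Xx X0 h0 (ltW l0) l2 hZ).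
  exact: (smooth_sum_le X (ltW l0) l1 K0 w0).
have b3 : (count (bad 3%N) (iota 1 X))%:R <= x / Z * Lg.
  exact: (count_nondiag_pair Xx X0 h0 hX Z1).
have b4 : (count (bad 4%N) (iota 1 X))%:R <= x * Mk ^+ 2 * (2 * h%:R + Lg) / Z.
  exact: (count_common_divisor Xx X0 h0 hX k0 Z1).
have b5 : (count (bad 5%N) (iota 1 X))%:R <= x * Mk * Lg * (2 * (h%:R + 1)) / Z.
  exact: (count_shifted_divisor Xx X0 h0 hX k0 Z1 (add0n h) (or_introl erefl)).
have b6 : (count (bad 6%N) (iota 1 X))%:R <= x * Mk * Lg * (2 * (h%:R + 1)) / Z.
  exact: (count_shifted_divisor Xx X0 h0 hX k0 Z1 (addn0 h) (or_intror erefl)).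
have V0 : 0 < Z ^+ 225 by rewrite exprn_gt0.
pose F := (2 * x) `^ (1 - lam) * (Z ^+ 225) `^ (2 * lam) *
  expR (4 * (1 + w + 2 * K / w + 2 * lam * K * expR (lam * K)) +
        expR (16 * expR 1) * (1 + lam^-1)).
have b7 : (count (bad 7%N) (iota 1 X))%:R <= F.
  exact: (count_rough_totient_small Xx hX (leq0n h) l0 l1 K0 w0 V0).
have b8 : (count (bad 8%N) (iota 1 X))%:R <= F.
  exact: (count_rough_totient_small Xx hX (leqnn h) l0 l1 K0 w0 V0).
have eE : x * expR (- K + 3 * T) = x / Z * et ^+ 3.
  rewrite expRD expRN mulrA; congr (_ * _).
  by rewrite /et -expRM_natl; congr expR; rewrite mulrC.
have xZ0 : 0 < x / Z by rewrite divr_gt0.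
have et2 : et <= et ^+ 2 by rewrite expr2 ler_peMl//; lra.
have et3 : et ^+ 2 <= et ^+ 3 by rewrite ler_weXn2l.
have Mk0 : 0 <= Mk.
  by rewrite mulr_ge0 ?exprn_ge0 ?mulr_ge0 ?exprn_ge0//; lra.
(* Three losses of e^T: the power V^(2 lam) = e^(450 lam K), the Euler factors up to Z, and those
   above Z. *)
have FE : F <= 2 * (x / Z) * et ^+ 3.
  have -> : et ^+ 3 = et * (et * et) by ring.
  rewrite mulrA; apply: ler_pM; rewrite ?expR_ge0//.
  - by apply: mulr_ge0; exact: powR_ge0.
  - apply: ler_pM; rewrite ?powR_ge0//.
      rewrite powRM ?(ltW x0)//; apply: ler_pM; rewrite ?powR_ge0//.
      rewrite -[leRHS](@powRr1 R 2)//; apply: ler_powR; lra.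
    rewrite -powR_mulrn ?(ltW Z0)// -powRrM /powR (gt_eqF Z0) /Z expRK ler_expR.
    by apply: le_trans VT; rewrite le_eqVlt; apply/orP; left; apply/eqP; ring.
  by rewrite -expRD ler_expR lerD.
have B2 : x `^ (1 - lam) * S ^+ 2 <= x / Z * et ^+ 2.
  by apply: ler_pM; rewrite ?powR_ge0 ?sqr_ge0// lerXn2r ?nnegrE ?expR_ge0.
have B4 : x * Mk ^+ 2 * (2 * h%:R + Lg) / Z <= x / Z * (et ^+ 2 * (3 * et)).
  have -> : x * Mk ^+ 2 * (2 * h%:R + Lg) / Z = x / Z * (Mk ^+ 2 * (2 * h%:R + Lg)) by ring.
  rewrite ler_pM2l//; apply: ler_pM; rewrite ?sqr_ge0//.
  - by rewrite addr_ge0 ?mulr_ge0//; lra.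
  - by rewrite lerXn2r ?nnegrE ?expR_ge0.
  - by have := hT; have := LgT; rewrite -/et; lra.
have B5 : x * Mk * Lg * (2 * (h%:R + 1)) / Z <= x / Z * (et * (et * (4 * et))).
  have -> : x * Mk * Lg * (2 * (h%:R + 1)) / Z = x / Z * (Mk * (Lg * (2 * (h%:R + 1)))) by ring.
  have h1 : 0 <= h%:R :> R by [].
  have u0 : 0 <= Lg by lra.
  have u1 : 0 <= 2 * (h%:R + 1) :> R by lra.
  have u2 : 2 * (h%:R + 1) <= 4 * et by have := hT; rewrite -/et; lra.
  rewrite ler_pM2l//; apply: (ler_pM Mk0 (mulr_ge0 u0 u1) MkT).
  exact: (ler_pM u0 u1 LgT u2).
have B3 : x / Z * Lg <= x / Z * et by rewrite ler_pM2l.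
have B0 : 6 * x / Z = 6 * (x / Z) by rewrite mulrA.
apply: le_trans cover _; rewrite eE /= !big_cons big_nil.
rewrite B0 in b0 b1.
have e1 : x / Z * (et ^+ 2 * (3 * et)) = 3 * (x / Z * et ^+ 3) by ring.
have e2 : x / Z * (et * (et * (4 * et))) = 4 * (x / Z * et ^+ 3) by ring.
have e3 : 2 * (x / Z) * et ^+ 3 = 2 * (x / Z * et ^+ 3) by ring.
rewrite e1 in B4; rewrite e2 in B5; rewrite e3 in FE.
have g1 : x / Z <= x / Z * et ^+ 3 by rewrite ler_peMr ?(ltW xZ0)// exprn_ege1.
have g2 : x / Z * et <= x / Z * et ^+ 3 by rewrite ler_pM2l// (le_trans et2).
have g3 : x / Z * et ^+ 2 <= x / Z * et ^+ 3 by rewrite ler_pM2l.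
move: b0 b1 b2 b3 b4 b5 b6 b7 b8 FE B2 B3 B4 B5 g1 g2 g3.
move: (count _ _)%:R (count _ _)%:R (count _ _)%:R (count _ _)%:R (count _ _)%:R (count _ _)%:R (count _ _)%:R (count _ _)%:R (count _ _)%:R.
move=> c0 c1 c2 c3 c4 c5 c6 c7 c8.
move: (x / Z * et ^+ 3) (x / Z * et ^+ 2) (x / Z * et) (x / Z) => *.
lra.
Qed.

Lemma S_sub_D_le :
  `|(S_phi h x)%:R - (D_phi h Z x)%:R| <= 29 * (x * expR (- K + 3 * T)).
Proof.
apply: le_trans exceptional_count_le.
rewrite /S_phi /D_phi (card_ord_count X (fun n => totient n == totient (n + h))).
rewrite (card_ord_count X (fun n => `[< exists j r : nat, diag_rep h Z n j r >])).
set D := fun n : nat => `[< _ >].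
have -> : count (fun n => totient n == totient (n + h)) (iota 1 X) =
    (count D (iota 1 X) + count exceptional (iota 1 X))%N.
  rewrite -count_predUI (@eq_count _ (predI D exceptional) pred0) ?count_pred0 ?addn0.
    apply: eq_count => n /=; rewrite /exceptional -/(D n).
    case: (boolP (D n)) => [/asboolP[j [r /diag_rep_totient ->]]|_]; first by rewrite eqxx.
    by rewrite andbT.
  by move=> n /=; rewrite /exceptional -/(D n); case: (D n); rewrite ?andbF.
by rewrite natrD addrAC subrr add0r normr_nat.
Qed.

End Total.

Local Open Scope classical_set_scope.

(** * Asymptotics of the parameters *)

Section Asymptotics.
Variable R : realType.
Implicit Types x t : R.

Lemma near_ge (M : R) : \forall x \near +oo, M <= x.
Proof. by apply: nbhs_pinfty_ge; exact: num_real. Qed.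

Lemma near_ln_ge (f : R -> R) (F : set_system R) : Filter F ->
  (forall M, \forall x \near F, M <= f x) ->
  forall M, \forall x \near F, M <= ln (f x) /\ f x = expR (ln (f x)).
Proof.
move=> FF H M; near=> x.
have : expR M <= f x by near: x; exact: H.
move=> h; have f0 : 0 < f x by apply: lt_le_trans h; exact: expR_gt0.
by rewrite lnK ?posrE//; split=> //; rewrite -ler_expR lnK ?posrE.
Unshelve. all: by end_near.
Qed.

(** Because [ln] is 0 on nonpositive reals, the exponential identity is carried along: it records
    that the previous iterate is positive and lets the logarithms be inverted. *)
Lemma near_iter_ln k : forall M : R, \forall x \near +oo,
  M <= iter_ln k x /\ (0 < k)%N ==> (iter_ln k.-1 x == expR (iter_ln k x)).
Proof.
elim: k => [|k IH] M.
  by near=> x; split=> //; near: x; exact: near_ge.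
have H (N : R) : \forall x \near +oo, N <= iter_ln k x.
  near=> x; have [] // : N <= iter_ln k x /\ (0 < k)%N ==> (iter_ln k.-1 x == expR (iter_ln k x)).
  by near: x; exact: IH.
near=> x.
have [h e] : M <= ln (iter_ln k x) /\ iter_ln k x = expR (ln (iter_ln k x)).
  by near: x; exact: near_ln_ge.
by split=> //=; rewrite /iter_ln/= -[X in X == _]/(iter_ln k x) {1}e.
Unshelve. all: by end_near.
Qed.

Lemma calA_bounds t (a := ln t + ln (ln t) - ln 2) : expR 1 <= t ->
  ln t - 1 <= a /\ a <= 2 * ln t.
Proof.
move=> t1; have t0 : 0 < t by apply: lt_le_trans t1; exact: expR_gt0.
have l1 : 1 <= ln t by rewrite -ler_expR lnK ?posrE.
have l2 : 0 <= ln (ln t) by exact: ln_ge0.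
have h2 : ln 2 <= (1 : R).
  rewrite -ler_expR lnK ?posrE//; have := expR_ge1Dx (1 : R); lra.
have h3 : 0 <= ln (2 : R) by rewrite ln_ge0// ler1n.
have h4 : ln (ln t) < ln t by apply: ln_sublinear; lra.
rewrite /a; lra.
Qed.

(* [x] is so large that the lower order terms are at most [c] times the main
   ones; each limit is reduced to a bound valid for every small [c]. *)
Definition well_placed (c x : R) : Prop :=
  let t := iter_ln 2 x in
  [/\ x = expR (ln x) /\ ln x = expR t, c^-1 <= t, c^-1 <= calA x &
      calA x ^+ 2 <= c * t /\ 16 * t ^+ 3 <= expR (t / 4)].

Lemma near_well_placed c : 0 < c -> \forall x \near +oo, well_placed c x.
Proof.
move=> c0; near=> x; rewrite /well_placed.
have [h1 /implyP/(_ isT)/eqP e1] : 0 <= iter_ln 1 x /\ (0 < 1)%N ==> (iter_ln 0 x == expR (iter_ln 1 x)).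
  by near: x; exact: near_iter_ln.
(* The four terms of the threshold serve, in order, the bound 1 / c <= t, the lemma [calA_bounds],
   the bound A^2 <= c t, and 16 t^3 <= (t / 16)^4 <= e^(t/4). *)
have [h2 /implyP/(_ isT)/eqP e2] : c^-1 + expR 1 + (64 / c) ^+ 2 + 16 * 16 ^+ 4 <= iter_ln 2 x /\
    (0 < 2)%N ==> (iter_ln 1 x == expR (iter_ln 2 x)).
  by near: x; exact: near_iter_ln.
have [h3 _] : c^-1 + 1 <= iter_ln 3 x /\ (0 < 3)%N ==> (iter_ln 2 x == expR (iter_ln 3 x)).
  by near: x; exact: near_iter_ln.
set t := iter_ln 2 x in h2 e2 *.
have ci0 : 0 < c^-1 by rewrite invr_gt0.
have e0 : 0 < expR (1 : R) by exact: expR_gt0.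
have s0 : 0 <= (64 / c) ^+ 2 by exact: sqr_ge0.
have b0 : 0 <= 16 * 16 ^+ 4 :> R := mulr_ge0 (ler0n R 16) (exprn_ge0 4 (ler0n R 16)).
set g := 16 * 16 ^+ 4 in b0 h2.
have t1 : expR 1 <= t by lra.
have t0 : 0 < t by lra.
have [a1 a2] := calA_bounds t1.
have eA : calA x = ln t + ln (ln t) - ln 2 by [].
have e3 : iter_ln 3 x = ln t by [].
split.
- by split; [exact: e1 | exact: e2].
- by lra.
- by rewrite eA; move: h3; rewrite e3; lra.
split; last first.
  have -> : expR (t / 4) = expR (t / 16) ^+ 4 by rewrite -expRM_natl; congr expR; field.
  apply: (@le_trans _ _ ((t / 16) ^+ 4)).
    rewrite expr_div_n ler_pdivlMr ?exprn_gt0// [t ^+ 4]exprS mulrAC.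
    rewrite -/g ler_wpM2r ?exprn_ge0 ?(ltW t0)//; lra.
  apply: lerXn2r; rewrite ?nnegrE ?expR_ge0 ?divr_ge0 ?(ltW t0)//.
  by have := expR_ge1Dx (t / 16); lra.
have l1 : 1 <= ln t by rewrite -ler_expR lnK ?posrE.
have A0 : 0 <= calA x by rewrite eA; lra.
have q0 : 0 <= Num.sqrt t by exact: sqrtr_ge0.
have lt4 : (ln t) ^+ 2 <= 16 * Num.sqrt t.
  pose u := ln t / 2.
  have u0 : 0 <= u by rewrite /u; lra.
  have es : Num.sqrt t = expR u.
    rewrite -{1}(@lnK R t) ?posrE// -[RHS]ger0_norm ?expR_ge0// -sqrtr_sqr -expRM_natl.
    by congr (Num.sqrt (expR _)); rewrite /u; field.
  have : u ^+ 2 / 4 <= expR u.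
    have h := expR_ge1Dx (u / 2); have hu : 0 <= 1 + u / 2 by lra.
    have -> : expR u = expR (u / 2) ^+ 2.
      by rewrite -expRM_natl; congr expR; field.
    apply: (@le_trans _ _ ((1 + u / 2) ^+ 2)).
      by rewrite !expr2; nra.
    by rewrite lerXn2r ?nnegrE ?expR_ge0.
  rewrite -es; have -> : ln t = 2 * u by rewrite /u; field.
  by rewrite !expr2; lra.
have A2 : calA x ^+ 2 <= 64 * Num.sqrt t.
  apply: (@le_trans _ _ ((2 * ln t) ^+ 2)).
    have b1 : 0 <= 2 * ln t by lra.
    have ab : calA x <= 2 * ln t by rewrite eA.
    by apply: lerXn2r.
  by rewrite exprMn [2 ^+ 2]expr2; lra.
apply: le_trans A2 _.
have et : t = Num.sqrt t * Num.sqrt t by rewrite -expr2 sqr_sqrtr// ltW.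
rewrite {2}et mulrA ler_wpM2r// mulrC -ler_pdivrMr//.
rewrite -(@ger0_norm _ (64 / c)) ?divr_ge0 ?(ltW c0)// -sqrtr_sqr ler_sqrt//; lra.
Unshelve. all: by end_near.
Qed.

(* In terms of [t = log_2 x] and [u = sqrt (log x / log_2 x)] every parameter
   is a rational expression. *)
Lemma well_placed_params (c x : R) (t := iter_ln 2 x) (u := Num.sqrt (ln x / t))
    (A := calA x) (e := par_eta x) : 0 < c -> c <= 1 / 256 -> well_placed c x ->
  [/\ [/\ 16 <= t, 16 <= A, A ^+ 2 <= c * t, x = expR (ln x) & ln x = expR t],
      [/\ 0 < u, ln x = u ^+ 2 * t & calR x = u * t],
      [/\ 0 < e, e ^+ 2 * A = 1, e ^+ 2 <= c & e <= 1 / 16],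
      par_T x = A * u / (1 - 2 * e) & par_K0 x = (2^-1 - 2 * e) * (u * t)].
Proof.
move=> c0 c1 [[ex eL] ct cA [At _]].
have ci : 16 <= c^-1 by rewrite -[leLHS]invrK lef_pV2 ?posrE ?invr_gt0//; lra.
have t0 : 0 < t by rewrite /t; lra.
have A0 : 0 < A by rewrite /A; lra.
have L0 : 0 < ln x by rewrite eL expR_gt0.
have u0 : 0 < u by rewrite sqrtr_gt0 divr_gt0.
have eu : ln x = u ^+ 2 * t.
  by rewrite sqr_sqrtr ?divr_ge0 ?ltW// mulfVK// gt_eqF.
have eR : calR x = u * t.
  have ut0 : 0 <= u * t by rewrite mulr_ge0 ?ltW.
  rewrite /calR -/t {1}eu -[RHS]ger0_norm// -sqrtr_sqr; congr Num.sqrt; ring.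
have eA : e ^+ 2 * A = 1.
  by rewrite /e /par_eta exprVn sqr_sqrtr ?(ltW A0)// mulVf// gt_eqF.
have e0 : 0 < e by rewrite invr_gt0 sqrtr_gt0.
have ec : e ^+ 2 <= c.
  have A1 : A != 0 by rewrite gt_eqF.
  have -> : e ^+ 2 = A^-1 by apply: (mulIf A1); rewrite eA mulVf.
  by rewrite -[leRHS]invrK lef_pV2 ?posrE ?invr_gt0.
have e1 : e <= 1 / 16.
  rewrite leNgt; apply/negP => h; have : (1 / 16) ^+ 2 < e ^+ 2 by rewrite ltrXn2r ?nnegrE//; lra.
  by rewrite [(1 / 16) ^+ 2]expr2; lra.
have eK : par_K0 x = (2^-1 - 2 * e) * (u * t) by rewrite /par_K0 -/e eR.
split=> //.
- by split=> //; [rewrite /t; lra | rewrite /A; lra].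
rewrite /par_T /par_E -/e -/A eR eu; field.
by rewrite !gt_eqF//; lra.
Qed.

(** The bound on T is the statement T = o(eta R): e^2 A = 1 and e <= 1 give 1 <= e A, hence A u <= e
    A^2 u <= c e u t, and 1 / (1 - 2 e) <= 2. The floor in J moves K below K0 by at most T. *)
Lemma well_placed_bounds (c x : R) (t := iter_ln 2 x) (u := Num.sqrt (ln x / t))
    (A := calA x) (e := par_eta x) (T := par_T x) (K := par_K x) :
  0 < c -> c <= 1 / 256 -> well_placed c x ->
  [/\ 0 < T /\ A * u <= T, T <= 2 * c * e * (u * t), K <= (2^-1 - 2 * e) * (u * t),
      (2^-1 - 2 * e) * (u * t) - T <= K & (par_J x)%:~R * T = K].
Proof.
move=> c0 c1 wp; have := well_placed_params c0 c1 wp.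
rewrite -/t -/u -/A -/e -/T.
move=> [[t1 A1 At _ _] [u0 eL eR] [e0 eA ec e1] eT eK].
have A0 : 0 < A by lra.
have t0 : 0 < t by lra.
have d0 : 0 < 1 - 2 * e by lra.
have Au0 : 0 < A * u by rewrite mulr_gt0.
have T0 : 0 < T by rewrite eT divr_gt0.
have AT : A * u <= T by rewrite eT ler_pdivlMr// ler_piMr ?(ltW Au0)//; lra.
have eA1 : 1 <= e * A.
  have : e * (e * A) <= e * A by rewrite ler_piMl ?mulr_ge0 ?(ltW e0) ?(ltW A0)//; lra.
  by rewrite mulrA -expr2 eA.
have Tc : T <= 2 * c * e * (u * t).
  rewrite eT ler_pdivrMr//.
  have h1 : A * u <= e * A ^+ 2 * u.
    rewrite ler_wpM2r ?(ltW u0)// expr2 mulrA ler_peMl ?(ltW A0)//.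
  have h2 : e * A ^+ 2 * u <= e * (c * t) * u.
    by rewrite ler_wpM2r ?(ltW u0)// ler_wpM2l ?(ltW e0).
  apply: le_trans (le_trans h1 h2) _.
  have h3 : 0 < c * e * (u * t) by rewrite !mulr_gt0.
  have -> : e * (c * t) * u = c * e * (u * t) by ring.
  have -> : 2 * c * e * (u * t) * (1 - 2 * e) = (c * e * (u * t)) * (2 - 4 * e) by ring.
  by rewrite ler_peMr ?(ltW h3)//; lra.
have eK' : K = (par_J x)%:~R * T by [].
have /andP[f1 f2] := floor_itv (par_K0 x / T).
rewrite -/(par_J x) intrD in f1 f2.
split=> //.
- by rewrite eK' -eK -ler_pdivlMr.
- by rewrite eK' -eK lerBlDr -[X in _ + X]mul1r -mulrDl -ler_pdivrMr// ltW.
Qed.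

(** Since eta^2 <= c, taking c below both k and k^2 makes c + eta at most 2 k; with k = eps / 100
    the generous common constant 50 is accommodated. *)
Lemma cvg_of_well_placed (f : R -> R) :
  (forall c x, 0 < c -> c <= 1 / 256 -> well_placed c x ->
     `|f x| <= 50 * (c + par_eta x)) -> f x @[x --> +oo] --> (0 : R).
Proof.
move=> H; apply/cvgr0Pnorm_le => eps eps0.
pose k := eps / 100.
have k0 : 0 < k by rewrite divr_gt0.
pose c := Num.min (1 / 256) (Num.min k (k ^+ 2)).
have c0 : 0 < c by rewrite !lt_min k0 exprn_gt0// divr_gt0 ?ltr0n.
have [c1 ck ck2] : [/\ c <= 1 / 256, c <= k & c <= k ^+ 2].
  by rewrite !ge_min !lexx !orbT.
near=> x.
have wp : well_placed c x by near: x; exact: near_well_placed.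
have := H c x c0 c1 wp => /le_trans; apply.
have [_ _ [e0 _ ec _] _ _] := well_placed_params c0 c1 wp.
have : par_eta x <= k.
  rewrite leNgt; apply/negP => h; have : k ^+ 2 < par_eta x ^+ 2.
    by rewrite ltr_pXn2r ?nnegrE ?(ltW k0) ?(ltW e0).
  lra.
by rewrite /k; move: ck; rewrite /k; lra.
Unshelve. all: by end_near.
Qed.

End Asymptotics.

(** * The main estimate *)

(** Equal radicals force [j] and [j + h] to have the same parity. *)
Lemma odd_diagonal_empty (R : realType) (h : nat) (Y x : R) : odd h -> D_phi h Y x = 0%N.
Proof.
move=> oh; rewrite /D_phi; apply/eqP; rewrite cards_eq0; apply/eqP/setP => n.
rewrite !inE; apply/negP => /andP[_ /asboolP[j [r [[/andP[j0 /eqP er] _] _ _ _ _]]]].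
have jh0 : (0 < j + h)%N by rewrite addn_gt0 j0.
have := dvdn_rad (isT : prime 2) j0; rewrite er dvdn_rad// !dvdn2 oddD oh.
by case: (odd j).
Qed.

Section MainEstimate.
Variable R : realType.
Implicit Types c x : R.

Lemma two_le_expR1 : (2 : R) <= expR 1.
Proof. by have := expR_ge1Dx (1 : R); lra. Qed.

Lemma log_bounds x (t : R) (Lg := 1 + ln (2 * Num.truncn x)%:R) :
  x = expR (expR t) -> 16 <= t -> 1 <= Lg /\ Lg <= expR (2 * t).
Proof.
move=> ex t1; have x1 : 1 <= x by rewrite ex -expR0 ler_expR expR_ge0.
have X0 : (0 < Num.truncn x)%N by rewrite truncn_gt0.
have x0 : 0 <= x by lra.
split; first by rewrite lerDl ln_ge0// ler1n muln_gt0.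
have h2 : ln 2 <= (1 : R) by rewrite -ler_expR lnK ?posrE// two_le_expR1.
have X0' : (0 : R) < (Num.truncn x)%:R by rewrite ltr0n.
have lX : ln (Num.truncn x)%:R <= expR t.
  by rewrite -[leRHS]expRK -ex ler_ln ?posrE ?truncn_le// (lt_le_trans X0')// truncn_le.
rewrite /Lg natrM lnM ?posrE//.
have et := expR_ge1Dx t.
have -> : expR (2 * t) = expR t * expR t by rewrite -expRD; congr expR; ring.
have : 3 * expR t <= expR t * expR t by rewrite ler_wpM2r ?expR_ge0//; lra.
by lra.
Qed.

(** With k <= 3 t, the factors 2^k and 2 Lg^2 give e^(3 t) and e^(5 t); their product to the power k
    gives e^(24 t^2), and the last Lg at most e^(2 t^2). *)
Lemma totient_factor_le (Lg t : R) (k : nat) : 1 <= Lg -> Lg <= expR (2 * t) ->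
  16 <= t -> k%:R <= 3 * t ->
  (2 ^+ k * (2 * Lg ^+ 2)) ^+ k * Lg <= expR (26 * t ^+ 2).
Proof.
move=> Lg1 LgT t1 kb.
have L0 : 0 <= Lg by lra.
have p1 : 2 ^+ k <= expR (3 * t).
  apply: (@le_trans _ _ (expR 1 ^+ k)).
    apply: lerXn2r; rewrite ?nnegrE ?expR_ge0//; exact: two_le_expR1.
  by rewrite -expRM_natl mulr1 ler_expR.
have q0 : 0 <= Lg ^+ 2 by exact: sqr_ge0.
have p2 : 2 * Lg ^+ 2 <= expR (5 * t).
  apply: (@le_trans _ _ (expR 1 * expR (4 * t))); last by rewrite -expRD ler_expR; lra.
  apply: (ler_pM _ q0 two_le_expR1) => //.
  have -> : expR (4 * t) = expR (2 * t) ^+ 2 by rewrite -expRM_natl; congr expR; ring.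
  by apply: lerXn2r; rewrite ?nnegrE ?expR_ge0.
have r0 : 0 <= 2 * Lg ^+ 2 by exact: mulr_ge0.
have s0 : 0 <= 2 ^+ k :> R by exact: exprn_ge0.
have p3 : 2 ^+ k * (2 * Lg ^+ 2) <= expR (8 * t).
  have -> : expR (8 * t) = expR (3 * t) * expR (5 * t) by rewrite -expRD; congr expR; ring.
  exact: ler_pM.
have v0 : 0 <= 2 ^+ k * (2 * Lg ^+ 2) by exact: mulr_ge0.
have p4 : (2 ^+ k * (2 * Lg ^+ 2)) ^+ k <= expR (24 * t ^+ 2).
  apply: (@le_trans _ _ (expR (8 * t) ^+ k)).
    by apply: lerXn2r; rewrite ?nnegrE ?expR_ge0.
  rewrite -expRM_natl ler_expR.
  have -> : 24 * t ^+ 2 = 3 * t * (8 * t) by ring.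
  by rewrite ler_wpM2r//; lra.
apply: (@le_trans _ _ (expR (24 * t ^+ 2) * expR (2 * t))).
  exact: (ler_pM (exprn_ge0 _ v0) L0 p4 LgT).
rewrite -expRD ler_expR.
have : t * 1 <= t * t by rewrite ler_wpM2l//; lra.
by rewrite expr2; lra.
Qed.

Lemma well_placed_estimate c x (h : nat) : 0 < c -> c <= 1 / 256 ->
  c * (3 * expR (16 * expR 1)) <= 1 -> well_placed c x ->
  (1 <= h)%N -> h%:R <= par_y x ->
  `|(S_phi h x)%:R - (D_phi h (par_Z x) x)%:R| <=
     29 * (x * expR (- par_K x + 3 * par_T x)).
Proof.
move=> c0 c1 cF wp h1 hy.
have [[t1 A1 At ex eL] [u0 eu eR] [e0 eA ec e1] eT eK] := well_placed_params c0 c1 wp.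
have [[T0 AT] Tc K1 K2 _] := well_placed_bounds c0 c1 wp.
have [_ _ cA [_ G]] := wp.
set t := iter_ln 2 x in t1 At eL u0 eu eR eT eK AT Tc K1 K2 G.
set u := Num.sqrt _ in u0 eu eR eT eK AT Tc K1 K2.
set A := calA x in A1 At eA eT AT cA.
set e := par_eta x in e0 eA ec e1 eT eK Tc K1 K2.
set T := par_T x in eT T0 AT Tc K2 *.
set K := par_K x in K1 K2 *.
clear At eA ec eT eK eR.
have t0 : 0 < t by clear -t1; lra.
have ut0 : 0 < u * t by rewrite mulr_gt0.
set g := expR (t / 4) in G.
have g0 : 0 < g by exact: expR_gt0.
have t3 : t <= t ^+ 3 by rewrite -{1}(expr1 t) ler_weXn2l//; clear -t1; lra.
have t2 : t ^+ 2 <= t ^+ 3 by rewrite ler_weXn2l//; clear -t1; lra.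
have tt2 : t <= t ^+ 2 by rewrite -{1}(expr1 t) ler_weXn2l//; clear -t1; lra.
(* Here u^2 t = log x = e^t, so u is e^(t/2) / sqrt t, which dominates g = e^(t/4) times the powers
   of t that occur. *)
have gu : g * t <= u.
  have h2 : (g * t * t) ^+ 2 <= (u * t) ^+ 2.
    have -> : (u * t) ^+ 2 = expR t * t by rewrite -eL eu; ring.
    have -> : expR t = g ^+ 4 by rewrite -expRM_natl; congr expR; field.
    have -> : (g * t * t) ^+ 2 = g ^+ 2 * (t ^+ 3 * t) by ring.
    have -> : g ^+ 4 * t = g ^+ 2 * (g ^+ 2 * t) by ring.
    rewrite ler_wpM2l ?sqr_ge0// ler_wpM2r ?(ltW t0)//.
    have g1 : g <= g ^+ 2.
      by rewrite expr2 ler_peMl ?(ltW g0)//; clear -G t3 t1; lra.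
    by clear -g1 G t3 t1; lra.
  have h3 : g * t * t <= u * t.
    rewrite leNgt; apply/negP => h4; move: h2; rewrite leNgt => /negP; apply.
    by rewrite ltr_pXn2r ?nnegrE ?(ltW ut0)// !mulr_ge0 ?(ltW g0) ?(ltW t0).
  by rewrite -(ler_pM2r t0).
have ug : g <= u by apply: le_trans gu; rewrite ler_peMr ?(ltW g0)//; clear -t1; lra.
have u1 : 16 * t ^+ 3 <= u by apply: le_trans ug.
have u1k : 16 <= u by clear -u1 t3 t1; lra.
have Aut : u * 16 <= T by apply: le_trans AT; rewrite mulrC ler_wpM2r ?(ltW u0)//; lra.
pose lam := (2 * u)^-1.
have l0 : 0 < lam by rewrite invr_gt0 mulr_gt0.
have ilam : lam^-1 = 2 * u by rewrite /lam invrK.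
have lu : lam * u = 2^-1 by rewrite /lam; field; rewrite gt_eqF.
have Kut : K <= u * t / 2.
  have hh : 0 <= e * (u * t) by rewrite mulr_ge0 ?ltW.
  by clear -hh K1; lra.
have Tut : T <= u * t / 16.
  apply: le_trans Tc _; have : c * e <= 1 / 256 * (1 / 16) by exact: (ler_pM (ltW c0) (ltW e0) c1 e1).
  by move=> ce; have hh := ler_wpM2r (ltW ut0) ce; clear -hh ut0; lra.
have Kl : u * t / 4 <= K.
  have hh : e * (u * t) <= 1 / 16 * (u * t) by rewrite ler_wpM2r ?(ltW ut0).
  by clear -hh K2 Tut ut0; lra.
clear K1 K2 Tc e0 e1 A1 e.
have ut1 : 16 <= u * t.
  have hh : u * 1 <= u * t by rewrite ler_wpM2l ?(ltW u0)//; clear -t1; lra.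
  by clear -hh u1k; lra.
have lK : lam * K <= t / 4.
  have -> : t / 4 = lam * (u * t / 2).
    have -> : lam * (u * t / 2) = lam * u * t / 2 by ring.
    by rewrite lu; field.
  exact: ler_wpM2l (ltW l0) _ _ Kut.
have K0 : 0 < K by clear -Kl ut0; lra.
have lK0 : 0 <= lam * K by rewrite mulr_ge0 ?(ltW l0) ?(ltW K0).
(* Each rough prime exceeds e^(1/lam), so more than 9 lam K of them exceed Z^9; lam K <= t / 4 keeps
   this number below 3 t. *)
have [k0 kb kl] : exists2 k0 : nat, k0%:R <= 3 * t & 9 * (lam * K) < k0%:R.
  exists (Num.truncn (9 * (lam * K))).+1.
    have hh : (Num.truncn (9 * (lam * K)))%:R <= 9 * (lam * K) by rewrite truncn_le mulr_ge0.
    by rewrite -natr1; clear -hh lK t1; lra.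
  have p0 : 0 <= 9 * (lam * K) by rewrite mulr_ge0.
  by have /andP[] := truncn_itv p0.
have x0 : 0 < x by rewrite ex expR_gt0.
have ex' : x = expR (expR t) by rewrite -eL.
have [Lg1 LgT] := log_bounds ex' t1.
set Lg : R := 1 + ln (2 * Num.truncn x)%:R in Lg1 LgT.
have Tt : 26 * t ^+ 2 <= T by clear -Aut u1 t2 tt2 t1; lra.
have T16 : 256 * t <= T.
  by clear -Aut u1 t3; lra.
(* Both [w] and 2 K / w are then at most u: K <= u t / 2 and t <= g. *)
pose w := g.
have sT : 4 * (1 + w + 2 * K / w + 2 * lam * K * expR (lam * K)) <= T.
  have q1 : 2 * K / w <= u.
    rewrite /w ler_pdivrMr//; apply: (@le_trans _ _ (u * t)); first by clear -Kut; lra.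
    by rewrite ler_wpM2l ?(ltW u0)//; clear -G t3 t1; lra.
  have q2 : 2 * lam * K * expR (lam * K) <= u.
    have q3 : expR (lam * K) <= g by rewrite ler_expR.
    have q4 : 2 * lam * K <= t by rewrite -mulrA; clear -lK t0; lra.
    apply: le_trans gu; rewrite [g * t]mulrC; apply: ler_pM => //.
    by rewrite -mulrA mulr_ge0.
  by rewrite /w; clear -q1 q2 ug Aut u1k; lra.
apply: (@S_sub_D_le R x K lam T w k0 h) => //.
- have hh : lam * 16 <= lam * u by rewrite ler_wpM2l ?(ltW l0).
  by clear -hh lu; lra.
- by have hh := expR_ge1Dx K; clear -hh Kl ut1; lra.
- have -> : Num.sqrt x = expR (ln x / 2).
    rewrite {1}ex -[RHS]ger0_norm ?expR_ge0// -sqrtr_sqr -expRM_natl.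
    by congr (Num.sqrt (expR _)); field.
  apply: (@le_trans _ _ (expR K ^+ 16)).
    rewrite exprS ler_wpM2r ?exprn_ge0 ?expR_ge0//.
    by have hh := expR_ge1Dx K; clear -hh Kl ut1; lra.
  rewrite -expRM_natl ler_expR eu.
  apply: (@le_trans _ _ (8 * (u * t))); first by clear -Kut; lra.
  have -> : u ^+ 2 * t / 2 = u / 2 * (u * t) by ring.
  by rewrite ler_wpM2r ?(ltW ut0)//; clear -u1k; lra.
- rewrite -!expRM_natl ltr_expR ilam.
  have -> : 9 * K = 9 * (lam * K) * (2 * u) by rewrite /lam; field; rewrite gt_eqF.
  by rewrite ltr_pM2r// mulr_gt0.
- by clear -Tut Kl ut0; lra.
- by apply: le_trans LgT _; rewrite ler_expR; clear -Tt tt2 t1; lra.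
- by apply: le_trans (totient_factor_le Lg1 LgT t1 kb) _; rewrite ler_expR.
- rewrite eu; have -> : lam * (u ^+ 2 * t) = lam * u * (u * t) by ring.
  by rewrite lu; clear -Kut; lra.
- by rewrite -mulrA; clear -lK Aut u1 t2 t3 tt2 t1 T16; lra.
rewrite ilam; set F := expR (16 * expR 1) in cF *.
have F0 : 0 < F by exact: expR_gt0.
(* The Euler factors above Z cost F (1 + 2 u) <= 3 F u, whereas T is only known to exceed A u. Hence
   A must beat the absolute constant F, which is why c is also bounded in terms of it. *)
have FA : 3 * F <= A.
  by apply: le_trans cA; rewrite -[leRHS]mulr1 ler_pdivlMl.
apply: (@le_trans _ _ (3 * F * u)); last by apply: le_trans AT; rewrite ler_wpM2r ?(ltW u0).
have -> : 3 * F * u = F * (3 * u) by ring.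
by rewrite ler_wpM2l ?(ltW F0)//; clear -u1k; lra.
Qed.

End MainEstimate.

(** * Error functions of the asymptotic formulas and their limits *)

Section ErrorTerms.
Variable R : realType.
Implicit Types c x : R.

Definition relerr_T x : R :=
  par_T x / (calA x * Num.sqrt (ln x / iter_ln 2 x)) - 1.
Definition relerr_J x : R := (par_J x)%:~R / (iter_ln 2 x / calA x) - 2^-1.
Definition relerr_K x : R :=
  (par_K x - (2^-1 - 2 * par_eta x) * calR x) / (par_eta x * calR x).
Definition relerr_moving x : R := 3 * par_T x / (par_eta x * calR x).
(** The exponent solved for its error, with the constant 29 moved into it as [ln 29]. *)
Definition relerr_total x : R := 2^-1 + (ln 29 - par_K x + 3 * par_T x) / calR x.

Let c0 : (0 : R) < 1 / 256. Proof. by rewrite divr_gt0 ?ltr0n. Qed.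

Lemma relerr_TE x : well_placed (1 / 256) x ->
  par_T x = (1 + relerr_T x) * (calA x * Num.sqrt (ln x / iter_ln 2 x)).
Proof.
move=> wp; have [[_ A1 _ _ _] [u0 _ _] _ _ _] := well_placed_params c0 (lexx _) wp.
rewrite /relerr_T; field; rewrite !gt_eqF//; lra.
Qed.

Lemma relerr_JE x : well_placed (1 / 256) x ->
  (par_J x)%:~R = (2^-1 + relerr_J x) * (iter_ln 2 x / calA x).
Proof.
move=> wp; have [[t1 A1 _ _ _] _ _ _ _] := well_placed_params c0 (lexx _) wp.
by rewrite /relerr_J; field; rewrite !gt_eqF//; lra.
Qed.

Lemma relerr_KE x : well_placed (1 / 256) x ->
  par_K x = (2^-1 - 2 * par_eta x + relerr_K x * par_eta x) * calR x.
Proof.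
move=> wp; have [[t1 _ _ _ _] [u0 _ eR] [e0 _ _ _] _ _] := well_placed_params c0 (lexx _) wp.
have R0 : 0 < calR x by rewrite eR mulr_gt0//; lra.
by rewrite /relerr_K; field; rewrite !gt_eqF.
Qed.

Lemma relerr_movingE x : well_placed (1 / 256) x ->
  relerr_moving x * par_eta x * calR x = 3 * par_T x.
Proof.
move=> wp; have [[t1 _ _ _ _] [u0 _ eR] [e0 _ _ _] _ _] := well_placed_params c0 (lexx _) wp.
have R0 : 0 < calR x by rewrite eR mulr_gt0//; lra.
by rewrite /relerr_moving; field; rewrite !gt_eqF.
Qed.

Lemma relerr_totalE x : well_placed (1 / 256) x ->
  29 * (x * expR (- par_K x + relerr_moving x * par_eta x * calR x)) =
  x * expR (- (2^-1 - relerr_total x) * Num.sqrt (ln x * iter_ln 2 x)).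
Proof.
move=> wp; have [[t1 _ _ _ _] [u0 _ eR] [e0 _ _ _] _ _] := well_placed_params c0 (lexx _) wp.
have R0 : 0 < calR x by rewrite eR mulr_gt0//; lra.
rewrite relerr_movingE// -/(calR x) mulrCA; congr (_ * _).
rewrite -[X in X * _](@lnK R 29) ?posrE// -expRD; congr expR.
by rewrite /relerr_total; field; rewrite gt_eqF.
Qed.

Lemma cvg_relerr_T : relerr_T x @[x --> +oo] --> (0 : R).
Proof.
apply: cvg_of_well_placed => c x cp c1 wp.
have [[_ A1 _ _ _] [u0 _ _] [e0 _ _ e1] eT _] := well_placed_params cp c1 wp.
rewrite /relerr_T eT; set e := par_eta x in e0 e1 *.
have d0 : 0 < 1 - 2 * e by lra.
have -> : calA x * Num.sqrt (ln x / iter_ln 2 x) / (1 - 2 * e) /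
   (calA x * Num.sqrt (ln x / iter_ln 2 x)) - 1 = 2 * e / (1 - 2 * e).
  by field; rewrite !gt_eqF//; lra.
rewrite ger0_norm; last by rewrite divr_ge0; lra.
rewrite ler_pdivrMr//.
have : 50 * (c + e) * (7 / 8) <= 50 * (c + e) * (1 - 2 * e) by rewrite ler_wpM2l//; lra.
by lra.
Qed.

Lemma cvg_relerr_J : relerr_J x @[x --> +oo] --> (0 : R).
Proof.
apply: cvg_of_well_placed => c x cp c1 wp.
have [[t1 A1 At _ _] [u0 _ eR] [e0 eA ec e1] eT eK] := well_placed_params cp c1 wp.
have [[T0 _] _ K1 K2 eJ] := well_placed_bounds cp c1 wp.
rewrite /relerr_J; set e := par_eta x in e0 eA ec e1 eT eK K1 K2 *.
set t := iter_ln 2 x in t1 At u0 eR eT eK K1 K2 *; set A := calA x in A1 At eA eT *.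
set u := Num.sqrt _ in u0 eR eT eK K1 K2.
have t0 : 0 < t by lra.
have A0 : 0 < A by lra.
have d0 : 0 < 1 - 2 * e by lra.
(* Multiplication by q normalises J. Here K0 q / T is exactly (1/2 - 2 e)(1 - 2 e), and the unit
   lost to the floor costs at most q <= c. *)
pose q := A / t.
have q0 : 0 < q by rewrite divr_gt0 ?ltr0n.
have qc : q <= c.
  rewrite ler_pdivrMr//; apply: le_trans At; rewrite expr2 ler_peMl ?(ltW A0)//; lra.
have -> : (par_J x)%:~R / (t / A) = par_K x / par_T x * q.
  by rewrite -eJ /q; field; rewrite !gt_eqF.
have kt : (2^-1 - 2 * e) * (u * t) / par_T x * q = (2^-1 - 2 * e) * (1 - 2 * e).
  by rewrite eT /q; field; rewrite !gt_eqF.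
have h1 : par_K x / par_T x * q <= (2^-1 - 2 * e) * (1 - 2 * e).
  rewrite -kt; apply: ler_wpM2r; first exact: ltW.
  by apply: ler_wpM2r => //; rewrite invr_ge0 ltW.
have h2 : (2^-1 - 2 * e) * (1 - 2 * e) - q <= par_K x / par_T x * q.
  have -> : (2^-1 - 2 * e) * (1 - 2 * e) - q =
      ((2^-1 - 2 * e) * (u * t) - par_T x) / par_T x * q.
    by rewrite -kt; field; rewrite gt_eqF.
  apply: ler_wpM2r; first exact: ltW.
  by apply: ler_wpM2r => //; rewrite invr_ge0 ltW.
have e2 : e ^+ 2 <= e by rewrite expr2 ler_piMr ?(ltW e0)//; lra.
have e20 : 0 <= e ^+ 2 by exact: sqr_ge0.
rewrite expr2 in e2 e20.
by rewrite ler_norml; move: h1 h2; move: (_ / _ * q) => v h1 h2; lra.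
Qed.

Lemma cvg_relerr_K : relerr_K x @[x --> +oo] --> (0 : R).
Proof.
apply: cvg_of_well_placed => c x cp c1 wp.
have [[t1 _ _ _ _] [u0 _ eR] [e0 _ _ e1] _ _] := well_placed_params cp c1 wp.
have [[T0 _] Tc K1 K2 _] := well_placed_bounds cp c1 wp.
rewrite /relerr_K; rewrite -eR in K1 K2 Tc.
have R0 : 0 < calR x by rewrite eR mulr_gt0//; lra.
have eR0 : 0 < par_eta x * calR x by rewrite mulr_gt0.
have ceR : 0 < c * (par_eta x * calR x) by rewrite mulr_gt0.
have eeR : 0 < par_eta x * (par_eta x * calR x) by rewrite mulr_gt0.
rewrite ler_norml ler_pdivlMr// ler_pdivrMr//.
have Tc' : par_T x <= 2 * (c * (par_eta x * calR x)) by move: Tc; lra.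
move: K1 K2 Tc' ceR eeR T0.
have -> : - (50 * (c + par_eta x)) * (par_eta x * calR x) =
  - (50 * (c * (par_eta x * calR x)) + 50 * (par_eta x * (par_eta x * calR x))) by ring.
have -> : 50 * (c + par_eta x) * (par_eta x * calR x) =
  50 * (c * (par_eta x * calR x)) + 50 * (par_eta x * (par_eta x * calR x)) by ring.
move: (c * (par_eta x * calR x)) (par_eta x * (par_eta x * calR x)).
move: ((2^-1 - 2 * par_eta x) * calR x) (par_T x) (par_K x) => *.
lra.
Qed.

Lemma cvg_relerr_moving : relerr_moving x @[x --> +oo] --> (0 : R).
Proof.
apply: cvg_of_well_placed => c x cp c1 wp.
have [[t1 _ _ _ _] [u0 _ eR] [e0 _ _ e1] _ _] := well_placed_params cp c1 wp.
have [[T0 _] Tc _ _ _] := well_placed_bounds cp c1 wp.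
rewrite -eR in Tc.
have R0 : 0 < calR x by rewrite eR mulr_gt0//; lra.
have eR0 : 0 < par_eta x * calR x by rewrite mulr_gt0.
rewrite /relerr_moving ger0_norm; last by rewrite divr_ge0 ?(ltW eR0)// mulr_ge0 ?(ltW T0).
rewrite ler_pdivrMr//.
have h : 6 * c * (par_eta x * calR x) <= 50 * (c + par_eta x) * (par_eta x * calR x).
  by rewrite ler_wpM2r ?(ltW eR0)//; lra.
by apply: le_trans h; move: Tc; lra.
Qed.

Lemma cvg_relerr_total : relerr_total x @[x --> +oo] --> (0 : R).
Proof.
apply: cvg_of_well_placed => c x cp c1 wp.
have [[t1 _ _ ex eL] [u0 eu eR] [e0 _ _ e1] _ _] := well_placed_params cp c1 wp.
have [[T0 _] Tc K1 K2 _] := well_placed_bounds cp c1 wp.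
have [_ ct _ _] := wp.
set t := iter_ln 2 x in t1 eL u0 eu eR Tc K1 K2 ct.
set u := Num.sqrt _ in u0 eu eR Tc K1 K2.
have t0 : 0 < t by lra.
have u1 : 1 <= u.
  rewrite leNgt; apply/negP => u1.
  have : u ^+ 2 * t < t by rewrite gtr_pMl// expr_lt1// ltW.
  by rewrite -eu eL; have := expR_ge1Dx t; lra.
have tR : t <= calR x by rewrite eR ler_peMl// ltW.
have R0 : 0 < calR x by lra.
rewrite -eR in Tc K1 K2.
(* As R >= t >= 1 / c, the constant ln 29 is at most 5 c R and disappears in the relative error. *)
have cR : 1 <= c * calR x.
  by rewrite -(mulfV (_ : c != 0)) ?gt_eqF// ler_pM2l//; apply: le_trans tR.
have l29 : 0 <= ln (29 : R) <= 5.
  rewrite ln_ge0 ?ler1n//= -ler_expR lnK ?posrE//.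
  have -> : 5 = 5%:R * 1 :> R by rewrite mulr1.
  rewrite expRM_natl; apply: (@le_trans _ _ (2 ^+ 5)); first by rewrite -natrX ler_nat.
  by apply: lerXn2r; rewrite ?nnegrE ?expR_ge0// two_le_expR1.
have eT : 0 <= par_eta x * calR x by rewrite mulr_ge0 ?ltW.
have ceR : c * par_eta x * calR x <= c * calR x.
  by rewrite ler_wpM2r ?(ltW R0)// ler_piMr ?(ltW cp)//; lra.
rewrite /relerr_total.
have -> : 2^-1 + (ln 29 - par_K x + 3 * par_T x) / calR x =
  (calR x / 2 + ln 29 - par_K x + 3 * par_T x) / calR x by field; rewrite gt_eqF.
rewrite ler_norml ler_pdivlMr// ler_pdivrMr//.
have Tc' : par_T x <= 2 * (c * calR x) by lra.
have -> : 50 * (c + par_eta x) * calR x = 50 * (c * calR x) + 50 * (par_eta x * calR x) by ring.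
have -> : - (50 * (c + par_eta x)) * calR x = - (50 * (c * calR x) + 50 * (par_eta x * calR x)) by ring.
move: K1 K2; have -> : (2^-1 - 2 * par_eta x) * calR x = calR x / 2 - 2 * (par_eta x * calR x) by ring.
move: cR l29 eT Tc' T0; move: (c * calR x) (par_eta x * calR x) (calR x / 2) (par_T x) (par_K x) (ln 29).
by move=> *; lra.
Qed.

End ErrorTerms.

Theorem theorem1p4 (R : realType) :
  (exists2 e : R -> R, e x @[x --> +oo] --> (0 : R) &
     \forall x \near +oo,
       par_T x = (1 + e x) * (calA x * Num.sqrt (ln x / iter_ln 2 x))) /\
  (exists2 e : R -> R, e x @[x --> +oo] --> (0 : R) &
     \forall x \near +oo,
       (par_J x)%:~R = (2^-1 + e x) * (iter_ln 2 x / calA x)) /\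
  (exists2 e : R -> R, e x @[x --> +oo] --> (0 : R) &
     \forall x \near +oo,
       par_K x = (2^-1 - 2 * par_eta x + e x * par_eta x) * calR x) /\
  (exists2 eps : R -> R, eps x @[x --> +oo] --> (0 : R) &
   exists2 C : R, 0 < C &
     (\forall x \near +oo, forall h : nat, (1 <= h)%N -> h%:R <= par_y x ->
        `|(S_phi h x)%:R - (D_phi h (par_Z x) x)%:R| <=
          C * (x * expR (- par_K x + eps x * par_eta x * calR x))) /\
     (exists2 delta : R -> R, delta x @[x --> +oo] --> (0 : R) &
        \forall x \near +oo,
          C * (x * expR (- par_K x + eps x * par_eta x * calR x)) =
            x * expR (- (2^-1 - delta x) * Num.sqrt (ln x * iter_ln 2 x)) /\
          (forall h : nat, (1 <= h)%N -> h%:R <= par_y x ->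
             `|(S_phi h x)%:R - (D_phi h (par_Z x) x)%:R| <=
               x * expR (- (2^-1 - delta x) *
                         Num.sqrt (ln x * iter_ln 2 x))))) /\
  (\forall x \near +oo, forall h : nat, odd h ->
     D_phi h (par_Z x : R) x = 0%N).
Proof.
have c1 : (0 : R) < 1 / 256 by rewrite divr_gt0 ?ltr0n.
have near_wp := near_well_placed c1.
split; [|split; [|split; [|split]]].
- exists (@relerr_T R); first exact: cvg_relerr_T.
  by apply: filterS near_wp => x; exact: relerr_TE.
- exists (@relerr_J R); first exact: cvg_relerr_J.
  by apply: filterS near_wp => x; exact: relerr_JE.
- exists (@relerr_K R); first exact: cvg_relerr_K.
  by apply: filterS near_wp => x; exact: relerr_KE.
- exists (@relerr_moving R); first exact: cvg_relerr_moving.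
  pose c : R := Num.min (1 / 256) (3 * expR (16 * expR 1))^-1.
  have F0 : 0 < 3 * expR (16 * expR 1) :> R by rewrite mulr_gt0// expR_gt0.
  have c0 : 0 < c by rewrite lt_min c1 invr_gt0.
  have c2 : c <= 1 / 256 by rewrite ge_min lexx.
  have c3 : c * (3 * expR (16 * expR 1)) <= 1.
    by rewrite -ler_pdivlMr// mul1r ge_min lexx orbT.
  have est : \forall x \near +oo, forall h : nat, (1 <= h)%N ->
      h%:R <= par_y (x : R) -> `|(S_phi h x)%:R - (D_phi h (par_Z x) x)%:R| <=
      29 * (x * expR (- par_K x + relerr_moving x * par_eta x * calR x)).
    apply: filterS2 near_wp (near_well_placed c0) => x wp1 wp h h1 hy.
    rewrite relerr_movingE//; exact: well_placed_estimate c0 c2 c3 wp h1 hy.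
  exists 29; first by [].
  split=> //.
  exists (@relerr_total R); first exact: cvg_relerr_total.
  apply: filterS2 near_wp est => x wp est.
  have E : 29 * (x * expR (- par_K x + relerr_moving x * par_eta x * calR x)) =
      x * expR (- (2^-1 - relerr_total x) * Num.sqrt (ln x * iter_ln 2 x)).
    exact: relerr_totalE.
  by split=> // h h1 hy; rewrite -E; exact: est.
by apply: filterS near_wp => x _ h; exact: odd_diagonal_empty.
Qed.
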